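(* For every integer $k\geq 3$, let $G_k:=\frac1k\sum_{\ell=0}^{k-1}\delta_{\ell\pi/k}$, and let $p_3(G_k)$ be the probability that the typical cell of the stationary Poisson line tessellation with intensity $1$ and directional distribution $G_k$ is a triangle. Then $$ p_3(G_k) = \frac{4}{k}\tan^2\!\Big(\frac{\pi}{2k}\Big)\sum_{i=1}^{k-2}\Bigg[(k-i)\sum_{j=1}^{k-i-1}\frac{\sin\frac{i\pi}{k}\,\sin\frac{j\pi}{k}\,\sin\frac{(i+j)\pi}{k}}{\sin\frac{i\pi}{k}+\sin\frac{j\pi}{k}+\sin\frac{(i+j)\pi}{k}}\Bigg]. $$
   Context: Lines in the plane are parametrized by pairs $(\theta,d)$, where $\theta\in[0,\pi)$ is the orientation angle the line makes with the (eastern) horizontal axis and $d\in\mathbb{R}$ is its signed distance to the origin. Let $G$ be a probability measure on $[0,\pi)$ (the directional distribution) which is non-degenerate, i.e. $G(\{\theta\})<1$ for every $\theta\in[0,\pi)$, and let $\gamma>0$. The stationary Poisson line process $X=X(\gamma,G)$ with intensity $\gamma$ and directional distribution $G$ is the Poisson process of lines whose intensity measure, in the coordinates $(\theta,d)$, is $\gamma\, G\otimes \mathrm{Leb}$ on $[0,\pi)\times\mathbb{R}$. Almost surely, the lines of $X$ decompose the plane into random convex polygons (cells), which form the Poisson line tessellation. The typical cell $Z=Z(\gamma,G)$ is the random polygon with distribution $$ P_Z(\,\cdot\,) := \frac{1}{\mathbb{E}\sum_{c:\,m(c)\in[0,1]^2}1}\;\mathbb{E}\sum_{c:\,m(c)\in[0,1]^2}\mathbf{1}\{c-m(c)\in\,\cdot\,\},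 $$ where the sums run over all cells $c$ of the tessellation whose lexicographically smallest vertex $m(c)$ lies in $[0,1]^2$. One takes $\gamma=1$, writes $Z(G):=Z(1,G)$, and defines the triangle probability $p_3(G):=\mathbb{P}[\,Z(G)\text{ is a triangle}\,]$. Here $\delta_x$ denotes the Dirac measure at $x$. *)

(* Defs.v *)
From HB Require Import structures.
From mathcomp Require Import all_boot all_order all_algebra.
From mathcomp Require Import all_classical all_reals all_analysis.
From mathcomp Require Import measurable_realfun.

Set Implicit Arguments.
Unset Strict Implicit.
Unset Printing Implicit Defensive.

Import Order.TTheory GRing.Theory Num.Theory.
Import numFieldNormedType.Exports.

Local Open Scope classical_set_scope.
Local Open Scope ring_scope.

Section PoissonProcess.
Context {R : realType} {d d' : measure_display}.
Context {Omega : measurableType d} {T : measurableType d'}.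

Definition point_count (X : Omega -> set T) (B : set T) (w : Omega) : \bar R :=
  counting (X w `&` B).

(* A point process is represented by its random set of points, so multiple
   points are excluded.  This loses no generality for a diffuse intensity
   measure mu, such as the product of any measure with Lebesgue measure. *)
Record poisson_process (P : probability Omega R) (mu : set T -> \bar R)
    (X : Omega -> set T) : Prop := PoissonProcess {
  poisson_process_measurable : forall B, measurable B ->
    measurable_fun [set: Omega] (point_count X B);
  poisson_process_law : forall B, measurable B -> (mu B < +oo)%E ->
    forall n : nat, P [set w | point_count X B w = n%:R%:E] =
      (expR (- fine (mu B)) * fine (mu B) ^+ n / n`!%:R)%:E;
  poisson_process_law_oo : forall B, measurable B -> mu B = +oo%E ->
    P [set w | point_count X B w = +oo%E] = 1%E;
  (* Taking C i = setT for some i gives independence of subfamilies. *)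
  poisson_process_indep : forall (n : nat) (B : 'I_n -> set T),
    (forall i, measurable (B i)) -> trivIset [set: 'I_n] B ->
    forall C : 'I_n -> set (\bar R), (forall i, measurable (C i)) ->
    P (\bigcap_i (point_count X (B i) @^-1` C i)) =
      (\prod_i P (point_count X (B i) @^-1` C i))%E
}.

End PoissonProcess.

Section LineTessellation.
Context {R : realType}.

(* The line with direction (cos theta, sin theta) and signed distance d to the
   origin, measured along the unit normal (- sin theta, cos theta). *)
Definition line (l : R * R) : set (R * R) :=
  [set x | - sin l.1 * x.1 + cos l.1 * x.2 = l.2].

(* Lines are given by their coordinates (theta, d); cells are closed. *)
Definition cells (L : set (R * R)) : set (set (R * R)) :=
  let complement := ~` \bigcup_(l in L) line l in
  [set closure (connected_component complement x) | x in complement].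

Definition vertices (c : set (R * R)) : set (R * R) :=
  [set v | c v /\ forall (x y : R * R) (t : R), c x -> c y -> 0 < t < 1 ->
     v.1 = (1 - t) * x.1 + t * y.1 -> v.2 = (1 - t) * x.2 + t * y.2 ->
     x = v /\ y = v].

Definition lexmin_vertex (c : set (R * R)) (v : R * R) : Prop :=
  vertices c v /\
  forall u, vertices c u -> v.1 < u.1 \/ v.1 = u.1 /\ v.2 <= u.2.

(* Junk value (0, 0) if c has no lexicographically smallest vertex. *)
Definition lexmin (c : set (R * R)) : R * R := xget (0, 0) (lexmin_vertex c).

Definition centered (c : set (R * R)) : set (R * R) :=
  [set (x.1 - (lexmin c).1, x.2 - (lexmin c).2) | x in c].

Definition convex_hull (A : set (R * R)) : set (R * R) :=
  smallest (@convex_set R (R^o * R^o)%type) A.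

Definition triangle (c : set (R * R)) : Prop :=
  exists x y z : R * R,
    ~ (exists l, [/\ line l x, line l y & line l z]) /\
    c = convex_hull [set x; y; z].

(* Cells whose lexicographically smallest vertex exists and lies in [0, 1]^2;
   the junk value of lexmin is never used on these. *)
Definition unit_cells (L : set (R * R)) : set (set (R * R)) :=
  [set c | cells L c /\
           exists2 v, lexmin_vertex c v & (`[0, 1] `*` `[0, 1]) v].

End LineTessellation.

Section TypicalCell.
Context {R : realType} {d : measure_display} {Omega : measurableType d}.

(* The Poisson line process of intensity gamma and directional distribution G,
   as a random set of coordinates (theta, d). *)
Definition poisson_line_process (P : probability Omega R) (gamma : {posnum R})
    (G : {measure set (measurableTypeR R) -> \bar R})
    (X : Omega -> set (measurableTypeR R * measurableTypeR R)) : Prop :=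
  (forall w, X w `<=` `[0, pi[ `*` [set: R]) /\
  poisson_process P
    (fun B => gamma%:num%:E * (G \x (@lebesgue_measure R)) B)%E X.

Definition expected_cells (P : probability Omega R)
    (X : Omega -> set (R * R)) (A : set (set (R * R))) : \bar R :=
  (\int[P]_w \esum_(c in unit_cells (X w)) (\1_A (centered c))%:E)%E.

Definition typical_cell_law (P : probability Omega R)
    (X : Omega -> set (R * R)) (A : set (set (R * R))) : \bar R :=
  ((expected_cells P X setT)^-1 * expected_cells P X A)%E.

Definition triangle_probability (P : probability Omega R)
    (X : Omega -> set (R * R)) : \bar R :=
  typical_cell_law P X [set c | triangle c].

End TypicalCell.

(* Uniform distribution on the k angles l * pi / k, 0 <= l < k (k > 0). *)
Definition equiangular {R : realType} (k : nat) :
    {measure set (measurableTypeR R) -> \bar R} :=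
  mscale (k%:R^-1)%:nng
    (msum (fun l : nat => \d_(l%:R * pi / k%:R : measurableTypeR R)) k).

Lemma equiangular_direction (R : realType) (k : nat) : (0 < k)%N ->
  @equiangular R k [set` `[0, pi[%R] = 1%E /\ @equiangular R k [set: R] = 1%E.
Proof.
move=> k0; have k0' : 0 < k%:R :> R by rewrite ltr0n.
have dirac1 (A : set R) : (forall l, (l < k)%N -> A (l%:R * pi / k%:R)) ->
    @equiangular R k A = 1%E.
  move=> kA; rewrite /equiangular /= /mscale /= /msum /=.
  rewrite (eq_bigr (fun=> 1%:E)) => [|l _]; last first.
    by rewrite diracE mem_set//; exact: kA.
  by rewrite sumEFin -EFinM sumr_const card_ord mulVf// gt_eqF.
split; apply: dirac1 => // l lk /=; rewrite in_itv /=; apply/andP; split.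
  by rewrite divr_ge0 ?mulr_ge0 ?pi_ge0 ?ler0n.
by rewrite ltr_pdivrMr// mulrC ltr_pM2l ?pi_gt0// ltr_nat.
Qed.

(* Main.v *)
(* Almost surely no three lines meet in a point, and then a cell is determined
   by its lexicographically smallest vertex v, which is the crossing of two
   lines; conversely every crossing is the smallest vertex of one cell.  The
   cell is a triangle iff a third line cuts off from the cone spanned at v by
   the lexicographically positive directions of the two lines a triangle whose
   interior is hit by no line.

   Both the cells and the triangles can therefore be counted as triples of
   lines with no line of the process in certain intervals depending on the
   triple.  With intensity 1/k in each direction, the expected number of such
   triples with coordinates y in an open set is the integral of
   k^-3 exp(- w(y)), w(y) being the total mass of the intervals: this is proved
   by isolating the three lines in dyadic boxes and letting the mesh decrease.
   - For all cells the third line is the first one past v in some fixed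
     direction, so that it integrates out and |sin(t1 - t2)| / k^2 remains.
   - For a triangle with third line at distance h from v, w(y) is
     h K (S12 + S13 + S23) / (2 k S13 S23), where Sij = |sin(ti - tj)| and
     K = sum_m sin(m pi / k) = cot(pi / 2k), which leaves
     (2 / (k^2 K)) S12 S13 S23 / (S12 + S13 + S23).  For three given directions
     exactly two of the three choices of the pair (t1, t2) are possible.

   The closed unit square is squeezed between open squares, since only for the
   latter are the counts shown to agree almost surely with measurable functions. *)
From HB Require Import structures.
From mathcomp Require Import finmap.
Require Import Defs.
From mathcomp Require Import all_boot all_order all_algebra.
From mathcomp Require Import all_classical all_reals all_analysis.
From mathcomp Require Import measurable_realfun.
From mathcomp Require Import ring lra zify.

Set Implicit Arguments.
Unset Strict Implicit.
Unset Printing Implicit Defensive.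

Import Order.TTheory GRing.Theory Num.Theory.
Import numFieldNormedType.Exports.

Local Open Scope classical_set_scope.
Local Open Scope ring_scope.

(** * Lines and cells *)

Section Lines.
Context {R : realType}.
Implicit Types (l p q u v : R * R) (L : set (R * R)).

(** The form of w(y): the lines of one direction that meet a triangle fill an interval whose length
    is half the sum of the projections of the three sides. As the directions are equispaced, the
    projections of a segment of any of these directions sum to K times its length, so w(y) is K/(2k)
    times the perimeter h/S13 + h/S23 + h S12/(S13 S23). Two pairs out of three: if the third
    direction lies between the other two, the cone at v contains it, and a line of that direction
    cannot cut both rays. The obstacle is that the process is known only through counts in fixed
    sets, while the intervals move with the triple. On a dyadic box they are replaced by slightly
    larger ones that depend on the box alone. These shrink under refinement, so both the counts and
    the densities increase and monotone convergence applies to each. In the limit the closed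
    intervals matter instead of the open ones; a line touching only an end would pass through the
    crossing of two others, which almost surely does not happen. That last fact is the same formula
    with no void condition and a thin range for the third line. *)

Definition slope (theta : R) u : R := - sin theta * u.1 + cos theta * u.2.

Definition side l q : R := slope l.1 q - l.2.

Definition mv v u (s : R) : R * R := (v.1 + s * u.1, v.2 + s * u.2).

Lemma lineE l q : line l q <-> side l q = 0.
Proof.
rewrite /line /side /slope /=; split => [->|/eqP]; first by rewrite subrr.
by rewrite subr_eq0 => /eqP.
Qed.

Lemma side_mv l v u s : side l (mv v u s) = side l v + s * slope l.1 u.
Proof. rewrite /side /slope /mv /=; ring. Qed.

Lemma continuous_side l : continuous (side l).
Proof.
move=> q; apply: cvgB; last exact: cvg_cst.
apply: cvgD; apply: cvgM; try exact: cvg_cst.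
- exact: cvg_fst.
- exact: cvg_snd.
Qed.

Lemma small_step u (e : R) : 0 < e ->
  exists2 t0 : R, 0 < t0 <= 1 &
    forall t, `|t| <= t0 -> `|t * u.1| < e /\ `|t * u.2| < e.
Proof.
move=> e0; set D := `|u.1| + `|u.2| + e.
have n1 : 0 <= `|u.1| by []. have n2 : 0 <= `|u.2| by [].
have D0 : 0 < D by rewrite /D; lra.
exists (e / D).
  by rewrite divr_gt0//= ler_pdivrMr// mul1r /D; lra.
move=> t; rewrite ler_pdivlMr// => tD; rewrite !normrM.
have t_0 : 0 <= `|t| by [].
split; [have [->|t1] := eqVneq t 0|have [->|t1] := eqVneq t 0];
  rewrite ?normr0 ?mul0r//.
- apply: lt_le_trans tD; rewrite ltr_pM2l ?normr_gt0// /D; lra.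
- apply: lt_le_trans tD; rewrite ltr_pM2l ?normr_gt0// /D; lra.
Qed.

Definition off_lines L p := forall l, L l -> side l p != 0.

Lemma complement_lines L : ~` (\bigcup_(l in L) line l) = off_lines L.
Proof.
apply/seteqP; split => q /=.
  by move=> nq l Ll; apply/eqP => lq; apply: nq; exists l => //; apply/lineE.
by move=> offq [l Ll /lineE lq]; move: (offq l Ll); rewrite lq eqxx.
Qed.

Definition cell_of L p := [set q | forall l, L l -> 0 <= side l p * side l q].

(** On a connected set avoiding the line [l], [side l] cannot change sign, by the intermediate value
    property. Conversely the segment from [p] to a point with the same signs avoids every line. *)
Lemma component_sides L p : off_lines L p ->
  connected_component (~` (\bigcup_(l in L) line l)) p =
  [set q | forall l, L l -> 0 < side l p * side l q].
Proof.
move=> offp; rewrite complement_lines; apply/seteqP; split => q /=.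
  move=> [C [Cp Coff Cconn] Cq] l Ll.
  have /connected_intervalP itvC : connected (side l @` C).
    apply: connected_continuous_connected => //.
    by apply: continuous_subspaceT => x; exact: continuous_side.
  rewrite lt_neqAle eq_sym mulf_neq0 ?(offp l)//=; last exact: (Coff _ Cq).
  rewrite leNgt; apply/negP => neg.
  have [x Cx xl0] : (side l @` C) 0.
    have [sp|sp] := ltP 0 (side l p).
      have sq : side l q <= 0 by rewrite pmulr_rlt0// in neg; exact: ltW.
      by apply: (itvC (side l q) (side l p)); [exists q|exists p|rewrite sq ltW].
    have {}sp : side l p < 0 by rewrite lt_neqAle sp offp.
    have sq : 0 <= side l q by rewrite nmulr_rlt0// in neg; exact: ltW.
    by apply: (itvC (side l p) (side l q)); [exists p|exists q|rewrite sq ltW].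
  by move: (Coff x Cx l Ll); rewrite xl0 eqxx.
move=> pq.
pose u : R * R := (q.1 - p.1, q.2 - p.2).
exists (mv p u @` `[0, 1]); last first.
  exists 1; first by rewrite /= in_itv /= ler01 lexx.
  by rewrite /mv /u /= !mul1r (addrC p.1) (addrC p.2) !subrK -surjective_pairing.
split.
- exists 0; first by rewrite /= in_itv /= ler01 lexx.
  by rewrite /mv !mul0r !addr0 -surjective_pairing.
- move=> x [t /=]; rewrite in_itv /= => /andP[t0 t1] <- l Ll.
  have -> : side l (mv p u t) = (1 - t) * side l p + t * side l q.
    rewrite /side /slope /mv /u /=; ring.
  have /= pql := pq l Ll.
  have pp : 0 < side l p * side l p by rewrite -expr2 exprn_even_gt0//= offp.
  apply/eqP => e0.
  have : 0 < (1 - t) * (side l p * side l p) + t * (side l p * side l q).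
    have [->|tn] := eqVneq t 0; first by rewrite subr0 mul1r mul0r addr0.
    apply: ltr_wpDl; first by rewrite mulr_ge0 ?subr_ge0// ltW.
    by rewrite mulr_gt0// lt_neqAle eq_sym tn.
  rewrite (_ : _ + _ = side l p * ((1 - t) * side l p + t * side l q)); last ring.
  by rewrite e0 mulr0 ltxx.
- apply: connected_continuous_connected; first exact: segment_connected.
  apply: continuous_subspaceT => t.
  have lin (a b : R) : (a + s * b) @[s --> t] --> a + t * b.
    apply: cvgD; first exact: cvg_cst.
    by apply: cvgM; [exact: cvg_id|exact: cvg_cst].
  exact: (cvg_pair (lin p.1 u.1) (lin p.2 u.2)).
Qed.

(** Moving a point of the closed set slightly towards [p] makes all the inequalities strict at once,
    because those at [p] are strict. *)
Lemma closure_sides L p : off_lines L p ->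
  closure [set q | forall l, L l -> 0 < side l p * side l q] = cell_of L p.
Proof.
move=> offp; apply/seteqP; split => x /=.
  move=> clx l Ll; rewrite leNgt; apply/negP => neg.
  have nB : nbhs x [set y | side l p * side l y < 0].
    have cf : continuous (fun y => side l p * side l y).
      by move=> y; apply: cvgM; [exact: cvg_cst|exact: continuous_side].
    by apply: (cf x [set z : R | z < 0]); exact: lt_nbhsl.
  have [y [/(_ l Ll) /= y1 /=]] := clx _ nB.
  by rewrite ltNge (ltW y1).
move=> xc B /nbhs_ballP [e /= e0 eB].
have [t0 /andP[t00 t01] t0P] := small_step (p.1 - x.1, p.2 - x.2) e0.
exists (mv x (p.1 - x.1, p.2 - x.2) t0); split => /=.
  move=> l Ll.
  have -> : side l (mv x (p.1 - x.1, p.2 - x.2) t0) =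
      (1 - t0) * side l x + t0 * side l p.
    rewrite /side /slope /mv /=; ring.
  have pp : 0 < side l p * side l p by rewrite -expr2 exprn_even_gt0//= offp.
  have /= xl := xc l Ll.
  rewrite mulrDr mulrCA (mulrCA _ t0).
  by apply: ltr_wpDl; [rewrite mulr_ge0// subr_ge0|rewrite mulr_gt0].
have [|b1 b2] := t0P t0; first by rewrite gtr0_norm.
by apply: eB; split; rewrite /ball/= /mv/= opprD addrA subrr sub0r normrN.
Qed.

Lemma cellsE L : cells L = [set cell_of L p | p in off_lines L].
Proof.
rewrite /cells complement_lines; apply/seteqP; split => c [p offp <-].
  by exists p => //; rewrite -closure_sides// -component_sides// complement_lines.
by exists p => //; rewrite -complement_lines component_sides// closure_sides.
Qed.

Lemma finite_pos_lb (T : choiceType) (A : set T) (g : T -> R) :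
  finite_set A -> (forall a, A a -> 0 < g a) ->
  exists2 e : R, 0 < e & forall a, A a -> e <= g a.
Proof.
move=> /finite_seqP[s ->]; elim: s => [|a s IH] gpos.
  by exists 1 => // a; rewrite /= in_nil.
have [b bs|e e0 eP] := IH; first by apply: gpos; rewrite /= in_cons bs orbT.
exists (Num.min e (g a)).
  by rewrite lt_min e0 gpos//= mem_head.
move=> b; rewrite /= in_cons => /predU1P[->|bs]; first by rewrite ge_min lexx orbT.
by rewrite ge_min eP.
Qed.

Definition locally_finite L :=
  forall M : R, finite_set [set l | L l /\ `|l.2| <= M].

Lemma sin_le_norm (a b : R) : `|sin a * b| <= `|b|.
Proof.
rewrite normrM ler_piMl// ler_norml; apply/andP; split; [exact: sin_geN1|exact: sin_le1].
Qed.

Lemma cos_le_norm (a b : R) : `|cos a * b| <= `|b|.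
Proof.
rewrite normrM ler_piMl// ler_norml; apply/andP; split; [exact: cos_geN1|exact: cos_le1].
Qed.

Lemma slope_le theta u : `|slope theta u| <= `|u.1| + `|u.2|.
Proof.
rewrite /slope mulNr (le_trans (ler_normD _ _))// normrN.
by apply: lerD; [exact: sin_le_norm|exact: cos_le_norm].
Qed.

(** A line far from the origin stays at distance at least 1 from [v]; only finitely many others
    remain, so the distances of [v] to the lines not through it have a positive lower bound. *)
Lemma local_sign L v : locally_finite L ->
  exists2 e : R, 0 < e & forall q, `|q.1 - v.1| < e -> `|q.2 - v.2| < e ->
    forall l, L l -> side l v != 0 -> 0 < side l v * side l q.
Proof.
move=> finL; pose M := `|v.1| + `|v.2| + 1.
have fin1 : finite_set [set l | [/\ L l, `|l.2| <= M & side l v != 0]].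
  by apply: sub_finite_set (finL M) => l /= [].
have [e e0 eP] := finite_pos_lb (g := fun l => `|side l v|) fin1 
  (fun l => fun '(And3 _ _ h) => etrans (normr_gt0 _) h).
have key l : L l -> side l v != 0 -> Num.min e 1 <= `|side l v|.
  move=> Ll lv; have [lM|lM] := leP `|l.2| M; first by rewrite ge_min eP.
  rewrite ge_min; apply/orP; right; rewrite /side.
  have := slope_le l.1 v; have := lerB_dist l.2 (slope l.1 v).
  by rewrite distrC; move: lM; rewrite /M; lra.
(* Halved because [slope_le] bounds the change of [side] by the sum of both coordinate
   differences. *)
exists (Num.min e 1 / 2); first by rewrite divr_gt0// lt_min e0 ltr01.
move=> q q1 q2 l Ll lv; have kl := key l Ll lv.
have -> : side l q = side l v + slope l.1 (q.1 - v.1, q.2 - v.2).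
  rewrite /side /slope /=; ring.
have := slope_le l.1 (q.1 - v.1, q.2 - v.2) => /=.
set s := slope _ _ => sle.
have {}sle : `|s| < `|side l v| by lra.
move: sle; set a := side l v in lv *.
have [a0|a0] := ltP 0 a.
  rewrite (gtr0_norm a0) ltr_norml => /andP[s1 s2].
  by rewrite mulr_gt0//; lra.
have {}a0 : a < 0 by rewrite lt_neqAle lv.
rewrite (ltr0_norm a0) ltr_norml opprK => /andP[s1 s2].
by rewrite nmulr_rgt0//; lra.
Qed.

Lemma local_sign_mv L v u : locally_finite L ->
  exists2 t0 : R, 0 < t0 & forall t, `|t| <= t0 ->
    forall l, L l -> side l v != 0 -> 0 < side l v * side l (mv v u t).
Proof.
move=> finL; have [e e0 eP] := local_sign v finL.
have [t0 /andP[t00 _] t0P] := small_step u e0.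
exists t0 => // t /t0P[t1 t2] l Ll lv.
by apply: eP => //=; rewrite addrAC subrr add0r.
Qed.

End Lines.

(** * Lexicographically smallest vertices and triangular cells *)

Section Directions.
Context {R : realType}.
Implicit Types (l p q u v x : R * R) (theta phi : R).

Definition lexpos u := (0 < u.1) || ((u.1 == 0) && (0 < u.2)).

(** Of the two unit vectors along a line of angle [theta], the lexicographically positive one: a
    smallest vertex sees the two edges at it in such directions. In [[0, pi[] the sign changes only
    past [pi / 2]. *)
Definition dirv theta : R * R :=
  if lexpos (cos theta, sin theta) then (cos theta, sin theta)
  else (- cos theta, - sin theta).

Lemma dirvE theta : exists2 s : R, s ^+ 2 = 1 &
  dirv theta = (s * cos theta, s * sin theta).
Proof.
rewrite /dirv; case: ifPn => _.
  by exists 1; rewrite ?expr1n// !mul1r.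
by exists (-1); rewrite ?sqrrN ?expr1n// !mulN1r.
Qed.

Lemma lexpos_dirv theta : lexpos (dirv theta).
Proof.
rewrite /dirv; case: ifPn => //; rewrite /lexpos /= negb_or negb_and -!leNgt.
move=> /andP[c0 /orP cs].
rewrite oppr_gt0 oppr_eq0; have [c1|cn] := eqVneq (cos theta) 0.
  case: cs => [|s0]; first by rewrite c1 eqxx.
  rewrite c1 ltxx /= oppr_gt0 lt_neqAle s0 andbT.
  apply/eqP => s1; have := cos2Dsin2 theta.
  by rewrite c1 s1 expr0n addr0 => /eqP; rewrite eq_sym oner_eq0.
by rewrite lt_neqAle cn c0.
Qed.

Lemma lexpos_neq0 u : lexpos u -> u.1 != 0 \/ u.2 != 0.
Proof.
by case/orP => [u1|/andP[_ u2]]; [left|right]; rewrite gt_eqF.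
Qed.

Lemma slope_dirv theta : slope theta (dirv theta) = 0.
Proof. have [s _ ->] := dirvE theta; rewrite /slope /=; ring. Qed.

Lemma norm_slope_dirv theta phi : `|slope theta (dirv phi)| = `|sin (phi - theta)|.
Proof.
have [s s1 ->] := dirvE phi.
have ns : `|s| = 1.
  by apply/eqP; rewrite -(eqrXn2 (n := 2))// ?expr1n ?normrX ?s1 ?normr1// -normrX s1 normr1.
rewrite -[RHS]mul1r -ns -normrM; congr (`|_|); rewrite sinB /slope /=; ring.
Qed.

Lemma slope_eq0 theta u : slope theta u = 0 ->
  exists c, u = (c * (dirv theta).1, c * (dirv theta).2).
Proof.
have [s s1 ->] := dirvE theta; rewrite /slope /= => u0.
have cs := cos2Dsin2 theta.
exists (s * (cos theta * u.1 + sin theta * u.2)).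
rewrite [LHS]surjective_pairing; congr (_, _).
  rewrite [RHS](_ : _ = s ^+ 2 * ((cos theta ^+ 2 + sin theta ^+ 2) * u.1
    + sin theta * (- sin theta * u.1 + cos theta * u.2))); last ring.
  by rewrite s1 cs u0 mulr0 addr0 !mul1r.
rewrite [RHS](_ : _ = s ^+ 2 * ((cos theta ^+ 2 + sin theta ^+ 2) * u.2
  - cos theta * (- sin theta * u.1 + cos theta * u.2))); last ring.
by rewrite s1 cs u0 mulr0 subr0 !mul1r.
Qed.

Lemma slope_scale theta c u : slope theta (c * u.1, c * u.2) = c * slope theta u.
Proof. rewrite /slope /=; ring. Qed.

Lemma same_angle l l' v : side l v = 0 -> side l' v = 0 -> l.1 = l'.1 -> l = l'.
Proof.
case: l l' => [a b] [a' b'] /=; rewrite /side /= => h1 h2 aa.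
by subst a'; congr (_, _); lra.
Qed.

Lemma on_ray l v x u : side l v = 0 -> side l x = 0 -> slope l.1 u = 0 ->
  u.1 != 0 \/ u.2 != 0 -> exists a, x = mv v u a.
Proof.
move=> lv lx lu u0.
have [c uE] := slope_eq0 lu.
have c0 : c != 0.
  by apply/eqP => c0; move: u0; rewrite uE c0 /= !mul0r eqxx => -[].
have [|c' wE] := @slope_eq0 l.1 (x.1 - v.1, x.2 - v.2).
  by move: lv lx; rewrite /side /slope /=; lra.
case: wE => e1 e2.
exists (c' / c); rewrite [LHS]surjective_pairing /mv uE /=.
by congr (_, _); rewrite mulrA divfK// -?e1 -?e2; ring.
Qed.

Lemma same_sign (a b c : R) : 0 < a * b -> 0 < b * c -> 0 < a * c.
Proof.
move=> ab bc.
have b2 : 0 < b ^+ 2.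
  rewrite exprn_even_gt0//=; apply/eqP => b0.
  by move: ab; rewrite b0 mulr0 ltxx.
by rewrite -(pmulr_rgt0 _ b2) (_ : b ^+ 2 * (a * c) = (a * b) * (b * c));
  [rewrite mulr_gt0|ring].
Qed.

Lemma ge0_div (m s : R) : m != 0 -> 0 <= m * s -> 0 <= s / m.
Proof.
move=> m0 ms; have -> : s / m = (m * s) * m^-1 ^+ 2 by field.
by rewrite mulr_ge0// sqr_ge0.
Qed.

End Directions.

(** * Cells and their smallest vertices for a line configuration in general position *)

Section GoodLines.
Context {R : realType}.
Implicit Types (l p q u v x : R * R) (theta phi : R).
Variable Theta : set R.
Hypothesis sin_angles : forall a b, Theta a -> Theta b -> a <> b -> sin (b - a) != 0.
Hypothesis two_angles : forall a, Theta a -> exists2 b, Theta b & b <> a.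

(** The almost sure properties from which all the geometry is deduced for a fixed sample: finiteness
    makes small moves harmless, unboundedness in each direction stops every ray inside a cell, and
    simplicity leaves exactly two lines at a crossing. *)
Record good_lines (L : set (R * R)) : Prop := GoodLines {
  good_angle : forall l, L l -> Theta l.1;
  good_finite : locally_finite L;
  good_unbounded : forall theta M, Theta theta ->
    (exists l, [/\ L l, l.1 = theta & M < l.2]) /\
    (exists l, [/\ L l, l.1 = theta & l.2 < M]);
  good_simple : forall l1 l2 l3 q, L l1 -> L l2 -> L l3 ->
    side l1 q = 0 -> side l2 q = 0 -> side l3 q = 0 ->
    [\/ l1 = l2, l1 = l3 | l2 = l3]
}.

Lemma slope_dirv_neq0 a b : Theta a -> Theta b -> a <> b -> slope a (dirv b) != 0.
Proof. by move=> Ta Tb ab; rewrite -normr_gt0 norm_slope_dirv normr_gt0 sin_angles. Qed.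

Variable L : set (R * R).
Hypothesis goodL : good_lines L.

Lemma crossing_angles l1 l2 v : side l1 v = 0 -> side l2 v = 0 -> l1 <> l2 ->
  l1.1 <> l2.1.
Proof. by move=> l1v l2v l12 ?; apply: l12; exact: same_angle l1v l2v _. Qed.

Lemma crossing_only l1 l2 l v : L l1 -> L l2 -> L l -> l1 <> l2 ->
  side l1 v = 0 -> side l2 v = 0 -> side l v = 0 -> l = l1 \/ l = l2.
Proof.
move=> L1 L2 Ll l12 v1 v2 lv.
by have [//|->|->] := good_simple goodL L1 L2 Ll v1 v2 lv; [left|right].
Qed.

(** By [local_sign_mv] only the lines through [v] can obstruct a short move from [v]. *)
Lemma cell_stay p v u : off_lines L p -> cell_of L p v ->
  (forall l, L l -> side l v = 0 -> 0 <= side l p * slope l.1 u) ->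
  exists2 t, 0 < t & cell_of L p (mv v u t).
Proof.
move=> offp cv cu; have [t t0 tP] := local_sign_mv v u (good_finite goodL).
exists t => // l Ll; have [lv|lv] := eqVneq (side l v) 0.
  by rewrite side_mv lv add0r mulrCA mulr_ge0 ?cu// ltW.
have pv : 0 < side l p * side l v.
  by rewrite lt_neqAle eq_sym mulf_neq0 ?(offp l)//= cv.
by apply/ltW/(same_sign pv)/tP => //; rewrite gtr0_norm.
Qed.

(** The last point of the ray in the cell is a vertex: the line [l] carrying the ray bounds the
    cell, so a segment of the cell through that point lies on [l], where it cannot extend
    further. *)
Lemma ray_exit p v u l : off_lines L p -> cell_of L p v -> L l ->
  side l v = 0 -> slope l.1 u = 0 -> u.1 != 0 \/ u.2 != 0 ->
  exists2 s, vertices (cell_of L p) (mv v u s) &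
    forall t, 0 <= t -> cell_of L p (mv v u t) -> t <= s.
Proof.
move=> offp cv Ll lv lu u0.
have [b Tb bl] := two_angles (good_angle goodL Ll).
have su : slope b u != 0.
  have [c uE] := slope_eq0 lu.
  rewrite uE slope_scale mulf_neq0//; last exact: slope_dirv_neq0 (good_angle goodL Ll) _.
  by apply/eqP => c0; move: u0; rewrite uE c0 /= !mul0r eqxx => -[].
pose S := [set s | 0 <= s /\ cell_of L p (mv v u s)].
have S0 : S 0 by split=> //; rewrite /mv !mul0r !addr0 -surjective_pairing.
have [B SB] : exists B, ubound S B.
  (* A line of a second direction that crosses the ray ahead of [v]; the cell cannot pass it. *)
  have [m [Lm mb ms]] : exists m, [/\ L m, m.1 = b & side m v * slope b u < 0].
    have [[m1 [L1 a1 d1]] [m2 [L2 a2 d2]]] := good_unbounded goodL (slope b v) Tb.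
    have [sp|sp] := ltP 0 (slope b u).
      by exists m1; split => //; rewrite pmulr_llt0// /side a1 subr_lt0.
    have {}sp : slope b u < 0 by rewrite lt_neqAle su.
    exists m2; split => //; rewrite nmulr_llt0//.
    by rewrite /side a2 subr_gt0.
  exists (- side m v / slope b u) => s [s0 /(_ m Lm)].
  have := cv m Lm; rewrite side_mv mb => mpv mps.
  have mv0 : side m v != 0 by apply/eqP => z; move: ms; rewrite z mul0r ltxx.
  have {}mpv : 0 < side m p * side m v.
    by rewrite lt_neqAle eq_sym mulf_neq0 ?(offp m).
  have h : 0 <= side m v * (side m v + s * slope b u).
    have pp : 0 < side m p ^+ 2 by rewrite exprn_even_gt0//= offp.
    rewrite -(pmulr_rge0 _ pp) (_ : side m p ^+ 2 * _ = (side m p * side m v) *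
      (side m p * (side m v + s * slope b u))); last ring.
    by rewrite mulr_ge0// ltW.
  have [sp|sp] := ltP 0 (slope b u).
    rewrite ler_pdivlMr//; rewrite pmulr_llt0// in ms.
    by rewrite nmulr_rge0// in h; lra.
  have {}sp : slope b u < 0 by rewrite lt_neqAle su.
  rewrite ler_ndivlMr//; rewrite nmulr_llt0// in ms.
  by rewrite pmulr_rge0// in h; lra.
have supS : has_sup S by split; [exists 0|exists B].
have Sle s : S s -> s <= sup S by move=> ?; apply: ub_le_sup => //; exists B.
have sup0 : 0 <= sup S by exact: Sle.
(* For each line the condition is an affine inequality in the parameter, so it passes to the
   supremum. *)
have csup : cell_of L p (mv v u (sup S)).
  move=> m Lm; rewrite side_mv.
  have [b0|b0] := leP 0 (side m p * slope m.1 u).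
    by rewrite mulrDr addr_ge0 ?cv// mulrCA mulr_ge0.
  have : sup S <= (side m p * side m v) / - (side m p * slope m.1 u).
    apply: ge_sup => [|s [s0 /(_ m Lm)]]; first by exists 0.
    by rewrite side_mv ler_pdivlMr ?oppr_gt0//; lra.
  by rewrite ler_pdivlMr ?oppr_gt0//; lra.
exists (sup S); last by move=> t t0 ct; apply: Sle.
split => // x y t cx cy /andP[t0 t1] e1 e2.
(* Both endpoints of the segment have nonnegative products with [side l p], and their convex
   combination is 0: both lie on [l]. Their parameters are at most the supremum and average to it,
   hence equal it. *)
have lsum : (1 - t) * (side l p * side l x) + t * (side l p * side l y) = 0.
  have e : side l (mv v u (sup S)) = (1 - t) * side l x + t * side l y.
    rewrite /side /slope e1 e2; ring.
  by rewrite mulrCA (mulrCA t) -mulrDr -e side_mv lv lu mulr0 addr0 mulr0.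
have lx0 := cx l Ll; have ly0 := cy l Ll.
have t1' : 0 < 1 - t by lra.
have /andP[] : (side l p * side l x == 0) && (side l p * side l y == 0).
  move/eqP: lsum; rewrite paddr_eq0; [|exact: mulr_ge0 (ltW t1') lx0|
    exact: mulr_ge0 (ltW t0) ly0].
  by rewrite !(mulf_eq0 (1 - t)) !(mulf_eq0 t) (gt_eqF t0) (gt_eqF t1') /=.
rewrite !mulf_eq0 (negbTE (offp l Ll)) /= => /eqP lx /eqP ly.
have [a xE] := on_ray lv lx lu u0.
have [a' yE] := on_ray lv ly lu u0.
have le1 : a <= sup S.
  have [a0|a0] := leP 0 a; last by exact: le_trans (ltW a0) _.
  by apply: Sle; split=> //; rewrite -xE.
have le2 : a' <= sup S.
  have [a0|a0] := leP 0 a'; last by exact: le_trans (ltW a0) _.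
  by apply: Sle; split=> //; rewrite -yE.
have sE : sup S = (1 - t) * a + t * a'.
  move: e1 e2; rewrite xE yE /mv /= => e1 e2.
  case: u0 => u0; apply: (mulIf u0).
    lra.
  lra.
have : (1 - t) * (sup S - a) + t * (sup S - a') = 0 by ring: sE.
move/eqP; rewrite paddr_eq0 ?mulr_ge0 ?subr_ge0// ?(ltW t0)// ?(ltW t1)//.
rewrite !mulf_eq0 (gt_eqF t0) (gt_eqF t1') /= !subr_eq0.
by move=> /andP[/eqP ea /eqP ea']; rewrite {1}xE {1}yE -ea -ea'.
Qed.

Lemma crossing_or_direction v :
  (exists l1 l2, [/\ L l1, L l2, l1.1 < l2.1, side l1 v = 0 & side l2 v = 0]) \/
  (exists2 u : R * R, u.1 != 0 \/ u.2 != 0 &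
     forall l, L l -> side l v = 0 -> slope l.1 u = 0).
Proof.
have [[l1 [L1 v1]]|nol] := pselect (exists l, L l /\ side l v = 0); last first.
  right; exists (1, 0); first by left; rewrite oner_eq0.
  by move=> l Ll lv; case: nol; exists l.
have [[l2 [L2 v2 l12]]|nol] :=
  pselect (exists l, [/\ L l, side l v = 0 & l1 <> l]); last first.
  right; exists (dirv l1.1); first exact/lexpos_neq0/lexpos_dirv.
  move=> l Ll lv; have [<-|l1l] := pselect (l1 = l); first exact: slope_dirv.
  by case: nol; exists l.
left; have [a12|a12|a12] := ltgtP l1.1 l2.1; [by exists l1, l2|by exists l2, l1|].
by case: (crossing_angles v1 v2 l12).
Qed.

(** If at most one line passed through [v], a short move along it in either direction would stay in
    the cell, and [v] would be the midpoint of a segment of the cell. *)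
Lemma vertex_crossing p v : off_lines L p -> vertices (cell_of L p) v ->
  exists l1 l2, [/\ L l1, L l2, l1.1 < l2.1, side l1 v = 0 & side l2 v = 0].
Proof.
move=> offp [cv ext]; have [//|[u u0 uP]] := crossing_or_direction v.
have [t t0 tP] := local_sign_mv v u (good_finite goodL).
have stay s : `|s| <= t -> cell_of L p (mv v u s).
  move=> st l Ll; have [lv|lv] := eqVneq (side l v) 0.
    by rewrite side_mv lv add0r uP// !mulr0.
  have pv : 0 < side l p * side l v.
    by rewrite lt_neqAle eq_sym mulf_neq0 ?(offp l)//= cv.
  by apply/ltW/(same_sign pv)/tP.
have [] := ext (mv v u t) (mv v u (- t)) 2^-1.
- by apply: stay; rewrite gtr0_norm.
- by apply: stay; rewrite normrN gtr0_norm.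
- lra.
- rewrite /mv /=; lra.
- rewrite /mv /=; lra.
move=> vE _; case: u0 => /eqP u0; case: u0.
  have /eqP : t * u.1 = 0 by move: (congr1 fst vE) => /=; lra.
  by rewrite mulf_eq0 (gt_eqF t0) /= => /eqP.
have /eqP : t * u.2 = 0 by move: (congr1 snd vE) => /=; lra.
by rewrite mulf_eq0 (gt_eqF t0) /= => /eqP.
Qed.

(** Otherwise the ray from [v] along [l1] in the negative lexicographic direction would start inside
    the cell, and [ray_exit] would end it at a smaller vertex. *)
Lemma sign_lexmin p v l1 l2 : off_lines L p -> lexmin_vertex (cell_of L p) v ->
  L l1 -> L l2 -> side l1 v = 0 -> side l2 v = 0 -> l1 <> l2 ->
  0 < side l2 p * slope l2.1 (dirv l1.1).
Proof.
move=> offp [[cv ext] lexm] L1 L2 v1 v2 l12.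
have a12 := crossing_angles v1 v2 l12.
have n2 : side l2 p * slope l2.1 (dirv l1.1) != 0.
  have T1 := good_angle goodL L1; have T2 := good_angle goodL L2.
  rewrite mulf_neq0 ?offp// slope_dirv_neq0//.
  exact/nesym.
rewrite lt_neqAle eq_sym n2 /= leNgt; apply/negP => neg.
pose u : R * R := (-1 * (dirv l1.1).1, -1 * (dirv l1.1).2).
have u0 : u.1 != 0 \/ u.2 != 0.
  rewrite /u /= !mulN1r !oppr_eq0; exact/lexpos_neq0/lexpos_dirv.
have u1 : slope l1.1 u = 0 by rewrite slope_scale slope_dirv mulr0.
have [t t0 ct] : exists2 t, 0 < t & cell_of L p (mv v u t).
  apply: cell_stay => // l Ll lv.
  have [->|->] := crossing_only L1 L2 Ll l12 v1 v2 lv.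
    by rewrite u1 mulr0.
  by rewrite slope_scale mulN1r mulrN oppr_ge0 ltW.
have [s vs /(_ t (ltW t0) ct) ts] := ray_exit offp cv L1 v1 u1 u0.
have s0 : 0 < s by exact: lt_le_trans ts.
have := lexm _ vs; rewrite /mv /u /= => -[|[]].
  rewrite mulN1r mulrN ltrDl oppr_gt0 pmulr_rlt0// => neg1.
  move: neg1; rewrite ltNge => /negP; apply.
  by case/orP: (lexpos_dirv l1.1) => [/ltW//|/andP[/eqP -> _]].
move=> e1; have {}e1 : (dirv l1.1).1 = 0.
  have /eqP : s * (dirv l1.1).1 = 0 by lra.
  by rewrite mulf_eq0 (gt_eqF s0) /= => /eqP.
have := lexpos_dirv l1.1; rewrite /lexpos e1 ltxx eqxx /= => d2 le2.
have : 0 < s * (dirv l1.1).2 by rewrite mulr_gt0.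
lra.
Qed.

Lemma cell_of_eq p q : off_lines L p -> off_lines L q ->
  (forall l, L l -> 0 < side l p * side l q) -> cell_of L p = cell_of L q.
Proof.
move=> offp offq pq; apply/seteqP; split=> x cx l Ll;
  have := pq l Ll; have := cx l Ll; rewrite !le_eqVlt => /predU1P[/esym/eqP|].
- by rewrite mulf_eq0 (negbTE (offp l Ll)) /= => /eqP -> _; rewrite mulr0 eqxx.
- by move=> ?; rewrite mulrC => ?; apply/orP; right; apply: same_sign; eassumption.
- by rewrite mulf_eq0 (negbTE (offq l Ll)) /= => /eqP -> _; rewrite mulr0 eqxx.
- by move=> ? ?; apply/orP; right; apply: same_sign; eassumption.
Qed.

(** The sides of the two lines through [v] are fixed by [sign_lexmin], those of all other lines by
    the position of [v] itself. *)
Lemma lexmin_cell_uniq c c' v : cells L c -> cells L c' ->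
  lexmin_vertex c v -> lexmin_vertex c' v -> c = c'.
Proof.
rewrite cellsE => -[p offp <-] [p' offp' <-] cv cv'; apply: cell_of_eq => // l Ll.
have [l1 [l2 [L1 L2 a12 v1 v2]]] := (vertex_crossing offp cv.1).
have l12 : l1 <> l2 by move=> e; move: a12; rewrite e ltxx.
have [lv|lv] := eqVneq (side l v) 0.
  have key m m' : L m -> L m' -> m <> m' -> side m v = 0 -> side m' v = 0 ->
      0 < side m' p * side m' p'.
    move=> Lm Lm' mm' mv0 mv0'.
    have h := sign_lexmin offp cv Lm Lm' mv0 mv0' mm'.
    have h' := sign_lexmin offp' cv' Lm Lm' mv0 mv0' mm'.
    by apply: same_sign h _; rewrite mulrC.
  have [->|->] := crossing_only L1 L2 Ll l12 v1 v2 lv; first exact: key (nesym l12) _ _.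
  exact: key l12 _ _.
apply: (@same_sign _ _ (side l v)); last rewrite mulrC;
  by rewrite lt_neqAle eq_sym mulf_neq0 ?(offp l) ?(offp' l)//=; apply cv || apply cv'.
Qed.

(** Oblique coordinates at the crossing [v]: each one is read off from the line along which the
    other coordinate runs. *)
Lemma ray_coords l1 l2 v q : L l1 -> L l2 -> l1.1 <> l2.1 ->
  side l1 v = 0 -> side l2 v = 0 ->
  let a := side l2 q / slope l2.1 (dirv l1.1) in
  let b := side l1 q / slope l1.1 (dirv l2.1) in
  q = (v.1 + a * (dirv l1.1).1 + b * (dirv l2.1).1,
       v.2 + a * (dirv l1.1).2 + b * (dirv l2.1).2).
Proof.
move=> L1 L2 a12 v1 v2 a b.
have T1 := good_angle goodL L1; have T2 := good_angle goodL L2.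
have n1 : slope l1.1 (dirv l2.1) != 0 by exact: slope_dirv_neq0.
have n2 : slope l2.1 (dirv l1.1) != 0 by exact/slope_dirv_neq0/nesym.
pose z : R * R := (q.1 - v.1 - a * (dirv l1.1).1 - b * (dirv l2.1).1,
                   q.2 - v.2 - a * (dirv l1.1).2 - b * (dirv l2.1).2).
have slz th : slope th z = slope th q - slope th v - a * slope th (dirv l1.1)
    - b * slope th (dirv l2.1) by rewrite /slope /z /=; ring.
have z1 : slope l1.1 z = 0.
  rewrite slz slope_dirv /b divfK//; move: v1; rewrite /side; lra.
have z2 : slope l2.1 z = 0.
  rewrite slz slope_dirv /a divfK//; move: v2; rewrite /side; lra.
have [c zE] := slope_eq0 z1.
have c0 : c = 0.
  move: z2; rewrite zE slope_scale => /eqP.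
  by rewrite mulf_eq0 (negbTE n2) orbF => /eqP.
move: zE; rewrite c0 !mul0r => -[e1 e2].
rewrite [LHS]surjective_pairing; congr (_, _); lra.
Qed.

Lemma lexmin_cell_exists l1 l2 v : L l1 -> L l2 -> l1.1 <> l2.1 ->
  side l1 v = 0 -> side l2 v = 0 -> exists2 c, cells L c & lexmin_vertex c v.
Proof.
move=> L1 L2 a12 v1 v2.
have l12 : l1 <> l2 by move=> e; apply: a12; rewrite e.
have T1 := good_angle goodL L1; have T2 := good_angle goodL L2.
have n1 : slope l1.1 (dirv l2.1) != 0 by exact: slope_dirv_neq0.
have n2 : slope l2.1 (dirv l1.1) != 0 by exact/slope_dirv_neq0/nesym.
(* The cell is that of a point of the open cone spanned by the two positive directions, so close to
   [v] that no line missing [v] comes between. *)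
pose u : R * R := ((dirv l1.1).1 + (dirv l2.1).1, (dirv l1.1).2 + (dirv l2.1).2).
have slu th : slope th u = slope th (dirv l1.1) + slope th (dirv l2.1).
  rewrite /slope /u /=; ring.
have [t t0 tP] := local_sign_mv v u (good_finite goodL).
have {}tP := tP t; rewrite gtr0_norm// lexx in tP.
have s1 : side l1 (mv v u t) = t * slope l1.1 (dirv l2.1).
  by rewrite side_mv v1 slu slope_dirv !add0r.
have s2 : side l2 (mv v u t) = t * slope l2.1 (dirv l1.1).
  by rewrite side_mv v2 slu slope_dirv add0r addr0.
have thru l : L l -> side l v = 0 -> l = l1 \/ l = l2.
  by move=> Ll lv; exact: crossing_only L1 L2 Ll l12 v1 v2 lv.
exists (cell_of L (mv v u t)).
  rewrite cellsE; exists (mv v u t) => // l Ll.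
  have [lv|lv] := eqVneq (side l v) 0.
    by case: (thru l Ll lv) => ->; rewrite ?s1 ?s2 mulf_neq0// gt_eqF.
  by apply/eqP => z; have := tP isT l Ll lv; rewrite z mulr0 ltxx.
(* The cell lies in the closed cone at [v]. Nonnegative oblique coordinates give that [v] is
   extreme, and as both directions are lexicographically positive, that it is the smallest
   vertex. *)
have cE q : cell_of L (mv v u t) q ->
    0 <= side l2 q / slope l2.1 (dirv l1.1) /\ 0 <= side l1 q / slope l1.1 (dirv l2.1).
  move=> cq; have := cq _ L1; have := cq _ L2; rewrite s1 s2 -!mulrA !(pmulr_rge0 _ t0).
  by move=> h2 h1; split; exact: ge0_div.
split; first split.
- move=> l Ll; have [lv|lv] := eqVneq (side l v) 0; first by rewrite lv mulr0.
  by rewrite mulrC ltW// tP.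
- move=> x y r cx cy /andP[r0 r1] e1 e2.
  have [x2 x1] := cE x cx; have [y2 y1] := cE y cy.
  have lin l : side l v = (1 - r) * side l x + r * side l y.
    rewrite /side /slope e1 e2; ring.
  have r1' : 0 < 1 - r by lra.
  have sum0 (m x' y' : R) : 0 <= x' / m -> 0 <= y' / m -> m != 0 ->
      (1 - r) * x' + r * y' = 0 -> x' = 0 /\ y' = 0.
    move=> hx hy m0 /(congr1 (fun z => z / m)); rewrite mul0r mulrDl -!mulrA => /eqP.
    rewrite paddr_eq0 ?(mulr_ge0 _ hx) ?(mulr_ge0 _ hy)// ?ltW//.
    rewrite !mulf_eq0 (gt_eqF r0) (gt_eqF r1') invr_eq0 (negbTE m0) !orbF /=.
    by move=> /andP[/eqP -> /eqP ->].
  have [sx1 sy1] := sum0 _ _ _ x1 y1 n1 (etrans (esym (lin l1)) v1).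
  have [sx2 sy2] := sum0 _ _ _ x2 y2 n2 (etrans (esym (lin l2)) v2).
  split.
    rewrite (ray_coords x L1 L2 a12 v1 v2) sx1 sx2 !mul0r !addr0.
    exact/esym/surjective_pairing.
  rewrite (ray_coords y L1 L2 a12 v1 v2) sy1 sy2 !mul0r !addr0.
  exact/esym/surjective_pairing.
- move=> q [cq _]; have [q2 q1] := cE q cq.
  rewrite (ray_coords q L1 L2 a12 v1 v2).
  move: q1 q2; set a := _ / _; set b := side l2 q / _ => a0 b0 /=.
  have := lexpos_dirv l1.1; have := lexpos_dirv l2.1; rewrite /lexpos.
  move: (dirv l1.1) (dirv l2.1) => [x1 y1] [x2 y2] /=.
  have nn (r s : R) : 0 <= r -> 0 <= s -> 0 <= r * s by exact: mulr_ge0.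
  have [->|bn] := eqVneq b 0; have [->|an] := eqVneq a 0.
  + by move=> _ _; right; rewrite !mul0r !addr0.
  + have a1 : 0 < a by rewrite lt_neqAle eq_sym an.
    case/orP => [x20|/andP[/eqP -> y20]] _; rewrite ?mulr0 !mul0r !addr0.
      by left; rewrite ltrDl mulr_gt0.
    by right; split=> //; rewrite lerDl ltW// mulr_gt0.
  + have b1 : 0 < b by rewrite lt_neqAle eq_sym bn.
    move=> _ /orP [x10|/andP[/eqP -> y10]]; rewrite ?mulr0 !mul0r !addr0.
      by left; rewrite ltrDl mulr_gt0.
    by right; split=> //; rewrite lerDl ltW// mulr_gt0.
  have a1 : 0 < a by rewrite lt_neqAle eq_sym an.
  have b1 : 0 < b by rewrite lt_neqAle eq_sym bn.
  case/orP => [x20|/andP[/eqP -> y20]] /orP [x10|/andP[/eqP -> y10]].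
  + by left; rewrite -addrA ltrDl addr_gt0// mulr_gt0.
  + by left; rewrite mulr0 addr0 ltrDl mulr_gt0.
  + by left; rewrite mulr0 addr0 ltrDl mulr_gt0.
  + right; rewrite !mulr0 !addr0; split=> //.
    by rewrite -addrA lerDl addr_ge0// mulr_ge0// ltW.
Qed.

End GoodLines.

(** * Triangular cells as caps cut off from the cone at the smallest vertex *)

Section Triangles.
Context {R : realType}.
Implicit Types (l p q u v x y z : R * R).

Definition hull3 x y z : set (R * R) :=
  [set q | exists a b c : R, [/\ 0 <= a, 0 <= b, 0 <= c, a + b + c = 1 &
    q = (a * x.1 + b * y.1 + c * z.1, a * x.2 + b * y.2 + c * z.2)]].

Lemma convE (t : {i01 R}) x y :
  (conv t (x : convex_lmodType (R^o * R^o)%type) y : R * R) =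
  (t%:num * x.1 + (1 - t%:num) * y.1, t%:num * x.2 + (1 - t%:num) * y.2).
Proof. by []. Qed.

Lemma convex_setP (A : set (R * R)) : @convex_set R (R^o * R^o)%type A <->
  forall (t : R) x y, 0 <= t <= 1 -> A x -> A y ->
    A (t * x.1 + (1 - t) * y.1, t * x.2 + (1 - t) * y.2).
Proof.
split => [cA t x y t01 Ax Ay|cA x y t /set_mem Ax /set_mem Ay].
  have := cA x y (Itv01 (andP t01).1 (andP t01).2) (mem_set Ax) (mem_set Ay).
  by move=> /set_mem; rewrite convE.
by apply/mem_set; rewrite convE; apply: cA => //; apply/andP; split.
Qed.

Lemma convex_hull3E x y z : convex_hull [set x; y; z] = hull3 x y z.
Proof.
apply/seteqP; split => q.
  apply: smallest_sub.
    apply/convex_setP => t p p' /andP[t0 t1] [a [b [c [a0 b0 c0 s ->]]]]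
      [a' [b' [c' [a0' b0' c0' s' ->]]]].
    have t1' : 0 <= 1 - t by rewrite subr_ge0.
    exists (t * a + (1 - t) * a'), (t * b + (1 - t) * b'), (t * c + (1 - t) * c').
    split; rewrite ?addr_ge0 ?mulr_ge0//=.
      have -> : c = 1 - a - b by lra.
      have -> : c' = 1 - a' - b' by lra.
      ring.
    by congr (_, _); ring.
  move=> p [[]->|->].
  - by exists 1, 0, 0; split=> //; [lra|rewrite [LHS]surjective_pairing; congr (_, _); ring].
  - by exists 0, 1, 0; split=> //; [lra|rewrite [LHS]surjective_pairing; congr (_, _); ring].
  - by exists 0, 0, 1; split=> //; [lra|rewrite [LHS]surjective_pairing; congr (_, _); ring].
move=> [a [b [c [a0 b0 c0 s ->]]]] A [cA xyzA].
have [Ax Ay Az] : [/\ A x, A y & A z].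
  by split; apply: xyzA; [left; left|left; right|right].
have [c1|c1] := eqVneq c 1.
  have a1 : a = 0 by lra.
  have b1 : b = 0 by lra.
  by rewrite a1 b1 c1 !mul0r !mul1r !add0r -surjective_pairing.
have ab : a + b != 0 by apply: contra c1 => /eqP ab; apply/eqP; lra.
have ab0 : 0 < a + b by rewrite lt_neqAle eq_sym ab addr_ge0.
have {}cA := (convex_setP A).1 cA.
have w := cA (a / (a + b)) x y.
have {}w : A ((a * x.1 + b * y.1) / (a + b), (a * x.2 + b * y.2) / (a + b)).
  rewrite (_ : (_, _) = (a / (a + b) * x.1 + (1 - a / (a + b)) * y.1,
    a / (a + b) * x.2 + (1 - a / (a + b)) * y.2)).
    by apply: w => //; rewrite divr_ge0 ?ler_pdivrMr// ?addr_ge0//; lra.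
  by congr (_, _); field.
have := cA (a + b) _ z _ w Az.
rewrite (_ : (_, _) = (a * x.1 + b * y.1 + c * z.1, a * x.2 + b * y.2 + c * z.2)).
  by apply; lra.
have -> : 1 - (a + b) = c by lra.
by congr (_, _) => /=; field.
Qed.

(** A corner of positive weight is joined through [v] to the normalised combination of the other
    two, so an extreme [v] equals that corner. *)
Lemma vertex_hull3 x y z v : vertices (hull3 x y z) v -> [\/ v = x, v = y | v = z].
Proof.
move=> [[a [b [c [a0 b0 c0 s vE]]]] ext].
have corner (p w : R * R) t : hull3 x y z p -> 0 < t ->
    (t < 1 -> hull3 x y z w) ->
    t <= 1 -> v = (t * p.1 + (1 - t) * w.1, t * p.2 + (1 - t) * w.2) -> v = p.
  move=> hp t0 hw t1 e; move: t1; rewrite le_eqVlt => /predU1P[t1|t1].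
    by rewrite e t1 subrr !mul0r !addr0 !mul1r -surjective_pairing.
  by have [] := ext p w (1 - t) hp (hw t1); rewrite ?e /=; [lra|lra|lra|].
have hx : hull3 x y z x.
  by exists 1, 0, 0; split=> //; [lra|rewrite [LHS]surjective_pairing; congr (_, _); ring].
have hy : hull3 x y z y.
  by exists 0, 1, 0; split=> //; [lra|rewrite [LHS]surjective_pairing; congr (_, _); ring].
have hz : hull3 x y z z.
  by exists 0, 0, 1; split=> //; [lra|rewrite [LHS]surjective_pairing; congr (_, _); ring].
have [a1|a1] := ltP 0 a.
  apply: Or31; apply: (corner x ((b * y.1 + c * z.1) / (1 - a),
    (b * y.2 + c * z.2) / (1 - a)) a) => //; [|lra|].
    move=> a1'; exists 0, (b / (1 - a)), (c / (1 - a)).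
    have na : 1 - a != 0 by rewrite gt_eqF// subr_gt0.
    have na0 : 0 <= 1 - a by lra.
    split; rewrite ?divr_ge0//; last by congr (_, _); field.
    by rewrite add0r -mulrDl (_ : b + c = 1 - a) ?divff//; lra.
  have [a1'|na] := eqVneq (1 - a) 0.
    have b1 : b = 0 by lra.
    have c1 : c = 0 by lra.
    by rewrite vE a1' b1 c1 !mul0r !addr0.
  by rewrite vE; congr (_, _) => /=; field.
have {a1}a1 : a = 0 by lra.
have [b1|b1] := ltP 0 b.
  apply: Or32; apply: (corner y z b) => //; first by lra.
  have -> : 1 - b = c by lra.
  by rewrite vE a1 !mul0r !add0r.
apply: Or33; have c1 : c = 1 by lra.
have -> : v = (0 * x.1 + 0 * y.1 + 1 * z.1, 0 * x.2 + 0 * y.2 + 1 * z.2).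
  by rewrite vE a1 c1; congr (_ + _ * _ + _, _ + _ * _ + _); lra.
by rewrite [RHS]surjective_pairing; congr (_, _); ring.
Qed.

Lemma hull3_translate w x y z :
  [set (q.1 - w.1, q.2 - w.2) | q in hull3 x y z] =
  hull3 (x.1 - w.1, x.2 - w.2) (y.1 - w.1, y.2 - w.2) (z.1 - w.1, z.2 - w.2).
Proof.
apply/seteqP; split => q.
  move=> [_ [a [b [c [a0 b0 c0 s ->]]]] <-]; exists a, b, c; split => //=.
  have -> : c = 1 - a - b by lra.
  by congr (_, _); ring.
move=> [a [b [c [a0 b0 c0 s ->]]]].
exists (a * x.1 + b * y.1 + c * z.1, a * x.2 + b * y.2 + c * z.2).
  by exists a, b, c.
have -> : c = 1 - a - b by lra.
by congr (_, _) => /=; ring.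
Qed.

Lemma triangle_centered c : triangle (centered c) -> exists x y z, c = hull3 x y z.
Proof.
move=> [x [y [z [_]]]]; rewrite convex_hull3E /centered => e.
pose w : R * R := (- (lexmin c).1, - (lexmin c).2).
exists (x.1 - w.1, x.2 - w.2), (y.1 - w.1, y.2 - w.2), (z.1 - w.1, z.2 - w.2).
rewrite -hull3_translate -e image_comp -[LHS]image_id; apply: eq_imagel => q _ /=.
by rewrite /w /= !opprK !subrK -surjective_pairing.
Qed.

Lemma hull3_triangle x y z :
  ~ (exists l, [/\ line l x, line l y & line l z]) ->
  triangle (centered (hull3 x y z)).
Proof.
move=> nc; set w := lexmin (hull3 x y z).
exists (x.1 - w.1, x.2 - w.2), (y.1 - w.1, y.2 - w.2), (z.1 - w.1, z.2 - w.2).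
rewrite convex_hull3E -hull3_translate; split => // -[l].
move=> [/lineE lx /lineE ly /lineE lz]; apply: nc; exists (l.1, l.2 + slope l.1 w).
split; apply/lineE; [move: lx|move: ly|move: lz]; rewrite /side /slope /=; lra.
Qed.

Variable Theta : set R.
Hypothesis sin_angles : forall a b, Theta a -> Theta b -> a <> b -> sin (b - a) != 0.
Hypothesis two_angles : forall a, Theta a -> exists2 b, Theta b & b <> a.
Variable L : set (R * R).
Hypothesis goodL : good_lines Theta L.

(* l cuts off from the cone at v spanned by u1 and u2 a triangle whose interior
   is not hit by L. *)
Definition cap v u1 u2 l :=
  [/\ L l, side l v * slope l.1 u1 < 0, side l v * slope l.1 u2 < 0 &
   let A := mv v u1 (- side l v / slope l.1 u1) in
   let B := mv v u2 (- side l v / slope l.1 u2) in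
   forall m, L m -> ~ (Num.min (side m v) (Num.min (side m A) (side m B)) < 0 <
     Num.max (side m v) (Num.max (side m A) (side m B)))].

Lemma side_foot l v u : slope l.1 u != 0 ->
  side l (mv v u (- side l v / slope l.1 u)) = 0.
Proof. by move=> n; rewrite side_mv divfK// subrr. Qed.

Lemma foot_gt0 (a b : R) : a * b < 0 -> 0 < - a / b.
Proof.
move=> ab; have b0 : b != 0 by apply: contraTneq ab => ->; rewrite mulr0 ltxx.
have -> : - a / b = - (a * b) * b^-1 ^+ 2 by field.
by rewrite mulr_gt0 ?oppr_gt0// exprn_even_gt0//= invr_eq0.
Qed.

Lemma same_side_minmax (s a b c : R) : s != 0 ->
  0 <= s * a -> 0 <= s * b -> 0 <= s * c ->
  ~ (Num.min a (Num.min b c) < 0 < Num.max a (Num.max b c)).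
Proof.
move=> s0; have [sp|sn] := ltP 0 s.
  rewrite !pmulr_rge0// => a0 b0 c0 /andP[].
  by rewrite !gt_min !ltNge a0 b0 c0.
have {}sn : s < 0 by rewrite lt_neqAle s0.
rewrite !nmulr_rge0// => a0 b0 c0 /andP[_].
by rewrite !lt_max !ltNge a0 b0 c0.
Qed.

Lemma minmax_same_side (a b c : R) :
  ~ (Num.min a (Num.min b c) < 0 < Num.max a (Num.max b c)) ->
  0 <= a * b /\ 0 <= a * c.
Proof.
move=> /negP; rewrite negb_and -!leNgt !le_min !ge_max.
move=> /orP[/and3P[a0 b0 c0]|/and3P[a0 b0 c0]].
  by split; apply: mulr_ge0.
by split; apply: mulr_le0.
Qed.

Lemma side_affine l x y z (a b c : R) : a + b + c = 1 ->
  side l (a * x.1 + b * y.1 + c * z.1, a * x.2 + b * y.2 + c * z.2) =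
  a * side l x + b * side l y + c * side l z.
Proof.
move=> abc; have -> : c = 1 - a - b by lra.
by rewrite /side /slope /=; ring.
Qed.

(** If the cell is a triangle, its corners are [v] and the ends [A], [B] of the two rays, and the
    third line is the one carrying [AB]. Conversely, if no line separates [v], [A] and [B], these
    points belong to the cell, and the third line confines the cell to their hull. *)
Lemma triangle_cap p v l1 l2 : off_lines L p -> lexmin_vertex (cell_of L p) v ->
  L l1 -> L l2 -> l1 <> l2 -> side l1 v = 0 -> side l2 v = 0 ->
  triangle (centered (cell_of L p)) <->
  exists l3, cap v (dirv l1.1) (dirv l2.1) l3.
Proof.
move=> offp lexv L1 L2 l12 v1 v2; have [[cv ext] _] := lexv.
have a12 := crossing_angles v1 v2 l12.
have T1 := good_angle goodL L1; have T2 := good_angle goodL L2.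
set u1 := dirv l1.1; set u2 := dirv l2.1.
have n1 : slope l1.1 u2 != 0 by exact: (slope_dirv_neq0 sin_angles).
have n2 : slope l2.1 u1 != 0 by exact/(slope_dirv_neq0 sin_angles)/nesym.
have s2 : 0 < side l2 p * slope l2.1 u1.
  exact: (sign_lexmin sin_angles two_angles goodL offp lexv L1 L2 v1 v2 l12).
have s1 : 0 < side l1 p * slope l1.1 u2.
  exact: (sign_lexmin sin_angles two_angles goodL offp lexv L2 L1 v2 v1 (nesym l12)).
have thru l : L l -> side l v = 0 -> l = l1 \/ l = l2.
  by move=> Ll lv; exact: (crossing_only goodL L1 L2 Ll l12 v1 v2 lv).
have off l : L l -> side l v != 0 -> 0 < side l p * side l v.
  by move=> Ll lv; rewrite lt_neqAle eq_sym mulf_neq0 ?(offp l)//= cv.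
have coords q : exists a b, [/\ q = (v.1 + a * u1.1 + b * u2.1, v.2 + a * u1.2 + b * u2.2),
    cell_of L p q -> 0 <= a & cell_of L p q -> 0 <= b].
  exists (side l2 q / slope l2.1 u1), (side l1 q / slope l1.1 u2).
  split; first exact: (ray_coords sin_angles goodL).
    move=> /(_ l2 L2) h; apply: ge0_div => //.
    have pp : 0 < side l2 p ^+ 2 by rewrite exprn_even_gt0//= offp.
    rewrite -(pmulr_rge0 _ pp) (_ : side l2 p ^+ 2 * _ =
      (side l2 p * slope l2.1 u1) * (side l2 p * side l2 q)); last ring.
    by rewrite mulr_ge0// ltW.
  move=> /(_ l1 L1) h; apply: ge0_div => //.
  have pp : 0 < side l1 p ^+ 2 by rewrite exprn_even_gt0//= offp.
  rewrite -(pmulr_rge0 _ pp) (_ : side l1 p ^+ 2 * _ =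
    (side l1 p * slope l1.1 u2) * (side l1 p * side l1 q)); last ring.
  by rewrite mulr_ge0// ltW.
have noncol s t l : 0 < s -> 0 < t -> side l v = 0 -> side l (mv v u1 s) = 0 ->
    side l (mv v u2 t) = 0 -> False.
  move=> s0 t0 lv; rewrite !side_mv lv !add0r.
  move=> /eqP; rewrite mulf_eq0 (gt_eqF s0) /= => /eqP lu1.
  move=> /eqP; rewrite mulf_eq0 (gt_eqF t0) /= => /eqP lu2.
  have [c e] := slope_eq0 lu1; have [c' e'] := slope_eq0 lu2.
  have c'0 : c' != 0.
    apply/eqP => c'0; have := lexpos_dirv l2.1; rewrite -/u2 e' c'0 !mul0r.
    by rewrite /lexpos /= ltxx andbF.
  have : slope l1.1 u1 * c' = slope l1.1 u2 * c.
    by rewrite e e' !slope_scale; ring.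
  rewrite /u1 slope_dirv mul0r => /esym/eqP; rewrite mulf_eq0 (negbTE n1) /= => /eqP c0.
  have := lexpos_dirv l1.1; rewrite -/u1 e c0 !mul0r.
  by rewrite /lexpos /= ltxx andbF.
split.
  move=> /triangle_centered[x [y [z cE]]].
  have ray u l l' : L l -> side l v = 0 -> slope l.1 u = 0 -> lexpos u ->
      L l' ->
      0 < side l' p * slope l'.1 u ->
      (forall m, L m -> side m v = 0 -> m = l \/ m = l') ->
      exists2 s, 0 < s & vertices (cell_of L p) (mv v u s).
    move=> Ll lv lu upos Ll' l'u only.
    have [t t0 ct] : exists2 t, 0 < t & cell_of L p (mv v u t).
      apply: (cell_stay goodL) => // m Lm mv0.
      by case: (only m Lm mv0) => ->; rewrite ?lu ?mulr0// ltW.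
    have [s vs /(_ t (ltW t0) ct) ts] :=
      ray_exit sin_angles two_angles goodL offp cv Ll lv lu (lexpos_neq0 upos).
    by exists s => //; exact: lt_le_trans ts.
  have [s s0 vA] : exists2 s, 0 < s & vertices (cell_of L p) (mv v u1 s).
    by apply: (ray u1 l1 l2) => //; [exact: slope_dirv|exact: lexpos_dirv].
  have [t t0 vB] : exists2 s, 0 < s & vertices (cell_of L p) (mv v u2 s).
    apply: (ray u2 l2 l1) => //; [exact: slope_dirv|exact: lexpos_dirv|].
    by move=> m Lm mv0; case: (thru m Lm mv0); auto.
  set A := mv v u1 s in vA; set B := mv v u2 t in vB.
  have n12 l : L l -> side l v = 0 -> side l A = 0 -> side l B = 0 -> False.
    by move=> _; exact: noncol.
  have [cA cB] := (vA.1, vB.1).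
  have vA0 : v <> A.
    move=> e; have /eqP := congr1 (side l2) e.
    by rewrite side_mv v2 add0r eq_sym mulf_eq0 (negbTE n2) gt_eqF.
  have vB0 : v <> B.
    move=> e; have /eqP := congr1 (side l1) e.
    by rewrite side_mv v1 add0r eq_sym mulf_eq0 (negbTE n1) gt_eqF.
  have AB0 : A <> B.
    move=> e; have /eqP := congr1 (side l1) e.
    rewrite !side_mv v1 !add0r /u1 slope_dirv mulr0 eq_sym mulf_eq0.
    by rewrite (negbTE n1) gt_eqF.
  (* Three distinct vertices of the hull of three points exhaust these points. *)
  have cE' : cell_of L p = hull3 v A B.
    move: vA vB lexv.1; rewrite cE => /vertex_hull3 hA /vertex_hull3 hB /vertex_hull3 hv.
    rewrite -!convex_hull3E; congr convex_hull.
    by case: hA hB hv => hA [] hB [] hv; (try by exfalso; congruence);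
      rewrite hA hB hv; apply/seteqP; split => q /=; tauto.
  have [l [Ll lA lB]] : exists l, [/\ L l, side l A = 0 & side l B = 0].
    (* A line through the midpoint of [AB] contains both ends, since neither of them is strictly on
       the side away from [p]. *)
    pose M : R * R := (2^-1 * A.1 + 2^-1 * B.1, 2^-1 * A.2 + 2^-1 * B.2).
    have sM l : side l M = 2^-1 * side l A + 2^-1 * side l B.
      rewrite /side /slope /M /=; lra.
    have [[l [Ll lM]]|noM] := pselect (exists l, L l /\ side l M = 0).
      exists l; have hA := cA l Ll; have hB := cB l Ll.
      have pM : 2^-1 * (side l p * side l A) + 2^-1 * (side l p * side l B) = 0.
        by rewrite mulrCA (mulrCA 2^-1) -mulrDr -sM lM mulr0.
      have e1 : side l p * side l A = 0 by lra.
      have e2 : side l p * side l B = 0 by lra.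
      by split=> //; apply/eqP; [move/eqP: e1|move/eqP: e2];
        rewrite mulf_eq0 (negbTE (offp l Ll)).
    have cM : cell_of L p M.
      by move=> l Ll; rewrite sM mulrDr !(mulrCA _ 2^-1); have := cA l Ll;
        have := cB l Ll; lra.
    (* With no line through the midpoint, it could be pushed away from [v] inside the cell; the
       weights of [A] and [B] would then both exceed 1/2. *)
    have [|r r0] := @cell_stay _ _ _ goodL p M (u1.1 + u2.1, u1.2 + u2.2) offp cM.
      by move=> l Ll lM; case: noM; exists l.
    rewrite cE' => -[a [b [c [a0 b0 c0 abc e]]]].
    have f1 l : L l -> side l M + r * (slope l.1 u1 + slope l.1 u2) =
        a * side l v + b * side l A + c * side l B.
      move=> Ll; rewrite -side_affine// -e side_mv.
      by congr (_ + _ * _); rewrite /slope /=; ring.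
    have bs : 2^-1 * s + r = b * s.
      apply: (mulIf n2); have := f1 l2 L2.
      rewrite sM !side_mv v2 /u2 slope_dirv !mulr0 !addr0 !add0r; lra.
    have ct : 2^-1 * t + r = c * t.
      apply: (mulIf n1); have := f1 l1 L1.
      rewrite sM !side_mv v1 /u1 slope_dirv !mulr0 !addr0 !add0r; lra.
    have b2 : 2^-1 < b by rewrite -(ltr_pM2r s0); lra.
    have c2 : 2^-1 < c by rewrite -(ltr_pM2r t0); lra.
    by move: abc a0 b2 c2; clear; lra.
  have lv : side l v != 0 by apply/eqP => lv; exact: (noncol s t l).
  have sE (u : R * R) (r : R) : 0 < r -> side l (mv v u r) = 0 ->
      side l v * slope l.1 u < 0 /\ - side l v / slope l.1 u = r.
    move=> r0; rewrite side_mv => e.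
    have eu : slope l.1 u = - (side l v / r).
      by rewrite (_ : side l v = - (r * slope l.1 u)); [field; rewrite gt_eqF|lra].
    rewrite eu; split; last by field; rewrite lv gt_eqF.
    by rewrite mulrN mulrA oppr_lt0 divr_gt0// -expr2 exprn_even_gt0.
  have [lu1 e1] := sE _ _ s0 lA; have [lu2 e2] := sE _ _ t0 lB.
  exists l; split => //; rewrite e1 e2 -/A -/B => /= m Lm.
  by apply: same_side_minmax (offp m Lm) (cv m Lm) (cA m Lm) (cB m Lm).
move=> [l3 [L3 c1 c2]].
have s0 := foot_gt0 c1; have t0 := foot_gt0 c2.
have m1 : slope l3.1 u1 != 0 by apply: contraTneq c1 => ->; rewrite mulr0 ltxx.
have m2 : slope l3.1 u2 != 0 by apply: contraTneq c2 => ->; rewrite mulr0 ltxx.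
have v3 : side l3 v != 0 by apply: contraTneq c1 => ->; rewrite mul0r ltxx.
have A3 := side_foot v m1; have B3 := side_foot v m2.
have [k1 k2] : slope l3.1 u1 * (- side l3 v / slope l3.1 u1) = - side l3 v /\
    slope l3.1 u2 * (- side l3 v / slope l3.1 u2) = - side l3 v.
  by split; rewrite mulrC divfK.
move: (- side l3 v / slope l3.1 u1) (- side l3 v / slope l3.1 u2) s0 t0 A3 B3 k1 k2.
move=> s t s0 t0; set A := mv v u1 s; set B := mv v u2 t => A3 B3 k1 k2 /= void.
have sgn (x y z : R) : 0 < x * y -> 0 <= y * z -> 0 <= x * z.
  move=> xy yz; have y2 : 0 < y ^+ 2.
    by rewrite exprn_even_gt0//=; apply: contraTneq xy => ->; rewrite mulr0 ltxx.
  rewrite -(pmulr_rge0 _ y2) (_ : y ^+ 2 * (x * z) = (x * y) * (y * z)); last ring.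
  by rewrite mulr_ge0// ltW.
have cA : cell_of L p A.
  move=> m Lm; have [mv0|mv0] := eqVneq (side m v) 0; last first.
    exact: sgn (off m Lm mv0) (minmax_same_side (void m Lm)).1.
  have [->|->] := thru m Lm mv0; rewrite side_mv ?v1 ?v2 add0r.
    by rewrite /u1 slope_dirv !mulr0.
  by rewrite mulrCA mulr_ge0// ltW.
have cB : cell_of L p B.
  move=> m Lm; have [mv0|mv0] := eqVneq (side m v) 0; last first.
    exact: sgn (off m Lm mv0) (minmax_same_side (void m Lm)).2.
  have [->|->] := thru m Lm mv0; rewrite side_mv ?v1 ?v2 add0r.
    by rewrite mulrCA mulr_ge0// ltW.
  by rewrite /u2 slope_dirv !mulr0.
have -> : cell_of L p = hull3 v A B.
  apply/seteqP; split => q; last first.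
    move=> [a [b [c [a0 b0 c0 abc ->]]]] m Lm; rewrite side_affine//.
    move: (cv m Lm) (cA m Lm) (cB m Lm).
    move: (side m p) (side m v) (side m A) (side m B) => xp xv xA xB hv hA hB.
    rewrite (_ : xp * _ = a * (xp * xv) + b * (xp * xA) + c * (xp * xB)); last ring.
    by rewrite !addr_ge0// mulr_ge0.
  move=> cq; have [a [b [qE /(_ cq) a0 /(_ cq) b0]]] := coords q.
  (* The oblique coordinates divided by the distances [s], [t] to the feet are the barycentric
     weights of [A] and [B]. The remaining weight of [v] is seen by [side l3], which vanishes at the
     feet. *)
  have q3 : side l3 q = side l3 v * (1 - a / s - b / t).
    have -> : side l3 q = side l3 v + a * slope l3.1 u1 + b * slope l3.1 u2.
      rewrite qE /side /slope /=; ring.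
    have -> : slope l3.1 u1 = - side l3 v / s by rewrite -k1; field; rewrite gt_eqF.
    have -> : slope l3.1 u2 = - side l3 v / t by rewrite -k2; field; rewrite gt_eqF.
    by field; rewrite !gt_eqF.
  have w0 : 0 <= 1 - a / s - b / t.
    have := cq l3 L3; rewrite q3 mulrA pmulr_rge0//; exact: off.
  exists (1 - a / s - b / t), (a / s), (b / t); split => //.
  - by rewrite divr_ge0// ltW.
  - by rewrite divr_ge0// ltW.
  - ring.
  - by rewrite qE /A /B /mv /=; congr (_, _); field; rewrite !gt_eqF.
apply: hull3_triangle => -[l [/lineE lv /lineE lA /lineE lB]].
exact: noncol s0 t0 lv lA lB.
Qed.

(** Neither line separates the corners of the other's triangle, so each foot on the ray of [l1] is
    at most as far as the other. The feet coincide, and simplicity at this point of [l1] identifies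
    the lines. *)
Lemma cap_uniq v l1 u2 l3 l3' : L l1 -> side l1 v = 0 ->
  cap v (dirv l1.1) u2 l3 -> cap v (dirv l1.1) u2 l3' -> l3 = l3'.
Proof.
move=> L1 v1; have foot_le l l' : cap v (dirv l1.1) u2 l -> cap v (dirv l1.1) u2 l' ->
    - side l v / slope l.1 (dirv l1.1) <= - side l' v / slope l'.1 (dirv l1.1).
  move=> [Ll c1 _ void] [Ll' c1' _ _].
  have [+ _] := minmax_same_side (void l' Ll'); rewrite side_mv.
  move: (- side l v / _) => s; set x := side l' v in c1' *; set y := slope _ _ in c1' *.
  have y0 : y != 0 by apply: contraTneq c1' => ->; rewrite mulr0 ltxx.
  have -> : - x / y = (x * x) / - (x * y).
    by field; rewrite y0 /=; apply: contraTneq c1' => ->; rewrite mul0r ltxx.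
  by rewrite ler_pdivlMr ?oppr_gt0//; lra.
move=> c3 c3'; have /eqP : - side l3 v / slope l3.1 (dirv l1.1) =
    - side l3' v / slope l3'.1 (dirv l1.1).
  by apply/eqP; rewrite eq_le !foot_le.
case: c3 c3' => [L3 c1 _ _] [L3' c1' _ _] /eqP e.
have m1 : slope l3.1 (dirv l1.1) != 0 by apply: contraTneq c1 => ->; rewrite mulr0 ltxx.
have m1' : slope l3'.1 (dirv l1.1) != 0 by apply: contraTneq c1' => ->; rewrite mulr0 ltxx.
have A3 := side_foot v m1; have := side_foot v m1'; rewrite -e => A3'.
have A1 : side l1 (mv v (dirv l1.1) (- side l3 v / slope l3.1 (dirv l1.1))) = 0.
  by rewrite side_mv v1 slope_dirv mulr0 addr0.
have [e1|e1|//] := good_simple goodL L1 L3 L3' A1 A3 A3'.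
  by move: c1; rewrite -e1 v1 mul0r ltxx.
by move: c1'; rewrite -e1 v1 mul0r ltxx.
Qed.

End Triangles.

(** * Trigonometric sums *)

Section TrigSums.
Context {R : realType}.
Variable k : nat.
Hypothesis k0 : (0 < k)%N.

Definition ang (i : nat) : R := i%:R * pi / k%:R.

Let kR0 : k%:R != 0 :> R.
Proof. by rewrite pnatr_eq0 -lt0n. Qed.

Lemma angS i : ang i.+1 = ang i + pi / k%:R.
Proof. by rewrite /ang -natr1; field. Qed.

Lemma ang0 : ang 0 = 0. Proof. by rewrite /ang !mul0r. Qed.

Lemma angk : ang k = pi. Proof. by rewrite /ang; field. Qed.

Lemma angD i j : ang (i + j) = ang i + ang j.
Proof. by rewrite /ang natrD; field. Qed.

Lemma angB i j : (j <= i)%N -> ang (i - j) = ang i - ang j.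
Proof. by move=> ji; rewrite /ang natrB//; field. Qed.

Lemma sin_ang_ge0 i : (i <= k)%N -> 0 <= sin (ang i).
Proof.
move=> ik; apply: sin_ge0_pi; rewrite /ang divr_ge0 ?mulr_ge0 ?pi_ge0//=.
by rewrite ler_pdivrMr ?ltr0n// mulrC ler_pM2l ?pi_gt0// ler_nat.
Qed.

Lemma sin_ang_gt0 i : (0 < i < k)%N -> 0 < sin (ang i).
Proof.
move=> /andP[i0 ik]; apply: sin_gt0_pi; rewrite /ang divr_gt0 ?mulr_gt0 ?pi_gt0 ?ltr0n//=.
by rewrite ltr_pdivrMr ?ltr0n// mulrC ltr_pM2l ?pi_gt0// ltr_nat.
Qed.

(** With h = pi/(2k), the product 2 sin h sin x = cos(x - h) - cos(x + h) telescopes along steps of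
    2h and gives 2 cos h at the end. *)
Lemma sum_sin : (1 < k)%N ->
  (\sum_(m < k) sin (ang m)) * tan (pi / (2 * k%:R)) = 1.
Proof.
move=> k1; set h : R := pi / (2 * k%:R).
have h0 : 0 < h by rewrite divr_gt0 ?pi_gt0// mulr_gt0// ltr0n.
have h2 : h < pi / 2.
  rewrite /h invfM mulrA ltr_pdivrMr ?ltr0n// ltr_pMr ?divr_gt0 ?pi_gt0//.
  by rewrite ltr1n.
have hh : pi / k%:R = 2 * h by rewrite /h; field.
have c0 : cos h != 0.
  by rewrite gt_eqF// cos_gt0_pihalf// h2 andbT; apply: lt_trans h0; rewrite oppr_lt0 divr_gt0 ?pi_gt0.
have tele n : 2 * sin h * \sum_(m < n) sin (ang m) = cos h - cos (ang n - h).
  elim: n => [|n IH]; first by rewrite big_ord0 mulr0 ang0 sub0r cosN subrr.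
  rewrite big_ord_recr /= mulrDr IH angS hh.
  have -> : ang n + 2 * h - h = ang n + h by ring.
  by rewrite cosB cosD; ring.
have := tele k; rewrite angk cosB cospi sinpi mulN1r mul0r addr0 opprK => e.
rewrite /tan mulrCA mulrA; apply: (mulIf c0); rewrite divfK// mul1r.
by move: e; set S := \sum_(m < k) _; lra.
Qed.

Lemma abs_sin_shift a b : `|sin (ang a - ang (b + k))| = `|sin (ang a - ang b)|.
Proof. by rewrite angD angk opprD addrA (sinB _ pi) cospi sinpi mulr0 subr0 mulrN1 normrN. Qed.

Lemma sum_shift (F : nat -> R) : F k = F 0%N ->
  \sum_(b < k) F b.+1 = \sum_(b < k) F b.
Proof.
case: k => [|n] Fk; first by rewrite !big_ord0.
by rewrite big_ord_recr [RHS]big_ord_recl /= Fk addrC.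
Qed.

(** |sin| has period pi, which is [k] steps of the grid; increasing [i] therefore only rotates the
    summands. *)
Lemma sum_abs_sin i : \sum_(j < k) `|sin (ang i - ang j)| = \sum_(m < k) sin (ang m).
Proof.
elim: i => [|i IH].
  apply: eq_bigr => j _; rewrite ang0 sub0r sinN normrN ger0_norm//.
  by apply: sin_ang_ge0; exact: ltnW.
rewrite -IH -(sum_shift (F := fun j => `|sin (ang i.+1 - ang j)|)).
  by apply: eq_bigr => j _; rewrite !angS; congr (`|sin _|); ring.
by rewrite -[in LHS](add0n k) abs_sin_shift.
Qed.

Definition sinD a b : R := `|sin (ang a - ang b)|.

Lemma sinDC a b : sinD a b = sinD b a.
Proof. by rewrite /sinD -normrN -sinN opprB. Qed.

Lemma sinDaa a : sinD a a = 0.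
Proof. by rewrite /sinD subrr sin0 normr0. Qed.

Definition tri_weight a b c : R :=
  sinD a b * sinD a c * sinD b c / (sinD a b + sinD a c + sinD b c).

Lemma tri_weight12 a b c : tri_weight a b c = tri_weight b a c.
Proof.
rewrite /tri_weight (sinDC b a); congr (_ / _); [ring|ring].
Qed.

Lemma tri_weight23 a b c : tri_weight a b c = tri_weight a c b.
Proof.
rewrite /tri_weight (sinDC c b); congr (_ / _); [ring|ring].
Qed.

Lemma tri_weightaa a c : tri_weight a a c = 0.
Proof. by rewrite /tri_weight sinDaa !mul0r. Qed.

Lemma tri_weight_bb a b : tri_weight a b b = 0.
Proof. by rewrite /tri_weight sinDaa mulr0 mul0r. Qed.

(** [tri_weight] depends on differences of angles and is periodic in each index, so a common
    rotation moves the first index to 0. *)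
Lemma sum_tri_weight1 a :
  \sum_(b < k) \sum_(c < k) tri_weight a b c =
  \sum_(b < k) \sum_(c < k) tri_weight 0 b c.
Proof.
elim: a => [//|a IH]; rewrite -IH.
rewrite -(sum_shift (F := fun b => \sum_(c < k) tri_weight a.+1 b c)); last first.
  apply: eq_bigr => c _.
  have e x : sinD x k = sinD x 0 by rewrite /sinD -[in LHS](add0n k) abs_sin_shift.
  by rewrite /tri_weight !(sinDC _ c) !e.
apply: eq_bigr => b _.
rewrite -(sum_shift (F := fun c => tri_weight a.+1 b.+1 c)); last first.
  have e x : sinD x k = sinD x 0 by rewrite /sinD -[in LHS](add0n k) abs_sin_shift.
  by rewrite /tri_weight !e.
apply: eq_bigr => c _; rewrite /tri_weight.
have e x y : sinD x.+1 y.+1 = sinD x y.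
  by rewrite /sinD !angS; congr (`|sin _|); ring.
by rewrite !e.
Qed.

Lemma sinD_lt a b : (a <= b <= k)%N -> sinD a b = sin (ang (b - a)).
Proof.
move=> /andP[ab bk]; rewrite sinDC /sinD -angB// ger0_norm//.
by apply: sin_ang_ge0; rewrite (leq_trans (leq_subr _ _)).
Qed.

Lemma sin_angC b : (b <= k)%N -> sin (ang (k - b)) = sin (ang b).
Proof. by move=> bk; rewrite angB// angk sinB sinpi cospi; ring. Qed.

Let V b c := tri_weight 0 b c.

(** After rotating one direction to 0, three directions 0 < b < c cut the circle of [k] steps into
    gaps b, c - b and k - c, and the weight is symmetric in the gaps. Putting k minus any one gap in
    front gives the same sum, and the three factors add up to 2k; this is k rotations times 2 orders
    of b and c. *)
Lemma sum_tri_weight :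
  \sum_(a < k) \sum_(b < k) \sum_(c < k) tri_weight a b c =
  3 * \sum_(1 <= i < k.-1)
       ((k - i)%:R *
        \sum_(1 <= j < k - i)
          (sin (ang i) * sin (ang j) * sin (ang (i + j)) /
           (sin (ang i) + sin (ang j) + sin (ang (i + j))))).
Proof.
under eq_bigr do rewrite sum_tri_weight1.
rewrite sumr_const card_ord -[LHS]mulr_natl.
have V0 b : V b 0 = 0 by rewrite /V tri_weight23 tri_weightaa.
have V0' b : V 0 b = 0 by rewrite /V tri_weightaa.
have VC b c : V b c = V c b by rewrite /V tri_weight23.
pose U (F : nat -> nat -> R) :=
  \sum_(1 <= b < k) \sum_(1 <= c < k | (b < c)%N) F b c * V b c.
have -> : \sum_(b < k) \sum_(c < k) tri_weight 0 b c = 2 * U (fun _ _ => 1).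
  have -> : \sum_(b < k) \sum_(c < k) tri_weight 0 b c =
      \sum_(1 <= b < k) \sum_(1 <= c < k) V b c.
    rewrite -(big_mkord xpredT (fun b => \sum_(c < k) tri_weight 0 b c)) big_ltn//.
    rewrite big1 ?add0r; last by move=> c _; exact: V0'.
    apply: eq_bigr => b _.
    by rewrite -(big_mkord xpredT (fun c => tri_weight 0 b c)) big_ltn// [tri_weight _ _ _]V0 add0r.
  have split2 b : \sum_(1 <= c < k) V b c =
     \sum_(1 <= c < k | (b < c)%N) V b c + \sum_(1 <= c < k | (c < b)%N) V b c.
    rewrite (bigID (fun c => (b < c)%N)) /=; congr (_ + _).
    rewrite (bigID (fun c => (c < b)%N)) /= [X in _ + X]big1 ?addr0.
      by apply: eq_bigl => c; lia.
    move=> c ?; have -> : c = b by lia.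
    exact: tri_weight_bb.
  under eq_bigr do rewrite split2.
  rewrite big_split /= mulr2n mulrDl mul1r.
  congr (_ + _).
    by apply: eq_bigr => b _; apply: eq_bigr => c _; rewrite mul1r.
  rewrite (exchange_big_dep_nat xpredT)//=.
  by apply: eq_bigr => b _; apply: eq_bigr => c _; rewrite mul1r VC.
(* Here i is the first gap b and j the second gap c - b. The value i = k - 1 may be added because
   its inner sum is empty. *)
have W1 : \sum_(1 <= i < k.-1)
       ((k - i)%:R *
        \sum_(1 <= j < k - i)
          (sin (ang i) * sin (ang j) * sin (ang (i + j)) /
           (sin (ang i) + sin (ang j) + sin (ang (i + j))))) =
   U (fun b c => k%:R - b%:R).
  transitivity (\sum_(1 <= i < k)
       ((k - i)%:R *
        \sum_(1 <= j < k - i)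
          (sin (ang i) * sin (ang j) * sin (ang (i + j)) /
           (sin (ang i) + sin (ang j) + sin (ang (i + j)))))).
    have [k1|k1] := leqP k 1; first by rewrite !big_geq//; lia.
    rewrite [RHS](big_cat_nat (n := k.-1))/=; try lia.
    rewrite [X in _ = _ + X]big_nat_cond [X in _ = _ + X]big1 ?addr0// => i ik.
    by rewrite big_geq ?mulr0//; lia.
  rewrite /U !big_nat; apply: eq_bigr => b /andP[b1 bk]; rewrite natrB ?(ltnW bk)//.
  rewrite -mulr_sumr; congr (_ * _).
  rewrite [RHS](big_cat_nat (n := b.+1))/=; try lia.
  rewrite [X in _ = X + _]big_nat_cond [X in _ = X + _]big1 ?add0r; last by move=> i; lia.
  rewrite -[in RHS](add1n b) [RHS]big_addn big_nat_cond [RHS]big_nat_cond.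
  apply: eq_big => [j|j]; first by lia.
  move=> /andP[/andP[j1 jk] _]; rewrite /V /tri_weight (addnC j).
  rewrite !sinD_lt; try lia.
  rewrite !subn0 addKn; congr (_ / _); ring.
(* The substitution of c - b for b exchanges the first two gaps. *)
have W2 : U (fun b c => k%:R - b%:R) = U (fun b c => k%:R - c%:R + b%:R).
  rewrite /U (exchange_big_dep_nat xpredT)//= [RHS](exchange_big_dep_nat xpredT)//=.
  rewrite !big_nat; apply: eq_bigr => c /andP[c1 ck].
  have cut (F : nat -> R) : \sum_(1 <= b < k | (b < c)%N) F b = \sum_(1 <= b < c) F b.
    rewrite (big_cat_nat (n := c))/=; try lia.
    rewrite [X in _ + X]big_nat_cond [X in _ + X]big1 ?addr0; last by move=> i; lia.
    by rewrite big_nat_cond [RHS]big_nat_cond; apply: eq_bigl => j; lia.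
  rewrite !cut big_nat_rev /= !big_nat; apply: eq_bigr => b /andP[b1 bc].
  have -> : (1 + c - b.+1 = c - b)%N by lia.
  have -> : V (c - b)%N c = V b c.
    rewrite /V /tri_weight !sinD_lt; try lia.
    have -> : (c - (c - b) = b)%N by lia.
    by rewrite !subn0; congr (_ / _); ring.
  by rewrite natrB 1?ltnW//; congr (_ * _); ring.
(* The reflection (b, c) to (k - c, k - b) exchanges the first and the last gap. *)
have W3 : U (fun b c => k%:R - b%:R) = U (fun b c => c%:R).
  rewrite /U big_nat_rev /=.
  under eq_bigr do rewrite big_nat_rev /=.
  rewrite (exchange_big_dep_nat xpredT)//=.
  rewrite !big_nat; apply: eq_bigr => b /andP[b1 bk].
  rewrite big_nat_cond [RHS]big_nat_cond; apply: eq_big => [c|c]; first by lia.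
  move=> /andP[/andP[c1 ck] bc].
  have -> : (1 + k - c.+1 = k - c)%N by lia.
  have -> : (1 + k - b.+1 = k - b)%N by lia.
  have -> : V (k - c)%N (k - b)%N = V b c.
    rewrite /V /tri_weight !sinD_lt; try lia.
    have -> : (k - b - (k - c) = c - b)%N by lia.
    by rewrite !subn0 !sin_angC; try lia; congr (_ / _); ring.
  by rewrite natrB 1?ltnW//; congr (_ * _); ring.
rewrite W1; have -> : 3 * U (fun b c => k%:R - b%:R) = U (fun b c => k%:R - b%:R) +
    U (fun b c => k%:R - c%:R + b%:R) + U (fun b c => c%:R).
  by rewrite -W2 -W3; ring.
rewrite mulrA /U !mulr_sumr -!big_split; apply: eq_bigr => b _ /=.
rewrite !mulr_sumr -!big_split; apply: eq_bigr => c _ /=; ring.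
Qed.

End TrigSums.

(** * Pairs of directions possible at the smallest vertex of a triangle *)

Section Validity.
Context {R : realType}.

Definition crossp (u v : R * R) := u.1 * v.2 - u.2 * v.1.

(** A line of angle [c] can cut both rays [dirv a] and [dirv b] of a cone only if these leave a
    parallel line through the apex on the same strict side. *)
Definition valid (a b c : R) : bool := 0 < slope c (dirv a) * slope c (dirv b).

Lemma validE a b c : valid a b c =
  (0 < crossp (dirv c) (dirv a) * crossp (dirv c) (dirv b)).
Proof.
have [s s1 e] := dirvE c.
have h u : slope c u = s * crossp (dirv c) u.
  rewrite e /crossp /slope /=; transitivity (s ^+ 2 * (- sin c * u.1 + cos c * u.2)).
    by rewrite s1 mul1r.
  ring.
rewrite /valid !h mulrACA -expr2 s1 mul1r//.
Qed.

(** Three vectors of a half plane cannot turn cyclically. The combination [u,v] w + [v,w] u + [w,u]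
    v is 0, so positive brackets and nonnegative first coordinates make all first coordinates
    vanish, and then the brackets vanish too. *)
Lemma lexpos_cross u v w : lexpos u -> lexpos v -> lexpos w ->
  0 < crossp u v -> 0 < crossp v w -> 0 < crossp w u -> False.
Proof.
move=> pu pv pw x y z.
have e1 : crossp u v * w.1 + crossp v w * u.1 + crossp w u * v.1 = 0.
  rewrite /crossp; ring.
have nn (p : R * R) : lexpos p -> 0 <= p.1.
  by case/orP => [/ltW//|/andP[/eqP ->]].
have [w1 u1 v1] : [/\ w.1 = 0, u.1 = 0 & v.1 = 0].
  have h1 := mulr_ge0 (ltW x) (nn _ pw).
  have h2 := mulr_ge0 (ltW y) (nn _ pu).
  have h3 := mulr_ge0 (ltW z) (nn _ pv).
  have z1 : crossp u v * w.1 = 0 by lra.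
  have z2 : crossp v w * u.1 = 0 by lra.
  have z3 : crossp w u * v.1 = 0 by lra.
  by split; apply/eqP; [move/eqP: z1|move/eqP: z2|move/eqP: z3];
    rewrite mulf_eq0 gt_eqF.
by move: x; rewrite /crossp u1 v1 mul0r mulr0 subrr ltxx.
Qed.

(** With x = [a,b], y = [b,c], z = [a,c], the three tested products are yz, xz and -xy. Their
    product is negative, so two of them or none are positive; none would be a cyclic turn, excluded
    by [lexpos_cross]. *)
Lemma valid_count a b c : slope a (dirv b) != 0 -> slope a (dirv c) != 0 ->
  slope b (dirv c) != 0 -> (valid a b c + valid b c a + valid c a b = 2)%N.
Proof.
move=> ab ac bc; rewrite !validE.
have nz p q : slope p (dirv q) != 0 -> crossp (dirv p) (dirv q) != 0.
  have [s s1 e] := dirvE p.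
  apply: contra => /eqP; rewrite e /crossp /slope /= => h; apply/eqP.
  transitivity (s ^+ 2 * (- sin p * (dirv q).1 + cos p * (dirv q).2)).
    by rewrite s1 mul1r.
  transitivity (s * (s * cos p * (dirv q).2 - s * sin p * (dirv q).1)); first ring.
  by rewrite h mulr0.
have x0 := nz _ _ ab; have y0 := nz _ _ bc; have z0 := nz _ _ ac.
have anti u v : crossp u v = - crossp v u by rewrite /crossp; ring.
have l1 := lexpos_cross (lexpos_dirv a) (lexpos_dirv b) (lexpos_dirv c).
have l2 := lexpos_cross (lexpos_dirv b) (lexpos_dirv a) (lexpos_dirv c).
move: l1 l2 x0 y0 z0.
rewrite (anti (dirv c) (dirv a)) (anti (dirv c) (dirv b)) (anti (dirv b) (dirv a)).
set x := crossp (dirv a) (dirv b); set y := crossp (dirv b) (dirv c).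
set z := crossp (dirv a) (dirv c) => l1 l2 x0 y0 z0.
have sg p q : p != 0 -> q != 0 -> (0 < p * q :> R) = ((p < 0) == (q < 0)).
  move=> p0 q0; have [qp|qn|/eqP] := ltgtP q 0; last by rewrite (negbTE q0).
    by rewrite (nmulr_lgt0 _ qp) eqb_id.
  by rewrite (pmulr_lgt0 _ qn) eqbF_neg -leNgt le_eqVlt eq_sym (negbTE p0).
rewrite !sg ?oppr_eq0//; move: l1 l2; rewrite !oppr_lt0 !oppr_gt0.
have pos p : p != 0 -> (0 < p :> R) = ~~ (p < 0).
  by move=> p0; rewrite -leNgt le_eqVlt eq_sym (negbTE p0).
rewrite !pos//; case: (x < 0); case: (y < 0); case: (z < 0) => //= l1 l2.
- by case: (l2 isT isT isT).
- by case: (l1 isT isT isT).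
Qed.

End Validity.

(** * Linear changes of variables *)

Section LinearChange.
Context {R : realType}.
Local Notation mu := (@lebesgue_measure R).
Local Open Scope ereal_scope.

Lemma measurable_affine (a b : R) :
  measurable_fun [set: measurableTypeR R]
    (fun x : measurableTypeR R => (a * x + b)%R : measurableTypeR R).
Proof.
apply: measurable_funD; last exact: measurable_cst.
by apply: measurable_funM; [exact: measurable_cst|exact: measurable_id].
Qed.

Lemma measurable_scale (a : R) :
  measurable_fun [set: measurableTypeR R]
    (fun x : measurableTypeR R => (a * x)%R : measurableTypeR R).
Proof. by apply: measurable_funM; [exact: measurable_cst|exact: measurable_id]. Qed.

Lemma ge0_integral_affine (f : measurableTypeR R -> \bar R) (a b : R) :
  (a != 0)%R -> measurable_fun setT f -> (forall x, 0 <= f x) ->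
  \int[mu]_x f (a * x + b)%R = (`|a|^-1)%:E * \int[mu]_x f x.
Proof.
move=> a0 mf f0.
have na0 : (0 < `|a|)%R by rewrite normr_gt0.
pose phi := fun x : measurableTypeR R => (a * x + b)%R : measurableTypeR R.
have mphi : measurable_fun setT phi by exact: measurable_affine.
have := @ge0_integral_pushforward _ _ _ _ R _ mphi mu setT f measurableT mf.
rewrite preimage_setT => <-; last by move=> x _; exact: f0.
pose c : {nonneg R} := NngNum (ltW na0).
(* Lebesgue measure is identified with |a| times its image under the affine map by comparison on
   half-open intervals; for negative a the preimage is closed at the other end. *)
have key : \int[mu]_x f x = \int[mscale c (pushforward mu phi)]_x f x.
  move=> m; apply: eq_measure_integral => A mA _; apply: lebesgue_measure_unique => //.
  move=> _ [[x y] _ <-] /=; rewrite /mscale /= /pushforward.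
  rewrite lebesgue_measure_itv /=.
  have [a1|a1] := ltP 0%R a.
    have -> : phi @^-1` `]x, y]%classic = `]((x - b) / a)%R, ((y - b) / a)%R]%classic.
      apply/seteqP; split => z /=; rewrite /phi !in_itv/= ltr_pdivrMr// ler_pdivlMr//;
        rewrite (mulrC z) => /andP[? ?]; apply/andP; split; lra.
    rewrite lebesgue_measure_itv /= !lte_fin ltr_pM2r ?invr_gt0// ltrD2r.
    case: ifPn => xy; rewrite ?mule0// -!EFinB -EFinM; congr _%:E.
    by rewrite gtr0_norm//; field; rewrite gt_eqF.
  have {}a1 : (a < 0)%R by rewrite lt_neqAle a0.
  have -> : phi @^-1` `]x, y]%classic = `[((y - b) / a)%R, ((x - b) / a)%R[%classic.
    apply/seteqP; split => z /=; rewrite /phi !in_itv/= ltr_ndivlMr// ler_ndivrMr//;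
      rewrite (mulrC z) => /andP[? ?]; apply/andP; split; lra.
  rewrite lebesgue_measure_itv /= !lte_fin ltr_nM2r ?invr_lt0// ltrD2r.
  case: ifPn => xy; rewrite ?mule0// -!EFinB -EFinM; congr _%:E.
  by rewrite ltr0_norm//; field; rewrite lt_eqF.
rewrite (key mphi) ge0_integral_mscale//= muleA -EFinM mulVf ?gt_eqF// mul1e//.
Qed.

Lemma fubini_swap (f : measurableTypeR R * measurableTypeR R -> \bar R) :
  measurable_fun setT f -> (forall x, 0 <= f x) ->
  \int[mu]_x \int[mu]_y f (x, y) = \int[mu]_y \int[mu]_x f (x, y).
Proof.
move=> mf f0; have e1 := @fubini_tonelli1 _ _ _ _ R mu mu f mf f0.
by have := @fubini_tonelli2 _ _ _ _ R mu mu f mf f0; rewrite e1.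
Qed.

Lemma measurable_linear2 (p q : R) :
  measurable_fun [set: measurableTypeR R * measurableTypeR R]
    (fun z => (p * z.1 + q * z.2)%R : measurableTypeR R).
Proof.
apply: measurable_funD; apply: measurable_funM; try exact: measurable_cst.
- exact: measurable_fst.
- exact: measurable_snd.
Qed.

(** One variable is substituted at a time. Once px + qy has become the first variable, the second
    coordinate has coefficient (ps - qr)/p in y; for p = 0 the variables separate with coefficients
    r and q. *)
Lemma integral_linear2 (f : measurableTypeR R * measurableTypeR R -> \bar R)
    (p q r s : R) : (p * s - q * r != 0)%R ->
  measurable_fun setT f -> (forall x, 0 <= f x) ->
  \int[mu]_x \int[mu]_y f (p * x + q * y, r * x + s * y)%R =
  (`|p * s - q * r|^-1)%:E * \int[mu]_x \int[mu]_y f (x, y).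
Proof.
move=> D0 mf f0.
have mpair (F G : measurableTypeR R * measurableTypeR R -> measurableTypeR R) :
    measurable_fun setT F -> measurable_fun setT G ->
    measurable_fun setT (fun z => f (F z, G z)).
  move=> mF mG; apply: (measurableT_comp mf).
  exact: measurable_fun_pair.
have mx x : measurable_fun setT (fun y => f (x, y)) by exact: measurableT_comp.
have my y : measurable_fun setT (fun x => f (x, y)) by exact: measurableT_comp.
have mfx : measurable_fun setT (fun x => \int[mu]_y f (x, y)).
  exact: (measurable_fun_fubini_tonelli_F f).
have mfy : measurable_fun setT (fun y => \int[mu]_x f (x, y)).
  exact: (measurable_fun_fubini_tonelli_G f).
rewrite (fubini_swap (f := fun z => f (p * z.1 + q * z.2, r * z.1 + s * z.2)%R))//=;
  last by apply: mpair; exact: measurable_linear2.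
have [p0|p0] := eqVneq p 0%R.
  have q0 : (q != 0)%R by apply: contraNneq D0 => ->; rewrite p0 !mul0r subrr.
  have r0 : (r != 0)%R by apply: contraNneq D0 => ->; rewrite p0 mulr0 mul0r subrr.
  transitivity (\int[mu]_y ((`|r|^-1)%:E * \int[mu]_x f (q * y, x)%R)).
    apply: eq_integral => y _.
    rewrite -(ge0_integral_affine (f := fun x => f (q * y, x)%R) (s * y) r0)//.
    by apply: eq_integral => x _; rewrite p0 mul0r add0r.
  have mq : measurable_fun setT (fun y => \int[mu]_x f (q * y, x)%R).
    exact: (measurableT_comp mfx (measurable_scale q)).
  rewrite ge0_integralZl//; last first.
    by move=> y _; apply: integral_ge0.
  have -> : \int[mu]_y \int[mu]_x f (q * y, x)%R = \int[mu]_y \int[mu]_x f (q * y + 0, x)%R.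
    by apply: eq_integral => y _; rewrite addr0.
  rewrite (ge0_integral_affine (f := fun x => \int[mu]_y f (x, y)) 0 q0 mfx);
    last by move=> x; apply: integral_ge0.
  rewrite muleA -EFinM p0 mul0r sub0r normrN normrM invfM mulrC//.
transitivity (\int[mu]_y ((`|p|^-1)%:E *
    \int[mu]_x f (x, r / p * x + (p * s - q * r) / p * y)%R)).
  apply: eq_integral => y _.
  have m1 : measurable_fun setT
      (fun x => f (x, r / p * x + (p * s - q * r) / p * y)%R).
    apply: (measurableT_comp mf); apply: measurable_fun_pair => //.
    exact: measurable_affine.
  rewrite -(ge0_integral_affine (q * y) p0 m1)//.
  by apply: eq_integral => x _; congr (f (_, _)); field.
have m2 : measurable_fun setT (fun z : measurableTypeR R * measurableTypeR R =>
    f (z.1, r / p * z.1 + (p * s - q * r) / p * z.2)%R).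
  by apply: mpair => //; exact: measurable_linear2.
rewrite ge0_integralZl//; last 2 first.
  exact: (measurable_fun_fubini_tonelli_G (fun z : measurableTypeR R * measurableTypeR R =>
    f (z.1, r / p * z.1 + (p * s - q * r) / p * z.2)%R)).
  by move=> y _; apply: integral_ge0.
rewrite -(fubini_swap (f := (fun z : measurableTypeR R * measurableTypeR R =>
    f (z.1, r / p * z.1 + (p * s - q * r) / p * z.2)%R)))//=.
have D1 : ((p * s - q * r) / p != 0)%R by rewrite mulf_neq0// invr_eq0.
transitivity ((`|p|^-1)%:E * \int[mu]_x ((`|(p * s - q * r) / p|^-1)%:E *
    \int[mu]_y f (x, y))).
  congr (_ * _); apply: eq_integral => x _.
  rewrite -(ge0_integral_affine (f := fun y => f (x, y)) (r / p * x) D1)//.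
  by apply: eq_integral => y _; rewrite addrC.
rewrite ge0_integralZl//; last by move=> y _; apply: integral_ge0.
rewrite muleA -EFinM; congr (_%:E * _).
by rewrite normrM normfV; field; rewrite !normr_eq0 D0 p0.
Qed.

Lemma integral_exp (k : R) : (0 < k)%R ->
  \int[mu]_x (if (0 < x)%R then expR (- k * x) else 0)%:E = (k^-1)%:E.
Proof.
move=> k0.
have mE : measurable_fun [set: measurableTypeR R] (fun x => (expR (- k * x))%:E).
  by apply/measurable_EFinP; exact: measurableT_comp (measurable_scale (- k)).
have e1 : \int[mu]_(x in `]0%R, +oo[) (expR (- k * x))%:E =
    \int[mu]_x (if (0 < x)%R then expR (- k * x) else 0)%:E.
  rewrite integral_mkcond; apply: eq_integral => x _; rewrite patchE.
  case: ifPn; rewrite ?inE/= ?in_itv/= ?andbT; first by move=> ->.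
  move=> /negP xN; rewrite ifF//; apply/negbTE/negP => x0; apply: xN.
  by rewrite inE/= in_itv/= x0.
rewrite -e1 integral_itv_obnd_cbnd; last by exact: measurable_funTS.
have := integral_exponential_pdf k0.
have -> : \int[mu]_x (exponential_pdf k x)%:E =
    k%:E * \int[mu]_(x in `[0%R, +oo[) (expR (- k * x))%:E.
  rewrite -ge0_integralZl//; last 2 first.
  - exact: measurable_funTS.
  - by rewrite lee_fin ltW.
  rewrite [RHS]integral_mkcond; apply: eq_integral => x _.
  by rewrite /exponential_pdf !patchE; case: ifPn.
move=> /(congr1 (fun z => (k^-1)%:E * z)).
by rewrite muleA -EFinM mulVf ?gt_eqF// mul1e mule1.
Qed.

End LinearChange.

(** * Integrals over three lines *)

Section FubiniTriple.
Local Open Scope ereal_scope.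
Context d1 d2 d3 (T1 : measurableType d1) (T2 : measurableType d2)
  (T3 : measurableType d3) (R : realType).
Variables (m1 : {sigma_finite_measure set T1 -> \bar R})
  (m2 : {sigma_finite_measure set T2 -> \bar R})
  (m3 : {sigma_finite_measure set T3 -> \bar R}).

(** Lets the product of the first two measures serve as a single factor in Tonelli's theorem. *)
Lemma sigma_finite_product : sigma_finite setT (m1 \x m2).
Proof.
have /sigma_finiteP[F [TF ndF Ffin]] := sigma_finiteT m1.
have /sigma_finiteP[G [TG ndG Gfin]] := sigma_finiteT m2.
exists (fun n => F n `*` G n).
  apply/esym/seteqP; split => // -[x y] _.
  have [i _ Fi] : (\bigcup_i F i) x by rewrite -TF.
  have [j _ Gj] : (\bigcup_i G i) y by rewrite -TG.
  exists (maxn i j) => //; split.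
  - by apply: (subsetPset _ _ (ndF _ _ (leq_maxl i j))).
  - by apply: (subsetPset _ _ (ndG _ _ (leq_maxr i j))).
move=> n; have [mF Fn] := Ffin n; have [mG Gn] := Gfin n.
split; first exact: measurableX.
by rewrite product_measure1E// lte_mul_pinfty// ge0_fin_numE.
Qed.

Lemma fubini_tonelli_triple (f : T1 * T2 * T3 -> \bar R) :
  measurable_fun setT f -> (forall y, 0 <= f y) ->
  \int[m1 \x m2 \x m3]_y f y = \int[m1 \x m2]_z \int[m3]_h f (z, h).
Proof.
move=> mf f0.
pose m12 : {sigma_finite_measure set (T1 * T2)%type -> \bar R} :=
  HB.pack (m1 \x m2) (Measure_isSigmaFinite.Build _ _ _ (m1 \x m2) sigma_finite_product).
exact: (fubini_tonelli1 (m1 := m12) f mf f0).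
Qed.

End FubiniTriple.

Section Region.
Context {R : realType}.
Local Notation mu := (@lebesgue_measure R).
Local Open Scope ereal_scope.

(* The crossing of the lines (t1, z.1) and (t2, z.2). *)
Definition meet (t1 t2 : R) (z : R * R) : R * R :=
  ((cos t2 * z.1 - cos t1 * z.2) / sin (t2 - t1),
   (sin t2 * z.1 - sin t1 * z.2) / sin (t2 - t1))%R.

Definition square (a b : R) : set (R * R) := `]a, b[ `*` `]a, b[.

Definition sq (a b : R) (z : R * R) : R := \1_(square a b) z.

Lemma sq_ge0 a b z : (0 <= sq a b z)%R.
Proof. by []. Qed.

Lemma integral_square (a b : R) : (a <= b)%R ->
  \int[mu]_x \int[mu]_y (sq a b (x, y))%:E = ((b - a) ^+ 2)%:E.
Proof.
move=> ab.
have l : mu `]a, b[%classic = (b - a)%:E.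
  rewrite lebesgue_measure_itv /= lte_fin; case: ltP => //= ba.
  by have -> : b = a; [lra|rewrite subrr].
have e : \int[mu]_y (\1_(`]a, b[%classic) y)%:E = (b - a)%:E.
  by rewrite integral_indic// setIT.
have mi : measurable_fun setT (fun y : measurableTypeR R => (\1_(`]a, b[%classic) y : R)%:E).
  by apply/measurable_EFinP; exact: measurable_indic.
transitivity (\int[mu]_x ((b - a)%:E * (\1_(`]a, b[%classic) x)%:E)).
  apply: eq_integral => x _.
  transitivity (\int[mu]_y ((\1_(`]a, b[%classic) x)%:E * (\1_(`]a, b[%classic) y)%:E)).
    apply: eq_integral => y _; rewrite -EFinM; congr _%:E.
    by rewrite /sq /square !indicE in_setX -natrM mulnb.
  by rewrite ge0_integralZl//= e muleC.
rewrite ge0_integralZl//=; last by rewrite lee_fin subr_ge0.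
by rewrite e -EFinM expr2.
Qed.

Lemma measurable_square (a b : R) :
  measurable (square a b : set (measurableTypeR R * measurableTypeR R)).
Proof. by apply: measurableX; exact: measurable_itv. Qed.

Lemma measurable_sq (a b : R) : measurable_fun setT
  (sq a b : measurableTypeR R * measurableTypeR R -> R).
Proof. by apply: measurable_indic; exact: measurable_square. Qed.

Lemma measurable_meet (t1 t2 : R) :
  measurable_fun setT (fun z : measurableTypeR R * measurableTypeR R =>
    meet t1 t2 z : measurableTypeR R * measurableTypeR R).
Proof.
have h (u v w : R) : measurable_fun setT (fun z : measurableTypeR R * measurableTypeR R =>
    ((u * z.1 - v * z.2) / w)%R : measurableTypeR R).
  apply: (eq_measurable_fun (fun z => (u / w * z.1 + (- v / w) * z.2)%R)).
    by move=> z _; rewrite !mulNr mulrAC (mulrAC v) mulrBl.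
  exact: measurable_linear2.
exact: measurable_fun_pair.
Qed.

(** The linear map from the two signed distances to the crossing has determinant 1 / sin(t2 -
    t1). *)
Lemma integral_meet (t1 t2 a b : R) : sin (t2 - t1) != 0%R -> (a <= b)%R ->
  \int[mu]_x \int[mu]_y (sq a b (meet t1 t2 (x, y)))%:E =
  (`|sin (t2 - t1)| * (b - a) ^+ 2)%:E.
Proof.
move=> s0 ab; set s := sin (t2 - t1) in s0 *.
pose p := (cos t2 / s)%R; pose q := (- cos t1 / s)%R.
pose r := (sin t2 / s)%R; pose r' := (- sin t1 / s)%R.
have D : (p * r' - q * r = s^-1)%R.
  transitivity ((sin t2 * cos t1 - cos t2 * sin t1) / s ^+ 2)%R.
    by rewrite /p /q /r /r'; field.
  by rewrite -sinB -/s; field.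
have mf : measurable_fun setT (EFin \o sq a b :
    measurableTypeR R * measurableTypeR R -> \bar R).
  by apply/measurable_EFinP; exact: measurable_sq.
have D0 : (p * r' - q * r != 0)%R by rewrite D invr_eq0.
have f0 (x : measurableTypeR R * measurableTypeR R) : 0 <= (EFin \o sq a b) x.
  by rewrite /= lee_fin.
transitivity (\int[mu]_x \int[mu]_y (EFin \o sq a b) (p * x + q * y, r * x + r' * y)%R).
  have mE (x y : R) : meet t1 t2 (x, y) = (p * x + q * y, r * x + r' * y)%R.
    by rewrite /meet /= -/s /p /q /r /r'; congr (_, _); field.
  by apply: eq_integral => x _; apply: eq_integral => y _ /=; rewrite mE.
rewrite (integral_linear2 D0 mf f0) D normfV invrK [RHS]EFinM.
congr (_ * _); exact: integral_square.
Qed.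

(** For fixed first two lines the argument of [phi] is a translate of the third coordinate, so the
    integral of [phi] factors out and the area of the square remains, up to the Jacobian. *)
Lemma integral_region (t1 t2 a b p q : R) (phi : measurableTypeR R -> \bar R) :
  sin (t2 - t1) != 0%R -> (a <= b)%R -> measurable_fun setT phi ->
  (forall x, 0 <= phi x) ->
  \int[(mu \x mu) \x mu]_y ((sq a b (meet t1 t2 y.1))%:E *
     phi (y.2 - (p * y.1.1 + q * y.1.2))%R) =
  (`|sin (t2 - t1)| * (b - a) ^+ 2)%:E * \int[mu]_x phi x.
Proof.
move=> s0 ab mphi phi0.
have m1 : measurable_fun setT (fun z : measurableTypeR R * measurableTypeR R =>
    (sq a b (meet t1 t2 z))%:E).
  by apply/measurable_EFinP; exact: measurableT_comp (@measurable_sq a b) (measurable_meet t1 t2).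
have m2 : measurable_fun setT
    (fun y : (measurableTypeR R * measurableTypeR R) * measurableTypeR R =>
    phi (y.2 - (p * y.1.1 + q * y.1.2))%R).
  apply: (measurableT_comp mphi); apply: measurable_funB; first exact: measurable_snd.
  exact: (measurableT_comp (measurable_linear2 p q) (@measurable_fst _ _ _ _)).
pose f (y : (measurableTypeR R * measurableTypeR R) * measurableTypeR R) :=
  (sq a b (meet t1 t2 y.1))%:E * phi (y.2 - (p * y.1.1 + q * y.1.2))%R.
have mf : measurable_fun setT f.
  apply: emeasurable_funM; last exact: m2.
  exact: (measurableT_comp m1 (@measurable_fst _ _ _ _)).
have f0 y : 0 <= f y by rewrite /f mule_ge0// lee_fin sq_ge0.
have -> : \int[(mu \x mu) \x mu]_y f y = \int[mu \x mu]_z \int[mu]_h f (z, h).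
  exact: fubini_tonelli_triple.
transitivity (\int[mu \x mu]_z ((sq a b (meet t1 t2 z))%:E * \int[mu]_x phi x)).
  apply: eq_integral => z _; rewrite /f /= ge0_integralZl//; last 2 first.
  - exact: (measurableT_comp m2 (measurable_pair1 z)).
  - by rewrite lee_fin.
  congr (_ * _).
  have := ge0_integral_affine (f := phi) (- (p * z.1 + q * z.2)) (oner_neq0 R) mphi phi0.
  rewrite normr1 invr1 mul1e => <-.
  by apply: eq_integral => x _; rewrite mul1r.
rewrite ge0_integralZr//; [|by move=> z _; rewrite lee_fin sq_ge0|exact: integral_ge0].
rewrite fubini_tonelli1//; last by move=> z; rewrite lee_fin sq_ge0.
congr (_ * _); exact: integral_meet.
Qed.

End Region.

(** * Counting measures and a Campbell formula for triples of lines *)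

Section Counting.
Context {R : realType}.
Local Open Scope ereal_scope.
Local Notation cnt := (@counting _ R).

Lemma counting_finite (T : choiceType) (A : set T) :
  finite_set A -> cnt A = (#|` fset_set A|%fset)%:R%:E.
Proof. by move=> fA; rewrite /counting asboolT. Qed.

Lemma counting_infinite (T : choiceType) (A : set T) :
  ~ finite_set A -> cnt A = +oo.
Proof. by move=> fA; rewrite /counting asboolF. Qed.

Lemma counting0 (T : choiceType) : cnt (set0 : set T) = 0.
Proof. by rewrite counting_finite// fset_set0. Qed.

Lemma counting1 (T : choiceType) (x : T) : cnt [set x] = 1.
Proof. by rewrite counting_finite// fset_set1 cardfs1. Qed.

Lemma counting_eq0 (T : choiceType) (A : set T) : cnt A = 0 <-> A = set0.
Proof.
split => [|->]; last exact: counting0.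
have [fA|fA] := pselect (finite_set A); last by rewrite counting_infinite.
rewrite counting_finite// => -[/eqP]; rewrite pnatr_eq0 cardfs_eq0 => /eqP e.
by rewrite -(fset_setK fA) e; apply/seteqP; split.
Qed.

Lemma counting_eq1 (T : choiceType) (A : set T) :
  cnt A = 1 <-> exists x, A = [set x].
Proof.
split => [|[x ->]]; last exact: counting1.
have [fA|fA] := pselect (finite_set A); last by rewrite counting_infinite.
rewrite counting_finite// => -[/eqP]; rewrite -[1%R]/(1%:R) eqr_nat.
move=> /cardfs1P[x e]; exists x; rewrite -(fset_setK fA) e.
by apply/seteqP; split => y /=; rewrite ?inE => /eqP.
Qed.

Lemma counting_cvg (T : pointedType) (S : nat -> set T) :
  (forall n, S n `<=` S n.+1) ->
  cnt (S n) @[n --> \oo] --> cnt (\bigcup_n S n).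
Proof.
(* For the discrete sigma-algebra [counting] is a measure, and continuity from below applies. *)
move=> ndS; pose M := g_sigma_algebraType [set: set T].
have mM (A : set M) : measurable A by exact: sub_sigma_algebra.
apply: (@nondecreasing_cvg_mu _ M R cnt) => //.
by apply/nondecreasing_seqP => n; apply/subsetPset; exact: ndS.
Qed.

Lemma counting_fin_bigcup (T : pointedType) (I : choiceType) (D : set I) (F : I -> set T) :
  finite_set D -> trivIset D F ->
  cnt (\bigcup_(i in D) F i) = \sum_(i \in D) cnt (F i).
Proof.
move=> fD tF; pose M := g_sigma_algebraType [set: set T].
have mM (A : set M) : measurable A by exact: sub_sigma_algebra.
exact: (@measure_fin_bigcup _ R M cnt).
Qed.

Lemma counting_esum (T : choiceType) (A : set T) : cnt A = \esum_(x in A) 1.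
Proof.
have fin (F : set T) : finite_set F -> \esum_(x in F) (1 : \bar R) = cnt F.
  move=> fF; rewrite esum_fset// fsbig_finite//= counting_finite//.
  by rewrite sumEFin big_const_seq count_predT iter_addr addr0.
have [fA|fA] := pselect (finite_set A); first by rewrite fin.
rewrite counting_infinite//; apply/esym/eqyP => r r0.
have [B BA nB] := infinite_set_fset (Num.bound r) fA.
have fB := finite_fset B.
apply: (@le_trans _ _ (cnt [set` B])).
  rewrite counting_finite// set_fsetK lee_fin.
  rewrite (@le_trans _ _ (Num.bound r)%:R)//; last by rewrite ler_nat.
  by rewrite ltW// archi_boundP// ltW.
rewrite -fin// esum_mkcond [leRHS]esum_mkcond; apply: le_esum => x _.
case: ifPn => [/set_mem xB|_]; last by case: ifP.
by rewrite ifT//; apply/mem_set/BA.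
Qed.

End Counting.

(** * Probability of isolating three points *)

Section PoissonEvents.
Context {R : realType} {d d' : measure_display}.
Context {Omega : measurableType d} {T : measurableType d'}.
Variables (P : probability Omega R) (mu : {measure set T -> \bar R}).
Variable X : Omega -> set T.
Hypothesis pp : poisson_process P mu X.
Local Open Scope ereal_scope.

Lemma measurable_count_eq B (c : \bar R) : measurable B ->
  measurable [set w | point_count X B w = c].
Proof.
move=> mB; have := poisson_process_measurable pp mB measurableT (emeasurable_set1 c).
by rewrite setTI.
Qed.

Definition single_event (I1 I2 I3 Q : set T) : set Omega :=
  [set w | [/\ point_count X I1 w = 1 :> \bar R, point_count X I2 w = 1 :> \bar R,
     point_count X I3 w = 1 :> \bar R &
     point_count X (Q `\` (I1 `|` I2 `|` I3)) w = 0 :> \bar R]].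

Lemma measurable_single_event I1 I2 I3 Q :
  measurable I1 -> measurable I2 -> measurable I3 -> measurable Q ->
  measurable (single_event I1 I2 I3 Q).
Proof.
move=> m1 m2 m3 mQ.
have -> : single_event I1 I2 I3 Q =
    [set w | point_count X I1 w = 1 :> \bar R] `&`
    [set w | point_count X I2 w = 1 :> \bar R] `&`
    [set w | point_count X I3 w = 1 :> \bar R] `&`
    [set w | point_count X (Q `\` (I1 `|` I2 `|` I3)) w = 0 :> \bar R].
  by apply/seteqP; split => w /=; [move=> []|move=> [[[]]]].
apply: measurableI; first apply: measurableI; first apply: measurableI;
  apply: measurable_count_eq => //.
by apply: measurableD => //; apply: measurableU => //; exact: measurableU.
Qed.

(** The three small sets and the rest of [Q] are disjoint, so the four counts are independent. Their
    masses add up to [q], and the four exponentials multiply to exp(-q). *)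
Lemma single_event_prob I1 I2 I3 Q (a1 a2 a3 q : R) :
  measurable I1 -> measurable I2 -> measurable I3 -> measurable Q ->
  I1 `&` I2 = set0 -> I1 `&` I3 = set0 -> I2 `&` I3 = set0 ->
  I1 `<=` Q -> I2 `<=` Q -> I3 `<=` Q ->
  mu I1 = a1%:E -> mu I2 = a2%:E -> mu I3 = a3%:E -> mu Q = q%:E ->
  P (single_event I1 I2 I3 Q) = (a1 * a2 * a3 * expR (- q))%:E.
Proof.
move=> m1 m2 m3 mQ d12 d13 d23 s1 s2 s3 e1 e2 e3 eQ.
set V := Q `\` (I1 `|` I2 `|` I3).
have mV : measurable V.
  by apply: measurableD => //; apply: measurableU => //; exact: measurableU.
have eV : mu V = (q - a1 - a2 - a3)%:E.
  have : mu Q = mu (I1 `|` I2 `|` I3) + mu V.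
    rewrite -measureU//; last 2 first.
      by apply: measurableU => //; exact: measurableU.
      by apply/seteqP; split => x //= -[h [_]].
    congr (mu _); apply/seteqP; split => x /=.
      by move=> Qx; have [h|h] := pselect ((I1 `|` I2 `|` I3) x); [left|right].
    by move=> [[[/s1|/s2]|/s3]|[]].
  have e12 : mu (I1 `|` I2) = (a1 + a2)%:E.
    by rewrite measureU// EFinD; congr (_ + _).
  have -> : mu (I1 `|` I2 `|` I3) = (a1 + a2 + a3)%:E.
    rewrite measureU//; first by rewrite EFinD; congr (_ + _).
      exact: measurableU.
    by rewrite setIUl d13 d23 setU0.
  rewrite eQ.
  have finV : mu V \is a fin_num.
    rewrite ge0_fin_numE// (@le_lt_trans _ _ (mu Q))//; last by rewrite eQ ltry.
    by apply: le_measure; rewrite ?inE//; exact: subDsetl.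
  rewrite -(fineK finV) -!EFinD => -[->]; congr _%:E; ring.
pose B (i : 'I_4) := nth set0 [:: I1; I2; I3; V] i.
pose C (i : 'I_4) : set (\bar R) := nth set0 [:: [set 1]; [set 1]; [set 1]; [set 0]] i.
have mB i : measurable (B i) by case: i => [[|[|[|[|?]]]] ?].
have mC i : measurable (C i).
  by case: i => [[|[|[|[|?]]]] ?] //; exact: emeasurable_set1.
have tB : trivIset [set: 'I_4] B.
  have V1 : I1 `&` V = set0 by apply/seteqP; split => x //= -[h [_]]; apply; left; left.
  have V2 : I2 `&` V = set0 by apply/seteqP; split => x //= -[h [_]]; apply; left; right.
  have V3 : I3 `&` V = set0 by apply/seteqP; split => x //= -[h [_]]; apply; right.
  apply/trivIsetP => i j _ _; rewrite -val_eqE /B /=.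
  case: i j => [[|[|[|[|?]]]] ?] [[|[|[|[|?]]]] ?] //= _ //; by rewrite setIC.
have -> : single_event I1 I2 I3 Q = \bigcap_i (point_count X (B i) @^-1` C i).
  apply/seteqP; split => w.
    by move=> [w1 w2 w3 w4] [[|[|[|[|?]]]] ?] _.
  move=> h; split.
  - exact: (h (Ordinal (isT : 0 < 4)%N)).
  - exact: (h (Ordinal (isT : 1 < 4)%N)).
  - exact: (h (Ordinal (isT : 2 < 4)%N)).
  - exact: (h (Ordinal (isT : 3 < 4)%N)).
rewrite (poisson_process_indep pp)//.
have law1 I a : measurable I -> mu I = a%:E ->
    P (point_count X I @^-1` [set (1 : \bar R)]) = (expR (- a) * a)%:E.
  move=> mI eI; have := poisson_process_law pp mI.
  rewrite eI ltry => /(_ isT 1%N) /=; rewrite expr1 divr1; exact.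
have law0 I a : measurable I -> mu I = a%:E ->
    P (point_count X I @^-1` [set (0 : \bar R)]) = (expR (- a))%:E.
  move=> mI eI; have := poisson_process_law pp mI.
  rewrite eI ltry => /(_ isT 0%N) /=; rewrite expr0 divr1 mulr1; exact.
rewrite !big_ord_recl big_ord0 /B /C /=.
rewrite (law1 _ _ m1 e1) (law1 _ _ m2 e2) (law1 _ _ m3 e3) (law0 _ _ mV eV) mule1 -!EFinM.
congr _%:E.
have -> : (- q = - a1 + (- a2 + (- a3 + - (q - a1 - a2 - a3))))%R by ring.
by rewrite !expRD; ring.
Qed.

End PoissonEvents.

(** * Dyadic boxes *)

Section Dyadic.
Context {R : realType}.

Definition idx (n : nat) (y : R) : int := Num.floor (y * 2 ^+ n).

Definition idx3 (n : nat) (y : R * R * R) : int * int * int :=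
  (idx n y.1.1, idx n y.1.2, idx n y.2).

Definition box (n : nat) (z : int) : set R := [set y | idx n y = z].

Definition box3 (n : nat) (z : int * int * int) : set (R * R * R) :=
  [set y | idx3 n y = z].

Lemma boxE n z : box n z = `[z%:~R / 2 ^+ n, (z + 1)%:~R / 2 ^+ n[%classic.
Proof.
have p0 : 0 < 2 ^+ n :> R by rewrite exprn_gt0.
apply/seteqP; split => y /=; rewrite in_itv/= ler_pdivrMr// ltr_pdivlMr//.
  by move=> <-; exact: floor_itv.
by move=> /floor_def.
Qed.

Lemma box3E n z : box3 n z = (box n z.1.1 `*` box n z.1.2) `*` box n z.2.
Proof.
case: z => [[a b] c]; apply/seteqP; split => y; first by rewrite /box3 /idx3 /= => -[<- <- <-].
by move=> [[/= <- <-] /= <-].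
Qed.

Lemma measurable_box n z : measurable (box n z : set (measurableTypeR R)).
Proof. by rewrite boxE; exact: measurable_itv. Qed.

Lemma lebesgue_box n z : @lebesgue_measure R (box n z) = (2 ^- n)%:E.
Proof.
have p0 : 0 < 2 ^+ n :> R by rewrite exprn_gt0.
rewrite boxE lebesgue_measure_itv /= lte_fin ltr_pM2r ?invr_gt0// ltr_int ltrDl ltr01.
by rewrite -EFinB; congr _%:E; rewrite -mulrBl intrD addrAC subrr add0r mul1r.
Qed.

Lemma measurable_box3 n z :
  measurable (box3 n z : set (measurableTypeR R * measurableTypeR R * measurableTypeR R)).
Proof.
rewrite box3E; apply: measurableX; last exact: measurable_box.
by apply: measurableX; exact: measurable_box.
Qed.

Lemma lebesgue_box3 n z :
  ((@lebesgue_measure R \x @lebesgue_measure R) \x @lebesgue_measure R)%E (box3 n z)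
  = ((2 ^- n) ^+ 3)%:E.
Proof.
have m12 : measurable (box n z.1.1 `*` box n z.1.2 :
    set (measurableTypeR R * measurableTypeR R)).
  by apply: measurableX; exact: measurable_box.
rewrite box3E product_measure1E//; last exact: measurable_box.
rewrite /= product_measure1E; [|exact: measurable_box|exact: measurable_box].
transitivity ((2 ^- n)%:E * (2 ^- n)%:E * (2 ^- n)%:E : \bar R)%E.
  by congr (_ * _ * _)%E; exact: lebesgue_box.
by rewrite -!EFinM; congr _%:E; ring.
Qed.

Lemma idx_close n y : (idx n y)%:~R / 2 ^+ n <= y < (idx n y)%:~R / 2 ^+ n + 2 ^- n.
Proof.
have : box n (idx n y) y by [].
by rewrite boxE /= in_itv/= intrD mulrDl mul1r.
Qed.

Lemma idxS n y : idx n y = Num.floor ((idx n.+1 y)%:~R / 2 :> R).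
Proof.
apply/floor_def; have /andP[a b] := floor_itv (y * 2 ^+ n.+1).
have /andP[c d] := floor_itv ((idx n.+1 y)%:~R / 2 : R).
have e : y * 2 ^+ n.+1 = y * 2 ^+ n * 2 by rewrite exprSr mulrA.
rewrite -/(idx n.+1 y) e in a b; set m := Num.floor _ in c d *.
apply/andP; split; first by lra.
have d' : (idx n.+1 y)%:~R < (2 * (m + 1))%:~R :> R.
  by rewrite intrM; move: d; rewrite ltr_pdivrMr// mulrC.
have : (idx n.+1 y + 1)%:~R <= (2 * (m + 1))%:~R :> R.
  by rewrite ler_int lezD1 -(ltr_int R).
by rewrite intrM; move: b; lra.
Qed.

Lemma idx3S n y y' : idx3 n.+1 y = idx3 n.+1 y' -> idx3 n y = idx3 n y'.
Proof. by rewrite /idx3 => -[e1 e2 e3]; rewrite !(idxS n) e1 e2 e3. Qed.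

End Dyadic.

(** * Expected number of isolated triples *)

Section Grid.
Context {R : realType} {d d' : measure_display}.
Context {Omega : measurableType d} {T : measurableType d'}.
Variables (P : probability Omega R) (mu : {measure set T -> \bar R}).
Variable X : Omega -> set T.
Hypothesis pp : poisson_process P mu X.
Variables (i1 i2 i3 : R -> T) (lam : R).
Hypotheses (inj1 : injective i1) (inj2 : injective i2) (inj3 : injective i3).
Hypotheses (dis12 : forall x y, i1 x <> i2 y) (dis13 : forall x y, i1 x <> i3 y)
  (dis23 : forall x y, i2 x <> i3 y).
Hypotheses (m1 : forall n z, measurable (i1 @` box n z))
  (m2 : forall n z, measurable (i2 @` box n z))
  (m3 : forall n z, measurable (i3 @` box n z)).
Hypotheses (mu1 : forall n z, mu (i1 @` box n z) = (lam * 2 ^- n)%:E)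
  (mu2 : forall n z, mu (i2 @` box n z) = (lam * 2 ^- n)%:E)
  (mu3 : forall n z, mu (i3 @` box n z) = (lam * 2 ^- n)%:E).
Hypothesis lam_ge0 : 0 <= lam.

Variables (sel : nat -> set (int * int * int)) (Q : nat -> int * int * int -> set T)
  (q : nat -> int * int * int -> R).
Hypotheses (fin_sel : forall n, finite_set (sel n))
  (mQ : forall n z, measurable (Q n z)) (muQ : forall n z, mu (Q n z) = (q n z)%:E).
Hypothesis subQ : forall n z, [/\ i1 @` box n z.1.1 `<=` Q n z,
  i2 @` box n z.1.2 `<=` Q n z & i3 @` box n z.2 `<=` Q n z].
Hypothesis selS : forall n (y : R * R * R), sel n (idx3 n y) -> sel n.+1 (idx3 n.+1 y).
Hypothesis QS : forall n (y : R * R * R), Q n.+1 (idx3 n.+1 y) `<=` Q n (idx3 n y).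

Definition three_pts (y : R * R * R) : set T := [set i1 y.1.1; i2 y.1.2; i3 y.2].

(** The forbidden set [Q] depends on the triple only through its box, which reduces the condition on
    each selected box to four counts in fixed sets. Finer boxes have smaller forbidden sets, so more
    triples become isolated. *)
Definition isolated n (w : Omega) : set (R * R * R) :=
  [set y | [/\ sel n (idx3 n y), three_pts y `<=` X w & X w `&` Q n (idx3 n y) `<=` three_pts y]].

Lemma isolatedS n w : isolated n w `<=` isolated n.+1 w.
Proof.
move=> y [sy yX XQ]; split => //; first exact: selS.
by apply: subset_trans XQ; apply: setIS; exact: QS.
Qed.

Let event n z := @single_event R _ _ _ _ X (i1 @` box n z.1.1) (i2 @` box n z.1.2)
  (i3 @` box n z.2) (Q n z).

Local Notation cnt := (@counting _ R).

(** All points of [X w] in [Q n z] belong to the triple, and the box puts one of its points into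
    each of three disjoint images; hence at most one triple qualifies. *)
Lemma count_isolated_box n z w : sel n z ->
  cnt (isolated n w `&` box3 n z) = (\1_(event n z) w : R)%:E.
Proof.
move=> sz; have [s1 s2 s3] := subQ n z.
have [wE|wE] := pselect (event n z w).
  rewrite indicE mem_set//; case: wE.
  move=> /counting_eq1[x1 e1] /counting_eq1[x2 e2] /counting_eq1[x3 e3] /counting_eq0 e4.
  have [X1 [y1 b1 h1]] : (X w `&` i1 @` box n z.1.1) x1 by rewrite e1.
  have [X2 [y2 b2 h2]] : (X w `&` i2 @` box n z.1.2) x2 by rewrite e2.
  have [X3 [y3 b3 h3]] : (X w `&` i3 @` box n z.2) x3 by rewrite e3.
  suff -> : isolated n w `&` box3 n z = [set (y1, y2, y3)] by rewrite counting1.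
  apply/seteqP; split => [y [[sy yX XQ]]|_ ->].
    rewrite box3E => -[[c1 c2] c3]; case: y => [[a b] c] in sy yX XQ c1 c2 c3 *.
    have : [set x1] (i1 a).
      by rewrite -e1; split; [apply: yX; left; left|exists a].
    have : [set x2] (i2 b).
      by rewrite -e2; split; [apply: yX; left; right|exists b].
    have : [set x3] (i3 c).
      by rewrite -e3; split; [apply: yX; right|exists c].
    by rewrite -h1 -h2 -h3 => /inj3 -> /inj2 -> /inj1 ->.
  have e : idx3 n (y1, y2, y3) = z.
    by move: b1 b2 b3; rewrite /box /idx3 /= => -> -> ->; case: z {sz s1 s2 s3 e1 e2 e3 e4} => [[]].
  split=> //; split; rewrite ?e//.
    by move=> x [[]|] ->; rewrite ?h1 ?h2 ?h3.
  move=> x [Xx Qx].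
  have [[[|]|]|nx] := pselect ((i1 @` box n z.1.1 `|` i2 @` box n z.1.2 `|` i3 @` box n z.2) x).
  - move=> h; left; left; have : [set x1] x by rewrite -e1.
    by move=> /= ->.
  - move=> h; left; right; have : [set x2] x by rewrite -e2.
    by move=> /= ->.
  - move=> h; right; have : [set x3] x by rewrite -e3.
    by move=> /= ->.
  by have : set0 x by rewrite -e4.
rewrite indicE memNset// counting_eq0.
apply/seteqP; split => // y [[sy yX XQ]] yz; apply: wE.
have e : idx3 n y = z := yz; rewrite e in XQ.
rewrite box3E in yz; case: yz => -[c1 c2] c3.
split.
- apply/counting_eq1; exists (i1 y.1.1); apply/seteqP; split => [x [Xx bx]|_ ->].
    have := XQ x (conj Xx (s1 _ bx)); case: bx => b _ <- [[|]|] /=.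
    + by move=> ->.
    + by move=> h; case: (dis12 h).
    + by move=> h; case: (dis13 h).
  by split; [apply: yX; left; left|exists y.1.1].
- apply/counting_eq1; exists (i2 y.1.2); apply/seteqP; split => [x [Xx bx]|_ ->].
    have := XQ x (conj Xx (s2 _ bx)); case: bx => b _ <- [[|]|] /=.
    + by move=> /esym h; case: (dis12 h).
    + by move=> ->.
    + by move=> h; case: (dis23 h).
  by split; [apply: yX; left; right|exists y.1.2].
- apply/counting_eq1; exists (i3 y.2); apply/seteqP; split => [x [Xx bx]|_ ->].
    have := XQ x (conj Xx (s3 _ bx)); case: bx => b _ <- [[|]|] /=.
    + by move=> /esym h; case: (dis13 h).
    + by move=> /esym h; case: (dis23 h).
    + by move=> ->.
  by split; [apply: yX; right|exists y.2].
- apply/counting_eq0/seteqP; split => // x [Xx [Qx]]; apply.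
  case: (XQ x (conj Xx Qx)) => [[|]|] ->.
  + by left; left; exists y.1.1.
  + by left; right; exists y.1.2.
  + by right; exists y.2.
Qed.

Lemma count_isolated n w :
  cnt (isolated n w) = (\sum_(z \in sel n) (\1_(event n z) w : R)%:E)%E.
Proof.
have -> : isolated n w = \bigcup_(z in sel n) (isolated n w `&` box3 n z).
  apply/seteqP; split => y; last by move=> [z _ []].
  by move=> h; exists (idx3 n y) => //; case: h.
rewrite counting_fin_bigcup//.
  by apply: eq_fsbigr => z /set_mem sz; exact: count_isolated_box.
by move=> z z' _ _ [y [[_ <-] [_ <-]]].
Qed.

Let nu := ((@lebesgue_measure R \x @lebesgue_measure R) \x @lebesgue_measure R)%E.

(** A step density: on a box, [lam ^+ 3] times the volume is the product of the masses of the three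
    images, and the exponential is the factor left by [single_event_prob]. *)
Let g n (y : R * R * R) : \bar R :=
  (if idx3 n y \in sel n then lam ^+ 3 * expR (- q n (idx3 n y)) else 0)%:E.

Let gE n y : g n y =
  (\sum_(z \in sel n) ((lam ^+ 3 * expR (- q n z))%:E * (\1_(box3 n z) y)%:E))%E.
Proof.
rewrite /g; case: ifPn => [/set_mem sy|/negP sy].
  rewrite (fsbigD1 (idx3 n y))//= indicE mem_set// mule1.
  rewrite fsbig1 ?adde0// => z [_ zy]; rewrite indicE memNset ?mule0// => e.
  by apply: zy; rewrite /= e.
rewrite fsbig1// => z sz; rewrite indicE memNset ?mule0// => e.
by apply: sy; apply/mem_set; rewrite e.
Qed.

Let mevent n z : measurable (event n z).
Proof. exact: (measurable_single_event pp). Qed.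

Let mg n : measurable_fun setT
  (g n : measurableTypeR R * measurableTypeR R * measurableTypeR R -> \bar R).
Proof.
rewrite (_ : g n = fun y => (\sum_(z \in sel n)
    ((lam ^+ 3 * expR (- q n z))%:E * (\1_(box3 n z) y)%:E))%E); last first.
  by apply/funext => y; exact: gE.
apply: emeasurable_fsum => // z; apply: measurable_funeM.
by apply/measurable_EFinP; apply: measurable_indic; exact: measurable_box3.
Qed.

Let integral_step n :
  (\int[P]_w cnt (isolated n w) = \int[nu]_y g n y)%E.
Proof.
transitivity (\sum_(z \in sel n) ((lam ^+ 3 * expR (- q n z)) * (2 ^- n) ^+ 3)%:E)%E.
  under eq_integral do rewrite count_isolated.
  rewrite ge0_integral_fsum//; last first.
    by move=> z; apply/measurable_EFinP; exact: measurable_indic.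
  apply: eq_fsbigr => z /set_mem sz; rewrite integral_indic// setIT.
  have [s1 s2 s3] := subQ n z.
  have disj (f f' : R -> T) A B : (forall x y, f x <> f' y) -> f @` A `&` f' @` B = set0.
    by move=> fg; apply/seteqP; split => x // -[[a _ <-] [b _ /esym/fg]].
  transitivity ((lam * 2 ^- n * (lam * 2 ^- n) * (lam * 2 ^- n) * expR (- q n z))%:E).
    exact: (single_event_prob pp (m1 _ _) (m2 _ _) (m3 _ _) (mQ n z)
    (disj _ _ _ _ dis12) (disj _ _ _ _ dis13) (disj _ _ _ _ dis23) s1 s2 s3
    (mu1 _ _) (mu2 _ _) (mu3 _ _) (muQ n z)).
  by congr _%:E; ring.
under [RHS]eq_integral do rewrite gE.
rewrite ge0_integral_fsum//; last 2 first.
- move=> z; apply: measurable_funeM.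
  by apply/measurable_EFinP; apply: measurable_indic; exact: measurable_box3.
- move=> z y _; rewrite mule_ge0// lee_fin ?mulr_ge0 ?exprn_ge0 ?expR_ge0//.
apply: eq_fsbigr => z /set_mem sz.
rewrite ge0_integralZl//; last 2 first.
- by apply/measurable_EFinP; apply: measurable_indic; exact: measurable_box3.
- by rewrite lee_fin mulr_ge0 ?exprn_ge0 ?expR_ge0.
rewrite integral_indic//; last exact: measurable_box3.
by rewrite setIT EFinM; congr (_ * _)%E; apply/esym; exact: lebesgue_box3.
Qed.

Lemma measurable_count_isolated :
  measurable_fun setT (fun w => cnt (\bigcup_n isolated n w)).
Proof.
apply: (@emeasurable_fun_cvg _ _ _ _ (fun n w => cnt (isolated n w))).
  move=> n; rewrite (_ : (fun w => _) =
      fun w => (\sum_(z \in sel n) (\1_(event n z) w : R)%:E)%E).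
    apply: emeasurable_fsum => // z; apply/measurable_EFinP; exact: measurable_indic.
  by apply/funext => w; exact: count_isolated.
by move=> w _; apply: counting_cvg => n; exact: isolatedS.
Qed.

(** Isolated triples accumulate as n grows, and the step densities increase because the forbidden
    sets shrink; monotone convergence is applied on both sides of the identity at level n. *)
Lemma integral_count_isolated (G : R * R * R -> \bar R) :
  (forall y, g n y @[n --> \oo] --> G y) ->
  (\int[P]_w cnt (\bigcup_n isolated n w) = \int[nu]_y G y)%E.
Proof.
move=> gG.
have c0 n w : (0 <= cnt (isolated n w))%E.
  by rewrite /counting; case: ifP => // _; rewrite leey.
have cS w : nondecreasing_seq (fun n => cnt (isolated n w)).
  apply/nondecreasing_seqP => n; rewrite !counting_esum.
  rewrite esum_mkcond [leRHS]esum_mkcond; apply: le_esum => y _.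
  case: ifPn => [/set_mem h|_]; last by case: ifP.
  by rewrite ifT//; apply/mem_set/isolatedS.
have gS y : nondecreasing_seq (fun n => g n y).
  apply/nondecreasing_seqP => n; rewrite /g lee_fin.
  case: ifPn => [/set_mem h|_]; last first.
    by case: ifP => // _; rewrite mulr_ge0 ?exprn_ge0 ?expR_ge0.
  rewrite ifT; last by apply/mem_set/selS.
  rewrite ler_wpM2l ?exprn_ge0// ler_expR lerN2 -lee_fin -!muQ.
  by apply: le_measure; rewrite ?inE.
have mc n : measurable_fun setT (fun w => cnt (isolated n w)).
  rewrite (_ : (fun w => _) =
      fun w => (\sum_(z \in sel n) (\1_(event n z) w : R)%:E)%E).
    apply: emeasurable_fsum => // z; apply/measurable_EFinP; exact: measurable_indic.
  by apply/funext => w; exact: count_isolated.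
have g0 n y : (0 <= g n y)%E.
  by rewrite /g lee_fin; case: ifP => // _; rewrite mulr_ge0 ?exprn_ge0 ?expR_ge0.
have L := @cvg_monotone_convergence _ _ R P _ measurableT
  (fun n w => cnt (isolated n w)) mc (fun n w _ => c0 n w) (fun w _ => cS w).
have L' := @cvg_monotone_convergence _ _ R nu _ measurableT
  g mg (fun n y _ => g0 n y) (fun y _ => gS y).
have -> : (\int[P]_w cnt (\bigcup_n isolated n w) =
    \int[P]_w limn (fun n => cnt (isolated n w)))%E.
  apply: eq_integral => w _; apply/esym/cvg_lim => //.
  by apply: counting_cvg => n; exact: isolatedS.
have -> : (\int[nu]_y G y = \int[nu]_y limn (fun n => g n y))%E.
  by apply: eq_integral => y _; apply/esym/cvg_lim.
apply: (cvg_unique _ L); first exact: ereal_hausdorff.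
have -> : (fun n => \int[P]_w cnt (isolated n w))%E = (fun n => \int[nu]_y g n y)%E.
  by apply/funext => n; exact: integral_step.
exact: L'.
Qed.

End Grid.

(** * Box corners and exhaustion by finitely many boxes *)

Section DyadicCorners.
Context {R : realType}.

Lemma pow2_small (e : R) : 0 < e -> exists N, forall n, (N <= n)%N -> 2 ^- n < e.
Proof.
move=> e0; exists (Num.bound e^-1) => n Nn.
have e1 : 0 <= e^-1 by rewrite invr_ge0 ltW.
rewrite invf_plt ?posrE ?exprn_gt0//; apply: lt_le_trans (archi_boundP e1) _.
by rewrite -natrX ler_nat (leq_trans Nn)// ltnW// ltn_expl.
Qed.

Definition close (e : R) (y y' : R * R * R) :=
  [/\ `|y.1.1 - y'.1.1| <= e, `|y.1.2 - y'.1.2| <= e & `|y.2 - y'.2| <= e].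

Definition corner (n : nat) (z : int * int * int) : R * R * R :=
  (z.1.1%:~R / 2 ^+ n, z.1.2%:~R / 2 ^+ n, z.2%:~R / 2 ^+ n).

Lemma box_close n z y : box n z y -> `|y - z%:~R / 2 ^+ n| <= 2 ^- n :> R.
Proof.
move=> <-; have /andP[a b] := idx_close n y.
by rewrite ler_norml; apply/andP; split; lra.
Qed.

Lemma corner_close n (y : R * R * R) : close (2 ^- n) y (corner n (idx3 n y)).
Proof. by split; apply: box_close. Qed.

(** An index i at level n becomes 2i or 2i + 1 at the next level, so a corner moves by 0 or by one
    new mesh width. *)
Lemma corner_closeS n (y : R * R * R) :
  close (2 ^- n.+1) (corner n.+1 (idx3 n.+1 y)) (corner n (idx3 n y)).
Proof.
have key (x : R) : `|(idx n.+1 x)%:~R / 2 ^+ n.+1 - (idx n x)%:~R / 2 ^+ n| <= 2 ^- n.+1 :> R.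
  have /andP[c d] := floor_itv ((idx n.+1 x)%:~R / 2 : R).
  rewrite -idxS in c d.
  have c' : (2 * idx n x)%:~R <= (idx n.+1 x)%:~R :> R.
    by rewrite intrM; move: c; rewrite ler_pdivlMr// mulrC.
  have d' : (idx n.+1 x)%:~R < (2 * (idx n x + 1))%:~R :> R.
    by rewrite intrM; move: d; rewrite ltr_pdivrMr// mulrC.
  rewrite ler_int in c'; rewrite ltr_int in d'.
  have d2 : (idx n.+1 x <= 2 * idx n x + 1) by lia.
  have e1 : (idx n.+1 x)%:~R <= 2 * (idx n x)%:~R + 1 :> R.
    by rewrite -(intrM _ 2) -intrD1 ler_int.
  have e2 : 2 * (idx n x)%:~R <= (idx n.+1 x)%:~R :> R by rewrite -(intrM _ 2) ler_int.
  have p0 : 0 < 2 ^- n.+1 :> R by rewrite invr_gt0 exprn_gt0.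
  have -> : (idx n.+1 x)%:~R / 2 ^+ n.+1 - (idx n x)%:~R / 2 ^+ n =
      ((idx n.+1 x)%:~R - 2 * (idx n x)%:~R) * 2 ^- n.+1 :> R.
    by rewrite exprS; field; rewrite expf_neq0.
  rewrite normrM (gtr0_norm p0) ler_piMl ?(ltW p0)//.
  by rewrite ler_norml; apply/andP; split; lra.
by split; exact: key.
Qed.

(** The cut-off of each coordinate at about n, written for indices: it leaves finitely many boxes,
    is inherited by finer boxes and finally contains every point. *)
Definition window (n : nat) : set (int * int * int) :=
  [set z | [/\ (`|z.1.1| <= n * 2 ^ n)%N, (`|z.1.2| <= n * 2 ^ n)%N &
     (`|z.2| <= n * 2 ^ n)%N]].

Lemma finite_window n : finite_set (window n).
Proof.
have fin m : finite_set [set z : int | (`|z| <= m)%N].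
  apply: (@sub_finite_set _ _ ((Posz @` `I_m.+1) `|` (Negz @` `I_m.+1))).
    move=> [a|a] /= am; [left|right]; exists a => //=; lia.
  by rewrite finite_setU; split; apply: finite_image; exact: finite_II.
apply: (@sub_finite_set _ _ (([set z : int | (`|z| <= n * 2 ^ n)%N] `*`
  [set z : int | (`|z| <= n * 2 ^ n)%N]) `*` [set z : int | (`|z| <= n * 2 ^ n)%N])).
  by move=> z [].
by apply: finite_setX => //; exact: finite_setX.
Qed.

Lemma windowS n (y : R * R * R) : window n (idx3 n y) -> window n.+1 (idx3 n.+1 y).
Proof.
have key (x : R) : (`|idx n x| <= n * 2 ^ n)%N -> (`|idx n.+1 x| <= n.+1 * 2 ^ n.+1)%N.
  move=> h; have /andP[c d] := floor_itv ((idx n.+1 x)%:~R / 2 : R).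
  rewrite -idxS in c d.
  have c' : (2 * idx n x)%:~R <= (idx n.+1 x)%:~R :> R.
    by rewrite intrM; move: c; rewrite ler_pdivlMr// mulrC.
  have d' : (idx n.+1 x)%:~R < (2 * (idx n x + 1))%:~R :> R.
    by rewrite intrM; move: d; rewrite ltr_pdivrMr// mulrC.
  rewrite ler_int in c'; rewrite ltr_int in d'.
  have p1 : (1 <= 2 ^ n)%N by rewrite expn_gt0.
  rewrite expnS; lia.
by move=> [h1 h2 h3]; split; exact: key.
Qed.

Lemma windowP (y : R * R * R) : exists N, forall n, (N <= n)%N -> window n (idx3 n y).
Proof.
have key (x : R) : exists N, forall n, (N <= n)%N -> (`|idx n x| <= n * 2 ^ n)%N.
  (* The extra unit absorbs the downward rounding of [floor] at negative points. *)
  exists (Num.bound `|x|).+1 => n Nn.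
  have := archi_boundP (normr_ge0 x) => xb.
  have /andP[a b] := floor_itv (x * 2 ^+ n).
  have p0 : 0 < 2 ^+ n :> R by rewrite exprn_gt0.
  have p1 : 1 <= 2 ^+ n :> R by rewrite exprn_ege1// ler1n.
  have xn : `|x| <= n%:R - 1.
    rewrite (le_trans (ltW xb))// lerBrDr natr1 ler_nat//.
  have hx : `|x * 2 ^+ n| <= n%:R * 2 ^+ n - 1.
    rewrite normrM (gtr0_norm p0).
    have : `|x| * 2 ^+ n <= (n%:R - 1) * 2 ^+ n by rewrite ler_pM2r.
    by lra.
  move: hx; rewrite ler_norml => /andP[h1 h2].
  have e1 : (idx n x)%:~R <= (n * 2 ^ n)%:Z%:~R :> R.
    by rewrite (le_trans a)// -[X in _ <= X]/((n * 2 ^ n)%:R : R) natrM natrX; lra.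
  have e2 : (- (n * 2 ^ n)%:Z)%:~R <= (idx n x)%:~R :> R.
    rewrite mulrNz -[X in - X <= _]/((n * 2 ^ n)%:R : R) natrM natrX.
    by move: b; rewrite intrD -/(idx n x); lra.
  by move: e1 e2; rewrite !ler_int; lia.
have [N1 h1] := key y.1.1; have [N2 h2] := key y.1.2; have [N3 h3] := key y.2.
by exists (maxn N1 (maxn N2 N3)) => n; rewrite !geq_max => /and3P[a b c];
  split; [exact: h1|exact: h2|exact: h3].
Qed.

End DyadicCorners.

(** * The intensity measure with equispaced directions *)

Section LineMeasure.
Context {R : realType}.
Variable k : nat.
Hypothesis k0 : (0 < k)%N.
Local Notation T := (measurableTypeR R * measurableTypeR R)%type.
Local Notation leb := (@lebesgue_measure R).

Definition line_measure : {measure set T -> \bar R} :=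
  (@equiangular R k \x leb)%E.

Definition at_angle (j : nat) (d : R) : T := (ang (R := R) k j, d).

Lemma ang_inj : injective (ang (R := R) k).
Proof.
move=> i j; rewrite /ang -!mulrA => /eqP.
have pk : pi / k%:R != 0 :> R.
  by rewrite mulf_neq0 ?invr_eq0 ?pnatr_eq0 -?lt0n// gt_eqF ?pi_gt0.
by rewrite (inj_eq (mulIf pk)) eqr_nat => /eqP.
Qed.

Lemma at_angleE j (B : set R) : at_angle j @` B = [set ang (R := R) k j] `*` B.
Proof.
apply/seteqP; split => [_ [d Bd <-]//|[t d] [/= -> Bd]]; by exists d.
Qed.

Lemma measurable_at_angle j (B : set (measurableTypeR R)) : measurable B ->
  measurable (at_angle j @` B : set T).
Proof. by move=> mB; rewrite at_angleE; apply: measurableX => //; exact: measurable_set1. Qed.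

Lemma line_measure_at j (B : set (measurableTypeR R)) : (j < k)%N -> measurable B ->
  line_measure (at_angle j @` B) = (k%:R^-1%:E * leb B)%E.
Proof.
move=> jk mB; rewrite at_angleE.
have m1 : measurable ([set ang k j] : set (measurableTypeR R)) by [].
rewrite /line_measure /= (product_measure1E _ _ m1 mB).
congr (_ * _)%E; rewrite /equiangular /= /mscale /= /msum /=.
rewrite (bigD1 (Ordinal jk))//= big1 => [|i ij].
  by rewrite diracE mem_set// adde0 mule1.
rewrite diracE memNset//= -/(ang k i) => /ang_inj e.
by move: ij; rewrite -val_eqE /= e eqxx.
Qed.

Lemma line_measure_outside :
  line_measure (~` (\bigcup_(j in `I_k) (at_angle j @` [set: R]))) = 0%E.
Proof.
have mB : measurable (\bigcup_(j in `I_k) [set ang (R := R) k j] : set (measurableTypeR R)).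
  by apply: bigcup_measurable => j _; exact: measurable_set1.
rewrite (_ : ~` _ = (~` \bigcup_(j in `I_k) [set ang (R := R) k j]) `*` [set: R]).
  rewrite /line_measure /= product_measure1E//; last exact: measurableC.
  rewrite (_ : equiangular k _ = 0%E) ?mul0e//.
  rewrite /equiangular /= /mscale /= /msum /= big1 ?mule0// => i _.
  by rewrite diracE memNset//= => h; apply: h; exists i => //=; exact: ltn_ord.
apply/seteqP; split => [[t d] h|[t d] [h _]].
  by split=> //= -[j jk /= e]; apply: h; exists j => //; exists d; rewrite // /at_angle -e.
by move=> [j jk [d' _ [e _]]]; apply: h; exists j.
Qed.

End LineMeasure.

(** * Triples of lines whose intervals contain no line *)

Section IntervalCampbell.
Context {R : realType} {d : measure_display} {Omega : measurableType d}.
Variable k : nat.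
Hypothesis k0 : (0 < k)%N.
Local Notation T := (measurableTypeR R * measurableTypeR R)%type.
Local Notation leb := (@lebesgue_measure R).
Local Notation nu := ((leb \x leb) \x leb)%E.
Variables (P : probability Omega R) (X : Omega -> set T).
Hypothesis pp : poisson_process P (@line_measure R k) X.
Variables (j1 j2 j3 : nat).
Hypotheses (jk1 : (j1 < k)%N) (jk2 : (j2 < k)%N) (jk3 : (j3 < k)%N).
Hypotheses (j12 : j1 <> j2) (j13 : j1 <> j3) (j23 : j2 <> j3).
Variables (J : pred nat) (lo hi : nat -> R * R * R -> R) (C : R) (A : set (R * R * R)).
Hypothesis C0 : 0 <= C.
Hypothesis openA : open A.
Hypothesis lohi : forall j y, lo j y <= hi j y.
Hypothesis lip : forall j e y y', close e y y' ->
  `|lo j y - lo j y'| <= C * e /\ `|hi j y - hi j y'| <= C * e.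
Hypotheses (J1 : J j1) (J2 : J j2) (J3 : J j3).
Hypotheses (in1 : forall y, lo j1 y <= y.1.1 <= hi j1 y)
  (in2 : forall y, lo j2 y <= y.1.2 <= hi j2 y)
  (in3 : forall y, lo j3 y <= y.2 <= hi j3 y).
Hypotheses (end1 : forall y, A y -> ~ (lo j1 y < y.1.1 < hi j1 y))
  (end2 : forall y, A y -> ~ (lo j2 y < y.1.2 < hi j2 y))
  (end3 : forall y, A y -> ~ (lo j3 y < y.2 < hi j3 y)).

(** The margin of the enlarged intervals in units of the mesh: [C] covers the change of the
    endpoints across a box, and the added 1 makes the open enlarged interval contain the closed one
    strictly. Refining halves the mesh and moves the endpoints by at most C new mesh widths, so the
    enlarged intervals are nested. *)
Let K := C + 1.
Let K0 : 0 < K.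
Proof. by rewrite ltr_wpDl. Qed.

Let pt := at_angle (R := R) k.
Local Notation pts := (three_pts (pt j1) (pt j2) (pt j3)).

Definition slab n (z : int * int * int) j : set T :=
  if J j then pt j @` `]lo j (corner n z) - K * 2 ^- n, hi j (corner n z) + K * 2 ^- n[%classic
  else set0.

Definition slabs n z : set T := \big[setU/set0]_(j < k) slab n z j.

Definition slabs_mass n z : R := \sum_(j < k)
  (if J j then k%:R^-1 * (hi j (corner n z) - lo j (corner n z) + 2 * K * 2 ^- n) else 0).

Definition width y : R :=
  \sum_(j < k) (if J j then k%:R^-1 * (hi j y - lo j y) else 0).

Let p0 n : 0 < 2 ^- n :> R. Proof. by rewrite invr_gt0 exprn_gt0. Qed.

Lemma slabsP n z l : slabs n z l <-> exists j, [/\ (j < k)%N, J j, l.1 = ang k j &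
  lo j (corner n z) - K * 2 ^- n < l.2 < hi j (corner n z) + K * 2 ^- n].
Proof.
rewrite /slabs -bigcup_mkord; split => [[j /= jk]|[j [jk Jj l1 l2]]].
  rewrite /slab; case: ifPn => // Jj [x]; rewrite /= in_itv /= => xI <-.
  by exists j; split.
exists j => //=; rewrite /slab Jj; exists l.2; first by rewrite /= in_itv.
by rewrite /pt /at_angle -l1 -surjective_pairing.
Qed.

Lemma measurable_slab n z j : measurable (slab n z j).
Proof.
rewrite /slab; case: ifP => // _.
by apply: measurable_at_angle; exact: measurable_itv.
Qed.

Lemma measurable_slabs n z : measurable (slabs n z).
Proof. by apply: bigsetU_measurable => j _; exact: measurable_slab. Qed.

Lemma line_measure_slabs n z : line_measure k (slabs n z) = (slabs_mass n z)%:E.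
Proof.
have tF : trivIset [set: nat] (slab n z).
  move=> i j _ _ [l []]; rewrite /slab; case: ifP => // _ [x _ <-].
  by case: ifP => // _ [x' _ [/(ang_inj k0) ->]].
rewrite /slabs measure_bigsetU//; last by move=> j; exact: measurable_slab.
rewrite -sumEFin; apply: eq_bigr => j _; rewrite /slab.
case: ifP => Jj; last by rewrite measure0.
transitivity (k%:R^-1%:E * leb `](lo j (corner n z) - K * 2 ^- n)%R,
    (hi j (corner n z) + K * 2 ^- n)%R[%classic)%E.
  exact: (line_measure_at k0).
rewrite lebesgue_measure_itv /= lte_fin ifT; last first.
  have : 0 < K * 2 ^- n by rewrite mulr_gt0.
  by have := lohi j (corner n z); lra.
by rewrite -EFinB -EFinM; congr (_ * _)%:E; ring.
Qed.

Let selb n : set (int * int * int) := [set z | window n z /\ box3 n z `<=` A].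

Lemma finite_selb n : finite_set (selb n).
Proof. by apply: sub_finite_set (finite_window n) => z []. Qed.

Lemma selbS n (y : R * R * R) : selb n (idx3 n y) -> selb n.+1 (idx3 n.+1 y).
Proof.
move=> [wy by_]; split; first exact: windowS.
by move=> y' e; apply: by_; exact: idx3S e.
Qed.

Lemma slabsS n (y : R * R * R) : slabs n.+1 (idx3 n.+1 y) `<=` slabs n (idx3 n y).
Proof.
move=> l /slabsP[j [jk Jj l1 l2]]; apply/slabsP; exists j; split => //.
have [+ +] := lip j (corner_closeS n y).
have e : 2 ^- n = 2 * 2 ^- n.+1 :> R by rewrite exprS; field; rewrite expf_neq0.
have := p0 n.+1; rewrite !ler_norml e /K; move: l2; rewrite /K.
move: (2 ^- n.+1) (lo j _) (lo j _) (hi j _) (hi j _) => r a a' b b'.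
have Cr : 0 <= r -> 0 <= C * r by move=> ?; rewrite mulr_ge0.
move=> /andP[x1 x2] r0 /andP[x3 x4] /andP[x5 x6]; have Cr0 := Cr (ltW r0).
by apply/andP; split; lra.
Qed.

Lemma sub_slabs n z : [/\ pt j1 @` box n z.1.1 `<=` slabs n z,
  pt j2 @` box n z.1.2 `<=` slabs n z & pt j3 @` box n z.2 `<=` slabs n z].
Proof.
have key j (x y : R) (v : R * R * R) : close (2 ^- n) v (corner n z) -> lo j v <= x <= hi j v ->
    lo j (corner n z) - K * 2 ^- n < x < hi j (corner n z) + K * 2 ^- n.
  move=> /(lip j)[+ +] /andP[h1 h2]; rewrite !ler_norml /K => /andP[x3 x4] /andP[x5 x6].
  have := p0 n; move: (2 ^- n) x3 x4 x5 x6 => r *.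
  by apply/andP; split; lra.
have n0 : 0 <= 2 ^- n :> R by exact: ltW.
(* Only one coordinate is prescribed; the others are taken from the corner, since [in1], [in2] and
   [in3] hold for every triple. *)
split => _ [x bx <-]; apply/slabsP.
- exists j1; split=> //=.
  apply: (key j1 x x (x, (corner n z).1.2, (corner n z).2)); last exact: (in1 (x, _, _)).
  by split => /=; [exact: box_close|rewrite subrr normr0|rewrite subrr normr0].
- exists j2; split=> //=.
  apply: (key j2 x x ((corner n z).1.1, x, (corner n z).2)); last exact: (in2 (_, x, _)).
  by split => /=; [rewrite subrr normr0|exact: box_close|rewrite subrr normr0].
- exists j3; split=> //=.
  apply: (key j3 x x ((corner n z).1.1, (corner n z).1.2, x)); last exact: (in3 (_, _, x)).
  by split => /=; [rewrite subrr normr0|rewrite subrr normr0|exact: box_close].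
Qed.

Lemma eventually_selb y : A y -> exists N, forall n, (N <= n)%N -> selb n (idx3 n y).
Proof.
move=> Ay; have /nbhs_ballP[e /= e0 eA] : nbhs y A by exact: open_nbhs_nbhs.
have e2 : 0 < e / 2 by rewrite divr_gt0.
have [N1 h1] := pow2_small e2; have [N2 h2] := windowP y.
exists (maxn N1 N2) => n; rewrite geq_max => /andP[n1 n2]; split; first exact: h2.
move=> y' yy'; apply: eA.
have key (a b : R) : idx n a = idx n b -> ball b e a.
  move=> ab; have := box_close (erefl (idx n a)); have := box_close (erefl (idx n b)).
  rewrite ab /ball /= !ler_norml => /andP[x1 x2] /andP[x3 x4].
  have := h1 n n1; rewrite ltr_norml; move: (2 ^- n) x1 x2 x3 x4 => r *.
  by apply/andP; split; lra.
by move: yy'; rewrite /box3 /idx3 /= => -[a b c]; split; [split|]; apply: key.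
Qed.

Lemma slabs_mass_cvg y (e : R) : 0 < e ->
  exists N, forall n, (N <= n)%N -> `|width y - slabs_mass n (idx3 n y)| < e.
Proof.
(* Two endpoints contribute an error [C] each from the corner and a margin [K] each. *)
move=> e0; pose D := 2 * C + 2 * K.
have D0 : 0 < D by rewrite /D /K; have := C0; lra.
have [N hN] := pow2_small (divr_gt0 e0 D0).
exists N => n /hN; rewrite ltr_pdivlMr// => h; apply: le_lt_trans h.
rewrite /width /slabs_mass -sumrB (le_trans (ler_norm_sum _ _ _))//.
have -> : 2 ^- n * D = \sum_(j < k) k%:R^-1 * (2 ^- n * D).
  rewrite sumr_const card_ord -[RHS]mulr_natl mulrA divff ?mul1r//.
  by rewrite pnatr_eq0 -lt0n.
apply: ler_sum => j _; case: ifP => Jj; last first.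
  by rewrite subrr normr0 mulr_ge0 ?invr_ge0// mulr_ge0 ?(ltW (p0 n)) ?ltW.
rewrite -mulrBr normrM ger0_norm ?invr_ge0// ler_wpM2l ?invr_ge0//.
have [+ +] := lip j (corner_close n y); have := p0 n.
rewrite !ler_norml /D /K; move: (2 ^- n) (lo j _) (lo j _) (hi j _) (hi j _) => r a a' b b'.
move=> r0 /andP[x3 x4] /andP[x5 x6]; have Cr0 : 0 <= C * r by rewrite mulr_ge0// ltW.
by apply/andP; split; lra.
Qed.

Definition void_triples (L : set T) : set (R * R * R) :=
  [set y | [/\ A y, pts y `<=` L &
    forall j x, (j < k)%N -> J j -> L (pt j x) -> ~ (lo j y < x < hi j y)]].

Local Notation iso := (isolated X (pt j1) (pt j2) (pt j3) selb slabs).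

Lemma finite_eventually (F : set T) (B : nat -> set T) : finite_set F ->
  (forall l, F l -> exists N, forall n, (N <= n)%N -> ~ B n l) ->
  exists N, forall n, (N <= n)%N -> forall l, F l -> ~ B n l.
Proof.
move=> /finite_seqP[s ->]; elim: s => [|a s IH] h.
  by exists 0%N => n _ l; rewrite /= in_nil.
have [l ls|N1 h1] := IH; first by apply: h; rewrite /= in_cons ls orbT.
have [|N2 h2] := h a; first by rewrite /= mem_head.
exists (maxn N1 N2) => n; rewrite geq_max => /andP[n1 n2] l.
by rewrite /= in_cons => /predU1P[->|ls]; [exact: h2|exact: h1].
Qed.

(** An isolated triple is void because its slabs contain the open intervals, and its own lines lie
    at interval ends. Conversely only finitely many lines meet the coarsest slabs; by assumption
    those outside the triple miss the closed intervals, so each of them is eventually left out. *)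
Lemma bigcup_isolated w : locally_finite (X w) ->
  (forall y, void_triples (X w) y -> forall j x, (j < k)%N -> J j -> X w (pt j x) ->
     lo j y <= x <= hi j y -> pts y (pt j x)) ->
  \bigcup_n iso n w = void_triples (X w).
Proof.
move=> lf tan; apply/seteqP; split => y.
  move=> [n _ [[_ sy] yX XQ]].
  have Ay : A y by apply: sy.
  split => // j x jk Jj Xx /andP[lx xh].
  have : pts y (pt j x).
    apply: XQ; split => //; apply/slabsP; exists j; split => //=.
    have [+ +] := lip j (corner_close n y); have := p0 n.
    rewrite !ler_norml /K; move: (2 ^- n) (lo j (corner _ _)) (hi j (corner _ _)) => r a b.
    by move=> r0 /andP[x3 x4] /andP[x5 x6]; apply/andP; split; lra.
  move=> [[]|] [/(ang_inj k0) e e']; subst j x.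
  - by apply: (end1 Ay); rewrite lx.
  - by apply: (end2 Ay); rewrite lx.
  - by apply: (end3 Ay); rewrite lx.
move=> vy; have [Ay yX void] := vy.
have [N1 h1] := eventually_selb Ay.
pose F := [set l | [/\ X w l, slabs 0 (idx3 0 y) l & ~ pts y l]].
have finF : finite_set F.
  pose b j := `|lo j (corner 0 (idx3 0 y))| + `|hi j (corner 0 (idx3 0 y))| + K.
  apply: (@sub_finite_set _ _ (\bigcup_(j in `I_k) [set l | X w l /\ `|l.2| <= b j])).
    move=> l [Xl /slabsP[j [jk Jj l1]] + _]; rewrite expr0 invr1 mulr1 => /andP[l2 l3].
    exists j => //; split => //; rewrite /b.
    move: l2 l3; set a := lo j _; set c := hi j _ => l2 l3.
    have := ler_norm (- a); have := ler_norm c; have := normr_ge0 a; have := normr_ge0 c.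
    rewrite normrN ler_norml; have := K0; rewrite /K in l2 l3 *.
    by move=> *; apply/andP; split; lra.
  by apply: bigcup_finite => [|j _]; [exact: finite_II|exact: lf].
have [|N2 h2] := @finite_eventually F (fun n => slabs n (idx3 n y)) finF.
  move=> l [Xl /slabsP[j [jk Jj l1 _]] nl].
  have lE : l = pt j l.2 by rewrite /pt /at_angle -l1 -surjective_pairing.
  have nlj : ~ (lo j y <= l.2 <= hi j y).
    by move=> h; apply: nl; rewrite lE; apply: tan => //; rewrite -lE.
  have [e e0 eP] : exists2 e, 0 < e & l.2 + e <= lo j y \/ hi j y + e <= l.2.
    have [h|h] := ltP l.2 (lo j y).
      by exists (lo j y - l.2); [rewrite subr_gt0|left; lra].
    exists (l.2 - hi j y); last by right; lra.
    by rewrite subr_gt0 ltNge; apply/negP => h'; apply: nlj; rewrite h.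
  have D0 : 0 < 2 * C + 1 by have := C0; lra.
  have [N hN] := pow2_small (divr_gt0 e0 D0).
  exists N => n /hN; rewrite ltr_pdivlMr// => h /slabsP[i [ik Ji l1']].
  have : i = j by apply: (ang_inj (R := R) k0); rewrite -l1 -l1'.
  move=> -> /andP[]; have [+ +] := lip j (corner_close n y); have := p0 n; move: h.
  rewrite !ler_norml /K; move: (2 ^- n) (lo j (corner _ _)) (hi j (corner _ _)) => r a b.
  by move=> h r0 /andP[x3 x4] /andP[x5 x6] x7 x8; case: eP; lra.
exists (maxn N1 N2) => //; split => //.
  by apply: h1; rewrite leq_maxl.
move=> l [Xl Ql]; apply: contrapT => nl.
have Q0 : slabs 0 (idx3 0 y) l.
  elim: (maxn N1 N2) Ql => [//|n IH] /slabsS; exact: IH.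
exact: (h2 _ (leq_maxr N1 N2) l _ Ql).
Qed.

(** The number of triples isolated at some level is measurable and has the stated mean on every
    sample space point by point; it represents the number of void triples only for samples with the
    two regularity properties, whence the auxiliary [H]. *)
Lemma integral_void_triples : exists H : Omega -> \bar R,
  [/\ measurable_fun setT H, (forall w, 0 <= H w)%E,
   (\int[P]_w H w = \int[nu]_y
      (if y \in A then k%:R^-1 ^+ 3 * expR (- width y) else 0)%:E)%E &
   forall w, locally_finite (X w) ->
     (forall y, void_triples (X w) y -> forall j x, (j < k)%N -> J j -> X w (pt j x) ->
       lo j y <= x <= hi j y -> pts y (pt j x)) ->
     H w = counting (void_triples (X w))].
Proof.
have injp j : injective (pt j) by move=> x y [].
have disp i j : i <> j -> forall x y, pt i x <> pt j y.
  by move=> ij x y [/(ang_inj k0)].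
have mp j n z : measurable (pt j @` box n z).
  by apply: measurable_at_angle; exact: measurable_box.
have mup j : (j < k)%N -> forall n z, line_measure k (pt j @` box n z) = (k%:R^-1 * 2 ^- n)%:E.
  move=> jk n z; rewrite EFinM -(lebesgue_box n z); apply: (line_measure_at k0) => //.
  exact: measurable_box.
have k1 : 0 <= k%:R^-1 :> R by rewrite invr_ge0.
exists (fun w => counting (\bigcup_n iso n w)); split.
- exact: (measurable_count_isolated pp (@injp j1) (@injp j2) (@injp j3) (disp _ _ j12)
    (disp _ _ j13) (disp _ _ j23) (mp j1) (mp j2) (mp j3) finite_selb measurable_slabs
    sub_slabs selbS slabsS).
- by move=> w; rewrite /counting; case: ifP => // _; rewrite leey.
- apply: (integral_count_isolated pp (@injp j1) (@injp j2) (@injp j3) (disp _ _ j12)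
    (disp _ _ j13) (disp _ _ j23) (mp j1) (mp j2) (mp j3) (mup _ jk1) (mup _ jk2) (mup _ jk3)
    k1 finite_selb measurable_slabs line_measure_slabs sub_slabs selbS slabsS) => y.
  case: ifPn => [/set_mem Ay|/negP nAy]; last first.
    rewrite (_ : (fun n => _) = (fun=> 0%:E)); first exact: cvg_cst.
    apply/funext => n; rewrite ifF//; apply/negP => /set_mem[_ s]; apply: nAy.
    by apply/mem_set/s.
  have [N1 h1] := eventually_selb Ay.
  apply/fine_cvgP; split; first by near=> n.
  have qc : slabs_mass n (idx3 n y) @[n --> \oo] --> width y.
    apply/cvgrPdist_lt => e e0; have [N hN] := slabs_mass_cvg y e0.
    by exists N => // n /= /hN.
  have ec : k%:R^-1 ^+ 3 * expR (- slabs_mass n (idx3 n y)) @[n --> \oo] -->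
      k%:R^-1 ^+ 3 * expR (- width y).
    apply: cvgM; first exact: cvg_cst.
    by apply: (continuous_cvg _ (@continuous_expR R _)); exact: cvgN.
  apply: cvg_trans ec; apply: near_eq_cvg; exists N1 => // n /= Nn.
  by rewrite ifT//; apply/mem_set/h1.
- by move=> w lf tan; rewrite (bigcup_isolated lf tan).
Unshelve. all: end_near.
Qed.

End IntervalCampbell.

(** * Almost sure properties of the line process *)

Section AlmostSure.
Context {R : realType} {d : measure_display} {Omega : measurableType d}.
Variable P : probability Omega R.
Local Open Scope ereal_scope.

(** For nonnegative functions the integral is a supremum over simple functions below, hence monotone
    without measurability; this is what the cell counts call for. *)
Lemma ge0_le_integralT (f g : Omega -> \bar R) :
  (forall w, 0 <= f w) -> (forall w, f w <= g w) ->
  \int[P]_w f w <= \int[P]_w g w.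
Proof.
move=> f0 fg; have g0 w : 0 <= g w by exact: le_trans (f0 w) (fg w).
have pE (u : Omega -> \bar R) : (forall w, 0 <= u w) -> u^\+ = u /\ u^\- = cst 0.
  move=> u0; split; apply/funext => w; first by rewrite (@ge0_funeposE _ _ setT u)// inE.
  by rewrite (@ge0_funenegE _ _ setT u)// inE.
rewrite /integral !patch_setT (pE f f0).1 (pE f f0).2 (pE g g0).1 (pE g g0).2.
apply: leeB => //; apply: le_ereal_sup => _ [h hf <-]; exists h => // w; exact: le_trans (hf w) (fg w).
Qed.

(** On the exceptional null set the lower function is replaced by 0 and the upper one by +oo. This
    leaves their integrals unchanged and makes the comparison hold everywhere. *)
Lemma integral_sandwich (f g h : Omega -> \bar R) :
  measurable_fun setT f -> measurable_fun setT h ->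
  (forall w, 0 <= f w) -> (forall w, 0 <= g w) -> (forall w, 0 <= h w) ->
  {ae P, forall w, f w <= g w /\ g w <= h w} ->
  \int[P]_w f w <= \int[P]_w g w /\ \int[P]_w g w <= \int[P]_w h w.
Proof.
move=> mf mh f0 g0 h0 [N [mN PN0 sN]].
have fgh w : ~ N w -> f w <= g w /\ g w <= h w.
  by move=> nN; apply: contrapT => /sN.
pose f' w := if w \in N then 0 else f w.
pose h' w := if w \in N then +oo else h w.
have mN' : measurable_fun setT (fun w => w \in N).
  by apply: (measurable_fun_bool true); rewrite setTI (_ : _ @^-1` _ = N)//;
    apply/seteqP; split => w /=; [move=> /set_mem|move=> /mem_set ->].
have mf' : measurable_fun setT f' by apply: measurable_fun_ifT.
have mh' : measurable_fun setT h' by apply: measurable_fun_ifT.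
have ef : \int[P]_w f w = \int[P]_w f' w.
  apply: ge0_ae_eq_integral => //; first by move=> w _; rewrite /f'; case: ifP.
  exists N; split => // w /= h1; apply: contrapT => nN; apply: h1 => _.
  by rewrite /f' memNset.
have eh : \int[P]_w h w = \int[P]_w h' w.
  apply: ge0_ae_eq_integral => //; first by move=> w _; rewrite /h'; case: ifP.
  exists N; split => // w /= h1; apply: contrapT => nN; apply: h1 => _.
  by rewrite /h' memNset.
rewrite ef eh; split; apply: ge0_le_integralT => //.
- by move=> w; rewrite /f'; case: ifP.
- move=> w; rewrite /f'; case: ifPn => //; rewrite notin_setE => /fgh[//].
- move=> w; rewrite /h'; case: ifPn => [_|]; first by rewrite leey.
  by rewrite notin_setE => /fgh[].
Qed.

(** Markov's inequality for the sets [1 <= H]. Since [E] need not be measurable, it is covered by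
    such a set and a null set for each 1/(n+1), and the covers are intersected. *)
Lemma ae_not_of_integral_small (E : set Omega) :
  (forall e : R, (0 < e)%R -> exists H : Omega -> \bar R, [/\ measurable_fun setT H,
     forall w, 0 <= H w, \int[P]_w H w <= e%:E & {ae P, forall w, E w -> 1 <= H w}]) ->
  {ae P, forall w, ~ E w}.
Proof.
move=> small.
have h n : exists B, [/\ measurable B, P B <= (n.+1%:R^-1)%:E & E `<=` B].
  have [|H [mH H0 IH [N [mN PN0 sN]]]] := small n.+1%:R^-1%R; first by rewrite invr_gt0.
  pose B := [set w | 1 <= H w].
  have mB : measurable B.
    by rewrite -[B]setTI; exact: emeasurable_fun_c_infty.
  exists (B `|` N); split; [exact: measurableU| |].
    rewrite (le_trans (measureU2 P mB mN))// [X in _ + X]PN0 adde0 (le_trans _ IH)//.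
    have := @le_integral_comp_abse _ _ _ P setT measurableT H 1%R id
      (@measurable_id _ _ _) (fun r r0 => r0) (fun x y _ _ xy => xy) mH ltr01.
    have aH w : `|H w| = H w by rewrite gee0_abs.
    rewrite (_ : [set x | _] = B); last by apply/seteqP; split => w /=; rewrite aH.
    by rewrite mul1e setTI; under eq_integral do rewrite aH.
  move=> w Ew; have [Nw|nN] := pselect (N w); first by right.
  left; rewrite /B /=; have : ~ ~ (E w -> 1 <= H w) by move=> /sN.
  by move=> /contrapT; apply.
pose B n := projT1 (cid (h n)).
have BP n : [/\ measurable (B n), P (B n) <= (n.+1%:R^-1)%:E & E `<=` B n].
  by rewrite /B; case: cid.
exists (\bigcap_n B n); split.
- by apply: bigcap_measurable => [|n _]; [exists 0%N|have [] := BP n].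
- apply/eqP; rewrite eq_le measure_ge0 andbT; apply/lee_addgt0Pr => e e0; rewrite add0e.
  have [n ne] : exists n : nat, (n.+1%:R^-1 <= e)%R.
    exists (Num.bound e^-1); rewrite invf_ple ?posrE//.
    rewrite (le_trans (ltW (archi_boundP _)))// ?invr_ge0 ?ler_nat//; exact: ltW.
  have [mBn Pn _] := BP n.
  apply: (@le_trans _ _ (P (B n))).
    apply: le_measure; rewrite ?inE//; last by apply: bigcap_inf.
    by apply: bigcap_measurable => [|m _]; [exists 0%N|have [] := BP m].
  by rewrite (le_trans Pn)// lee_fin.
- by move=> w /= /contrapT Ew n _; have [_ _] := BP n; apply.
Qed.

End AlmostSure.

(** * Directions, local finiteness and unboundedness of the lines *)

Section PoissonLines.
Context {R : realType} {d : measure_display} {Omega : measurableType d}.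
Variable k : nat.
Hypothesis k0 : (0 < k)%N.
Local Notation T := (measurableTypeR R * measurableTypeR R)%type.
Local Notation leb := (@lebesgue_measure R).
Variables (P : probability Omega R) (X : Omega -> set T).
Hypothesis pp : poisson_process P (@line_measure R k) X.

Lemma ae_of_prob1 (E : set Omega) : measurable E -> P E = 1%E -> {ae P, forall w, E w}.
Proof.
move=> mE PE; exists (~` E); split; [exact: measurableC| |by []].
by rewrite probability_setC// PE subee.
Qed.

Lemma ae_void (B : set T) : measurable B -> line_measure k B = 0%E ->
  {ae P, forall w, X w `&` B = set0}.
Proof.
move=> mB B0; have : P [set w | point_count X B w = 0%:E :> \bar R] = 1%E.
  rewrite (poisson_process_law pp mB _ 0) ?B0 ?ltry//= oppr0 expR0 expr0 fact0.
  by rewrite mul1r divr1.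
move=> /(ae_of_prob1 (measurable_count_eq pp 0 mB)).
by apply: filterS => w /= /counting_eq0.
Qed.

(** The Poisson probabilities sum to 1 by the exponential series, so the count is almost surely a
    natural number. *)
Lemma ae_finite (B : set T) : measurable B -> (line_measure k B < +oo)%E ->
  {ae P, forall w, finite_set (X w `&` B)}.
Proof.
move=> mB Boo; set m := fine (line_measure k B).
pose E n := [set w | point_count X B w = n%:R%:E :> \bar R].
have mE n : measurable (E n) by exact: (measurable_count_eq pp).
have tE : trivIset setT E.
  move=> i j _ _ [w []]; rewrite /E /= => -> [] /eqP; rewrite eqr_nat => /eqP.
  by [].
suff h : P (\bigcup_n E n) = 1%E.
  have := ae_of_prob1 (bigcup_measurable (fun n _ => mE n)) h.
  apply: filterS => w [n _]; rewrite /E /= => e; apply: contrapT => nf.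
  by move: e; rewrite /point_count (counting_infinite nf).
apply/eqP; rewrite eq_le probability_le1 ?andTb; last exact: bigcup_measurable.
have : (\sum_(0 <= i < n) P (E i))%E @[n --> \oo] --> 1%E.
  have -> : (fun n => \sum_(0 <= i < n) P (E i))%E =
      (fun n => (expR (- m) * series (exp_coeff m) n)%:E).
    apply/funext => n; rewrite /series /= big_distrr /= -sumEFin.
    by apply: eq_bigr => i _; rewrite /E (poisson_process_law pp mB Boo) /exp_coeff mulrA.
  have -> : 1%E = (expR (- m) * expR m)%:E by rewrite -expRD addNr expR0.
  apply: cvg_EFin; first by near=> n.
  by apply: cvgM; [exact: cvg_cst|exact: is_cvg_series_exp_coeff].
move=> c; rewrite -(cvg_lim _ c)//; apply: lime_le; first by apply/cvg_ex; exists 1%E.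
near=> n; rewrite big_mkord -measure_bigsetU// le_measure ?inE//.
- by apply: bigsetU_measurable => i _.
- exact: bigcup_measurable.
- by rewrite -bigcup_mkord => w [i _ Ei]; exists i.
Unshelve. all: end_near.
Qed.

Lemma ae_nonempty (B : set T) : measurable B -> line_measure k B = +oo%E ->
  {ae P, forall w, X w `&` B !=set0}.
Proof.
move=> mB Boo; have := poisson_process_law_oo pp mB Boo.
move=> /(ae_of_prob1 (measurable_count_eq pp +oo%E mB)).
apply: filterS => w /= h; apply/set0P/eqP => e.
by move: h; rewrite /point_count e counting0.
Qed.

Definition angles : set R := [set ang k j | j in `I_k].

Lemma ae_angles : {ae P, forall w, forall l, X w l -> angles l.1}.
Proof.
have mB : measurable (~` (\bigcup_(j in `I_k) (at_angle k j @` [set: R])) : set T).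
  apply: measurableC; apply: bigcup_measurable => j _.
  exact: measurable_at_angle.
have := ae_void mB (line_measure_outside k).
apply: filterS => w h l Xl; apply: contrapT => nl.
suff : set0 l by [].
rewrite -h; split => // -[j jk [x _ e]]; apply: nl; exists j => //.
by rewrite -e.
Qed.

Lemma ae_locally_finite : {ae P, forall w, locally_finite (X w)}.
Proof.
have m1 : measurable ([set: R] : set (measurableTypeR R)) by [].
have m2 n : measurable (`[- n%:R, n%:R] : set (measurableTypeR R)) by exact: measurable_itv.
have key n : {ae P, forall w, finite_set (X w `&` ([set: R] `*` `[- n%:R, n%:R]))}.
  apply: ae_finite; first exact: measurableX.
  rewrite /line_measure /= (product_measure1E _ _ m1 (m2 n)).
  rewrite (equiangular_direction R k0).2 mul1e.
  rewrite -[X in (X < _)%E]/(leb `[- n%:R, n%:R]%classic) lebesgue_measure_itv /=.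
  case: ifP => _; last by rewrite ltry.
  by rewrite -EFinB ltry.
have := ae_foralln key; apply: filterS => w h M.
have M0 : 0 <= `|M| by [].
apply: sub_finite_set (h (Num.bound `|M|)) => l [Xl lM]; split => //; split => //=.
rewrite in_itv /= -ler_norml (le_trans lM)// (le_trans (ler_norm _))//.
exact: ltW (archi_boundP M0).
Qed.

Lemma ae_unbounded : {ae P, forall w, forall theta M, angles theta ->
  (exists l, [/\ X w l, l.1 = theta & M < l.2]) /\
  (exists l, [/\ X w l, l.1 = theta & l.2 < M])}.
Proof.
have kinv : (0 < k%:R^-1 :> R) by rewrite invr_gt0 ltr0n.
have key j n : {ae P, forall w, (j < k)%N ->
    X w `&` (at_angle k j @` `]n%:R, +oo[) !=set0 /\
    X w `&` (at_angle k j @` `]-oo, - n%:R[) !=set0}.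
  have [jk|jk] := boolP (j < k)%N; last exact: aeW.
  have m1 : measurable (`]n%:R, +oo[ : set (measurableTypeR R)) by exact: measurable_itv.
  have m2 : measurable (`]-oo, - n%:R[ : set (measurableTypeR R)) by exact: measurable_itv.
  have := ae_nonempty (measurable_at_angle k j m1) _.
  rewrite (line_measure_at k0 jk m1) lebesgue_measure_itv /= ltry => /(_ _)/wrap[].
    by rewrite addye// gt0_muley.
  have := ae_nonempty (measurable_at_angle k j m2) _.
  rewrite (line_measure_at k0 jk m2) lebesgue_measure_itv /= ltNyr => /(_ _)/wrap[].
    by rewrite gt0_muley.
  by apply: filterS2 => w h1 h2.
have := ae_foralln (fun j => ae_foralln (key j)); apply: filterS => w h theta M [j jk <-].
have M0 : 0 <= `|M| by [].
have [[l [Xl [x + e]]] [l' [Xl' [x' + e']]]] := h j (Num.bound `|M|) jk.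
rewrite /= !in_itv /= andbT => xM x'M.
have := archi_boundP M0; have := ler_norm M; have := ler_norm (- M); rewrite normrN => h1 h2 h3.
split; [exists l|exists l']; split => //.
- by rewrite -e.
- by rewrite -e /=; lra.
- by rewrite -e'.
- by rewrite -e' /=; lra.
Qed.

End PoissonLines.

(** * Counting crossings *)

Section Crossing.
Context {R : realType}.

Lemma lip_continuous (f : R * R * R -> R) (C : R) : 0 <= C ->
  (forall e y y', close e y y' -> `|f y - f y'| <= C * e) -> continuous f.
Proof.
move=> C0 lip y; apply/cvgrPdist_lt => e e0.
have C1 : 0 < C + 1 by lra.
have r0 : 0 < e / (C + 1) by rewrite divr_gt0.
suff : nbhs y [set y' | `|f y - f y'| < e] by [].
apply/nbhs_ballP; exists (e / (C + 1)) => // y' [[/ltW b1 /ltW b2] /ltW b3].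
apply: (@le_lt_trans _ _ (C * (e / (C + 1)))); first exact: lip.
by rewrite mulrCA gtr_pMr// ltr_pdivrMr//; lra.
Qed.
Variables t1 t2 t3 : R.
Hypothesis s0 : sin (t2 - t1) != 0.

Lemma side_meet z : side (t1, z.1) (meet t1 t2 z) = 0 /\ side (t2, z.2) (meet t1 t2 z) = 0.
Proof.
move: s0; rewrite /side /slope /meet sinB => s1; split => /=.
  transitivity (z.1 * (sin t2 * cos t1 - cos t2 * sin t1) /
    (sin t2 * cos t1 - cos t2 * sin t1) - z.1); last by rewrite mulfK// subrr.
  by field.
transitivity (z.2 * (sin t2 * cos t1 - cos t2 * sin t1) /
    (sin t2 * cos t1 - cos t2 * sin t1) - z.2); last by rewrite mulfK// subrr.
by field.
Qed.

Lemma meet_uniq d1 d2 v : side (t1, d1) v = 0 -> side (t2, d2) v = 0 ->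
  v = meet t1 t2 (d1, d2).
Proof.
move: s0; rewrite /side /slope /meet sinB /= => s1 h1 h2.
have -> : d1 = - sin t1 * v.1 + cos t1 * v.2 by lra.
have -> : d2 = - sin t2 * v.1 + cos t2 * v.2 by lra.
by rewrite [LHS]surjective_pairing; congr (_, _); field.
Qed.

(** The signed distance from the crossing of the first two lines to the third line: [slope t3] at
    the crossing is the coordinate of the parallel line through it. *)
Definition gap (y : R * R * R) : R := y.2 - slope t3 (meet t1 t2 y.1).

Lemma slope_meet : exists p q, forall z, slope t3 (meet t1 t2 z) = p * z.1 + q * z.2.
Proof.
exists ((- sin t3 * cos t2 + cos t3 * sin t2) / sin (t2 - t1)),
  ((sin t3 * cos t1 - cos t3 * sin t1) / sin (t2 - t1)) => z.
by rewrite /slope /meet /=; field.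
Qed.

Lemma meet_lip e (y y' : R * R * R) : close e y y' ->
  `|(meet t1 t2 y.1).1 - (meet t1 t2 y'.1).1| <= 2 / `|sin (t2 - t1)| * e /\
  `|(meet t1 t2 y.1).2 - (meet t1 t2 y'.1).2| <= 2 / `|sin (t2 - t1)| * e.
Proof.
move=> [h1 h2 _].
have key (a b : R) : `|a * (y.1.1 - y'.1.1)| <= `|y.1.1 - y'.1.1| ->
    `|b * (y.1.2 - y'.1.2)| <= `|y.1.2 - y'.1.2| ->
    `|(a * y.1.1 - b * y.1.2) / sin (t2 - t1) - (a * y'.1.1 - b * y'.1.2) / sin (t2 - t1)| <=
    2 / `|sin (t2 - t1)| * e.
  move=> ha hb; rewrite -mulrBl normrM normfV mulrAC ler_wpM2r ?invr_ge0//.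
  have -> : a * y.1.1 - b * y.1.2 - (a * y'.1.1 - b * y'.1.2) =
    a * (y.1.1 - y'.1.1) - b * (y.1.2 - y'.1.2) by ring.
  by rewrite (le_trans (ler_normB _ _))// mulr2n mulrDl mul1r lerD// ?(le_trans ha)// (le_trans hb).
by split; apply: key; rewrite ?sin_le_norm ?cos_le_norm.
Qed.

Lemma slope_meet_lip t e (y y' : R * R * R) : close e y y' ->
  `|slope t (meet t1 t2 y.1) - slope t (meet t1 t2 y'.1)| <= 4 / `|sin (t2 - t1)| * e.
Proof.
move=> /meet_lip[h1 h2]; set v := meet _ _ _ in h1 h2 *; set v' := meet _ _ _ in h1 h2 *.
have -> : slope t v - slope t v' = slope t (v.1 - v'.1, v.2 - v'.2).
  by rewrite /slope /=; ring.
rewrite (le_trans (slope_le _ _))//= (le_trans (lerD h1 h2))// -mulrDl.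
by rewrite -mulrDl -natrD.
Qed.

Lemma gap_lip e (y y' : R * R * R) : close e y y' ->
  `|gap y - gap y'| <= (1 + 4 / `|sin (t2 - t1)|) * e.
Proof.
move=> cl; have := slope_meet_lip t3 cl; case: cl => _ _ h h'.
have -> : gap y - gap y' = y.2 - y'.2 -
    (slope t3 (meet t1 t2 y.1) - slope t3 (meet t1 t2 y'.1)) by rewrite /gap; ring.
by rewrite mulrDl mul1r (le_trans (ler_normB _ _))// lerD.
Qed.

Definition region (D : set R) a b : set (R * R * R) :=
  [set y | square a b (meet t1 t2 y.1) /\ D (gap y)].

Lemma open_region (D : set R) a b : open D -> open (region D a b).
Proof.
move=> oD; rewrite (_ : region D a b =
  (fun y => (meet t1 t2 y.1).1) @^-1` `]a, b[ `&`
  (fun y => (meet t1 t2 y.1).2) @^-1` `]a, b[ `&` gap @^-1` D); last first.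
  by apply/seteqP; split => y [[? ?] ?].
have oab : open (`]a, b[%classic : set R) by exact: itv_open.
apply: openI; last by apply: open_comp oD => y _; apply: (lip_continuous _ gap_lip); rewrite addr_ge0 ?divr_ge0.
have c0 : 0 <= 2 / `|sin (t2 - t1)| by rewrite divr_ge0.
by apply: openI; apply: open_comp oab => y _;
  apply: (lip_continuous c0) => e z z' /meet_lip[].
Qed.

Local Notation leb := (@lebesgue_measure R).

(** The case of [integral_region] in which the integrand depends on the triple only through its
    gap. *)
Lemma integral_gap (D : set (measurableTypeR R)) a b (g : R * R * R -> R)
    (phi : measurableTypeR R -> R) : a <= b -> measurable D ->
  measurable_fun setT phi -> (forall x, 0 <= phi x) ->
  (forall y, D (gap y) -> g y = phi (gap y)) ->
  (\int[(leb \x leb) \x leb]_y (if y \in region D a b then g y else 0)%:E =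
   (`|sin (t2 - t1)| * (b - a) ^+ 2)%:E * \int[leb]_x (if x \in D then phi x else 0)%:E)%E.
Proof.
move=> ab mD mphi phi0 gE; have [p [q pqE]] := slope_meet.
rewrite -(integral_region p q s0 ab (phi := fun x => (if x \in D then phi x else 0)%:E)).
- apply: eq_integral => y _; rewrite -EFinM /sq indicE -pqE -/(gap y).
  have [s|s] := boolP (meet t1 t2 y.1 \in _); rewrite ?mul1r ?mul0r; last first.
    by rewrite memNset// => -[? _]; move: s; rewrite notin_setE.
  have [Dy|Dy] := boolP (gap y \in D).
    by rewrite mem_set ?gE//; [exact: set_mem|split; exact: set_mem].
  by rewrite memNset// => -[_ ?]; rewrite notin_setE in Dy.
- apply/measurable_EFinP; apply: measurable_fun_ifT => //.
  apply: (measurable_fun_bool true); rewrite setTI (_ : _ @^-1` _ = D)//.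
  by apply/seteqP; split => w /=; [move=> /set_mem|move=> /mem_set ->].
- by move=> x; case: ifP => _; rewrite lee_fin.
Qed.

End Crossing.


Section ExponentialSide.
Context {R : realType}.
Local Notation leb := (@lebesgue_measure R).

Lemma open_side (s : R) : open [set x | 0 < x * s].
Proof.
rewrite (_ : [set x | _] = (fun x => x * s) @^-1` [set x | 0 < x])//.
apply: open_comp (@open_gt _ 0) => x _; apply: cvgM; [exact: cvg_id|exact: cvg_cst].
Qed.

(** The half line on which x has the sign of [s] is mapped to the positive half line by that
    sign. *)
Lemma integral_exp_side (s a v : R) : s != 0 -> 0 < a -> 0 <= v ->
  (\int[leb]_x (if x \in [set x | 0 < x * s] then v * expR (- (a * `|x|)) else 0)%:E =
   (v / a)%:E)%E.
Proof.
move=> s0 a0 v0.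
pose f (x : measurableTypeR R) : \bar R := (if 0 < x then expR (- a * x) else 0)%:E.
have mf : measurable_fun setT f.
  apply/measurable_EFinP; apply: measurable_fun_ifT => //.
    by apply: measurable_fun_ltr => //; exact: measurable_cst.
  apply: measurableT_comp => //; exact: measurable_scale.
have f0 x : (0 <= f x)%E by rewrite /f; case: ifP; rewrite lee_fin// expR_ge0.
have sg0 : Num.sg s != 0 by rewrite sgr_eq0.
have key (x : R) : (0 < x * s) = (0 < Num.sg s * x).
  have -> : x * s = (Num.sg s * x) * `|s| by rewrite {1}(numEsg s); ring.
  by apply: pmulr_lgt0; rewrite normr_gt0.
have key2 (x : R) : 0 < Num.sg s * x -> Num.sg s * x = `|x|.
  by move=> h; rewrite -(gtr0_norm h) normrM normr_sg s0 mul1r.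
transitivity (\int[leb]_x (v%:E * f (Num.sg s * x + 0)%R))%E.
  apply: eq_integral => x _; rewrite /f -EFinM; congr _%:E.
  have -> : (x \in [set x | 0 < x * s]) = (0 < Num.sg s * x + 0).
    by rewrite addr0 -key; apply/idP/idP => [/set_mem|h]; [|apply/mem_set].
  case: ifP => h; last by rewrite mulr0.
  by rewrite addr0 in h *; rewrite (key2 x h) mulNr.
rewrite ge0_integralZl_EFin//.
- rewrite (ge0_integral_affine 0 sg0 mf f0) normr_sg s0 invr1 mul1e integral_exp//.
- apply: measurableT_comp mf _; exact: measurable_affine.
Qed.

End ExponentialSide.

Lemma sin_ang_neq0 (R : realType) (k i j : nat) : (i < k)%N -> (j < k)%N -> i <> j ->
  sin (ang k i - ang k j) != 0 :> R.
Proof.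
wlog ji : i j / (j <= i)%N => [h ik jk ij|ik jk ij].
  have [ji|/ltnW] := leqP j i; first exact: h ji ik jk ij.
  by move=> /h/(_ jk ik (nesym ij)); rewrite -opprB sinN oppr_eq0.
have k0 : (0 < k)%N by case: (k) ik.
rewrite -angB// gt_eqF// sin_ang_gt0//.
by rewrite subn_gt0 ltn_neqAle ji andbT eq_sym; apply/andP; split; [exact/eqP|lia].
Qed.

Lemma counting_ge1 (T : choiceType) (R : realType) (A : set T) : A !=set0 ->
  (1 <= counting A :> \bar R)%E.
Proof.
move=> [x Ax]; have [fA|fA] := pselect (finite_set A); last by rewrite counting_infinite ?leey.
rewrite counting_finite// lee_fin ler1n lt0n cardfs_eq0; apply/eqP => e.
by have : x \in fset_set A by [rewrite in_fset_set// inE]; rewrite e in_fset0.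
Qed.

(** * A third line at given signed distance from a crossing *)

Section GapTriples.
Context {R : realType} {d : measure_display} {Omega : measurableType d}.
Variable k : nat.
Hypothesis k0 : (0 < k)%N.
Local Notation T := (measurableTypeR R * measurableTypeR R)%type.
Local Notation leb := (@lebesgue_measure R).
Variables (P : probability Omega R) (X : Omega -> set T).
Hypothesis pp : poisson_process P (@line_measure R k) X.
Variables (j1 j2 j3 : nat).
Hypotheses (jk1 : (j1 < k)%N) (jk2 : (j2 < k)%N) (jk3 : (j3 < k)%N).
Hypotheses (j12 : j1 <> j2) (j13 : j1 <> j3) (j23 : j2 <> j3).
Local Notation t1 := (ang (R := R) k j1).
Local Notation t2 := (ang (R := R) k j2).
Local Notation t3 := (ang (R := R) k j3).
Local Notation gap := (gap t1 t2 t3).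
Local Notation pt := (at_angle (R := R) k).
Local Notation pts := (three_pts (pt j1) (pt j2) (pt j3)).

Let s0 : sin (t2 - t1) != 0.
Proof. by rewrite sin_ang_neq0//; exact/nesym. Qed.

Variables (D : set R) (a b c : R).
Hypotheses (openD : open D) (ab : a <= b) (c0 : 0 <= c).

(** The first two directions carry one-point intervals and other directions none, so only the
    interval of the third direction, of length c times the absolute gap, contributes to [width]. *)
Let J : pred nat := [pred j | [|| j == j1, j == j2 | j == j3]].
Let lo j (y : R * R * R) := if j == j1 then y.1.1 else if j == j2 then y.1.2 else
  Num.min y.2 (y.2 - c * gap y).
Let hi j (y : R * R * R) := if j == j1 then y.1.1 else if j == j2 then y.1.2 else
  Num.max y.2 (y.2 - c * gap y).

(* With c = 0 only the three lines are selected; with c = 1 no line in the third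
   direction may separate the third line from the crossing of the first two. *)
Definition gap_triples (L : set T) : set (R * R * R) :=
  [set y | [/\ region t1 t2 t3 D a b y, pts y `<=` L &
    forall x, L (pt j3 x) -> ~ (Num.min y.2 (y.2 - c * gap y) < x < Num.max y.2 (y.2 - c * gap y))]].

Lemma min_lip (x x' y y' e : R) : `|x - x'| <= e -> `|y - y'| <= e ->
  `|Num.min x y - Num.min x' y'| <= e /\ `|Num.max x y - Num.max x' y'| <= e.
Proof.
rewrite !ler_norml => /andP[h1 h2] /andP[h3 h4].
by rewrite !minElt !maxElt; split; do 2 case: ifPn; rewrite -?leNgt => *; apply/andP; split; lra.
Qed.

Lemma integral_gap_triples : exists H : Omega -> \bar R,
  [/\ measurable_fun setT H, (forall w, 0 <= H w)%E,
   (\int[P]_w H w = (`|sin (t2 - t1)| * (b - a) ^+ 2)%:E *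
      \int[leb]_x (if x \in D then k%:R^-1 ^+ 3 * expR (- (k%:R^-1 * (c * `|x|))) else 0)%:E)%E &
   forall w, locally_finite (X w) ->
     (forall y, gap_triples (X w) y -> forall x, X w (pt j3 x) ->
       Num.min y.2 (y.2 - c * gap y) <= x <= Num.max y.2 (y.2 - c * gap y) -> x = y.2) ->
     H w = counting (gap_triples (X w))].
Proof.
have Jc1 : J j1 by rewrite /J /= eqxx.
have Jc2 : J j2 by rewrite /J /= eqxx orbT.
have Jc3 : J j3 by rewrite /J /= eqxx !orbT.
have e21 : (j2 == j1) = false by apply/negbTE/eqP/nesym.
have e31 : (j3 == j1) = false by apply/negbTE/eqP/nesym.
have e32 : (j3 == j2) = false by apply/negbTE/eqP/nesym.
pose C : R := 1 + c * (1 + 4 / `|sin (t2 - t1)|).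
have g0 : 0 <= 1 + 4 / `|sin (t2 - t1)| by rewrite addr_ge0 ?divr_ge0.
have C0 : 0 <= C by rewrite addr_ge0 ?mulr_ge0.
have lohi j y : lo j y <= hi j y.
  by rewrite /lo /hi; case: ifP => // _; case: ifP => // _; rewrite ge_min le_max lexx.
have lip j e y y' : close e y y' ->
    `|lo j y - lo j y'| <= C * e /\ `|hi j y - hi j y'| <= C * e.
  move=> cl; have [h1 h2 h3] := cl.
  have e0 : 0 <= e by exact: le_trans h1.
  have eC : e <= C * e by rewrite ler_peMl// lerDl mulr_ge0.
  rewrite /lo /hi; case: ifP => _; first by split; exact: le_trans eC.
  case: ifP => _; first by split; exact: le_trans eC.
  apply: min_lip; first exact: le_trans eC.
  rewrite [C * e]mulrDl mul1r.
  have -> : y.2 - c * gap y - (y'.2 - c * gap y') = y.2 - y'.2 - c * (gap y - gap y') by ring.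
  rewrite (le_trans (ler_normB _ _))// lerD// normrM (ger0_norm c0) -mulrA ler_wpM2l//.
  exact: gap_lip.
have in1 y : lo j1 y <= y.1.1 <= hi j1 y by rewrite /lo /hi eqxx lexx.
have in2 y : lo j2 y <= y.1.2 <= hi j2 y by rewrite /lo /hi e21 eqxx lexx.
have in3 y : lo j3 y <= y.2 <= hi j3 y.
  by rewrite /lo /hi e31 e32 ge_min le_max !lexx.
have oA : open (region t1 t2 t3 D a b) by exact: open_region.
have end1 y : region t1 t2 t3 D a b y -> ~ (lo j1 y < y.1.1 < hi j1 y).
  by rewrite /lo /hi eqxx ltxx.
have end2 y : region t1 t2 t3 D a b y -> ~ (lo j2 y < y.1.2 < hi j2 y).
  by rewrite /lo /hi e21 eqxx ltxx.
have end3 y : region t1 t2 t3 D a b y -> ~ (lo j3 y < y.2 < hi j3 y).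
  move=> _; rewrite /lo /hi e31 e32 gt_min lt_max !ltxx /= => /andP[h1 h2].
  by have := lt_trans h1 h2; rewrite ltxx.
have [H [mH H0 IH cH]] := integral_void_triples k0 pp jk1 jk2 jk3 j12 j13 j23 C0 oA lohi lip
  Jc1 Jc2 Jc3 in1 in2 in3 end1 end2 end3.
have vE L : void_triples k j1 j2 j3 J lo hi (region t1 t2 t3 D a b) L = gap_triples L.
  apply/seteqP; split => y [Ay yL h]; split => //.
    by move=> x Lx; have := h j3 x jk3 Jc3 Lx; rewrite /lo /hi e31 e32.
  move=> j x jk /or3P[]/eqP -> Lx; rewrite /lo /hi ?eqxx ?e21 ?e31 ?e32.
  - by move=> /andP[] /lt_trans h' /h'; rewrite ltxx.
  - by move=> /andP[] /lt_trans h' /h'; rewrite ltxx.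
  - exact: h.
exists H; split => //.
  rewrite IH; apply: integral_gap => //.
  - exact: open_measurable.
  - apply: measurable_funM; first exact: measurable_cst.
    apply: measurableT_comp => //; apply: measurable_funN.
    apply: measurable_funM; first exact: measurable_cst.
    apply: measurable_funM; first exact: measurable_cst.
    exact: normr_measurable.
  - move=> y _; congr (_ * expR (- _)); rewrite /width.
    rewrite (bigD1 (Ordinal jk3))//= Jc3 big1 ?addr0 => [|j /eqP jj].
      rewrite /lo /hi e31 e32; congr (_ * _); have [g|g] := leP 0 (gap y).
        have h : 0 <= c * gap y by rewrite mulr_ge0.
        by rewrite min_r ?max_l ?ger0_norm//; [ring|lra|lra].
      have h : c * gap y <= 0 by rewrite mulr_ge0_le0// ltW.
      by rewrite min_l ?max_r ?ltr0_norm//; [ring|lra|lra].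
    have jj3 : (nat_of_ord j == j3) = false by apply/negbTE/eqP => e; apply: jj; exact: val_inj.
    rewrite /J /lo /hi /= jj3 orbF; case: ifP => // /orP[]/eqP ->.
      by rewrite eqxx subrr mulr0.
    by rewrite e21 eqxx subrr mulr0.
move=> w lf tan; rewrite (cH w lf) ?vE// => y vy j x jk /or3P[]/eqP -> Xx.
- by rewrite /lo /hi eqxx => /andP[h1 h2]; left; left; congr (_, _); apply/eqP; rewrite eq_le h2 h1.
- rewrite /lo /hi e21 eqxx => /andP[h1 h2]; left; right.
  by congr (_, _); apply/eqP; rewrite eq_le h2 h1.
- by rewrite /lo /hi e31 e32 => h; right; rewrite (tan y _ x).
Qed.

End GapTriples.

Section GapConsequences.
Context {R : realType} {d : measure_display} {Omega : measurableType d}.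
Variable k : nat.
Hypothesis k0 : (0 < k)%N.
Local Notation T := (measurableTypeR R * measurableTypeR R)%type.
Local Notation leb := (@lebesgue_measure R).
Variables (P : probability Omega R) (X : Omega -> set T).
Hypothesis pp : poisson_process P (@line_measure R k) X.
Local Notation pt := (at_angle (R := R) k).

(** Triples with their crossing in a fixed square and a gap below r in absolute value have an
    expected number proportional to r, hence gap 0 does not occur there. Growing squares exhaust the
    plane. *)
Lemma ae_not_concurrent j1 j2 j3 : (j1 < k)%N -> (j2 < k)%N -> (j3 < k)%N ->
  j1 <> j2 -> j1 <> j3 -> j2 <> j3 ->
  {ae P, forall w, forall y : R * R * R, three_pts (pt j1) (pt j2) (pt j3) y `<=` X w ->
     gap (ang k j1) (ang k j2) (ang k j3) y != 0}.
Proof.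
move=> jk1 jk2 jk3 j12 j13 j23.
pose s := `|sin (ang k j2 - ang k j1 : R)|.
have key M : {ae P, forall w, ~ exists y : R * R * R,
    [/\ three_pts (pt j1) (pt j2) (pt j3) y `<=` X w,
        square (- M%:R) M%:R (meet (ang k j1) (ang k j2) y.1) &
        gap (ang k j1) (ang k j2) (ang k j3) y = 0]}.
  apply: ae_not_of_integral_small => e e0.
  (* The constant of this linear bound in r, plus 1 to allow division by it. *)
  pose B : R := s * (M%:R - - M%:R) ^+ 2 * k%:R^-1 ^+ 3 * 2 + 1.
  have B0' : 0 <= s * (M%:R - - M%:R) ^+ 2 * k%:R^-1 ^+ 3 * 2.
    by rewrite !mulr_ge0 ?sqr_ge0 ?normr_ge0 ?exprn_ge0 ?invr_ge0.
  have B0 : 0 < B by rewrite ltr_wpDl.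
  pose r := e / B; have r0 : 0 < r by rewrite divr_gt0.
  have oD : open (`]- r, r[%classic : set R) by exact: itv_open.
  have MM : - M%:R <= M%:R :> R by rewrite (@le_trans _ _ 0)// oppr_le0.
  have [H [mH H0 IH cH]] := integral_gap_triples k0 pp jk1 jk2 jk3 j12 j13 j23 oD MM (lexx 0).
  exists H; split => //.
    rewrite IH.
    have -> : (\int[leb]_x (if x \in (`]- r, r[%classic : set R) then
        k%:R^-1 ^+ 3 * expR (- (k%:R^-1 * (0 * `|x|))) else 0)%:E = (k%:R^-1 ^+ 3 * (2 * r))%:E)%E.
      transitivity (\int[leb]_x ((k%:R^-1 ^+ 3)%:E * (\1_(`]- r, r[%classic : set R) x)%:E))%E.
        apply: eq_integral => x _; rewrite indicE -EFinM mul0r mulr0 oppr0 expR0 mulr1.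
        by case: (x \in _); rewrite ?mulr1 ?mulr0.
      rewrite ge0_integralZl_EFin//.
      - have lI : leb `]- r, r[%classic = (2 * r)%:E.
          rewrite lebesgue_measure_itv /= lte_fin ifT; last lra.
          by rewrite -EFinB; congr _%:E; ring.
        by rewrite integral_indic// setIT [X in (_ * X)%E]lI EFinM.
      - apply/measurable_EFinP; exact: measurable_indic.
    rewrite -EFinM lee_fin -/s.
    have -> : s * (M%:R - - M%:R) ^+ 2 * (k%:R^-1 ^+ 3 * (2 * r)) =
      (s * (M%:R - - M%:R) ^+ 2 * k%:R^-1 ^+ 3 * 2) * r by ring.
    rewrite /r mulrCA ger_pMr// ler_pdivrMr// mul1r /B lerDl ler01 //.
  have := ae_locally_finite k0 pp; apply: filterS => w lf [y [yX ys gy]].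
  rewrite cH//; last first.
    by move=> y' _ x _; rewrite mul0r subr0 minxx maxxx => h; apply/eqP; rewrite eq_le andbC.
  apply: counting_ge1; exists y; split => //.
    by split => //=; rewrite gy in_itv /= oppr_lt0 r0.
  by move=> x _; rewrite mul0r subr0 minxx maxxx => /andP[h1 h2]; have := lt_trans h1 h2; rewrite ltxx.
have := ae_foralln key; apply: filterS => w h y yX; apply/eqP => gy.
set v := meet (ang k j1) (ang k j2) y.1.
apply: (h (Num.bound (`|v.1| + `|v.2|))); exists y; split => //.
have := archi_boundP (addr_ge0 (normr_ge0 v.1) (normr_ge0 v.2)).
set M : R := (Num.bound _)%:R => hM.
have h1 : `|v.1| < M by apply: le_lt_trans hM; rewrite lerDl.
have h2 : `|v.2| < M by apply: le_lt_trans hM; rewrite lerDr.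
by split; rewrite /= in_itv /= -ltr_norml.
Qed.

Lemma integral_first_line j1 j2 j3 a b : (j1 < k)%N -> (j2 < k)%N -> (j3 < k)%N ->
  j1 <> j2 -> j1 <> j3 -> j2 <> j3 -> a <= b ->
  exists H : Omega -> \bar R, [/\ measurable_fun setT H, (forall w, 0 <= H w)%E,
   (\int[P]_w H w = (k%:R^-1 ^+ 2 * sinD k j1 j2 * (b - a) ^+ 2)%:E)%E &
   {ae P, forall w, H w = counting [set y : R * R * R |
     let v := meet (ang k j1) (ang k j2) y.1 in
     [/\ square a b v, three_pts (pt j1) (pt j2) (pt j3) y `<=` X w,
       slope (ang k j3) v < y.2 &
       forall x, X w (pt j3 x) -> ~ (slope (ang k j3) v < x < y.2)]]}].
Proof.
move=> jk1 jk2 jk3 j12 j13 j23 ab.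
have oD := @open_side R 1.
have [H [mH H0 IH cH]] := integral_gap_triples k0 pp jk1 jk2 jk3 j12 j13 j23 oD ab ler01.
exists H; split => //.
  have k1 : 0 < k%:R^-1 :> R by rewrite invr_gt0 ltr0n.
  have := integral_exp_side (oner_neq0 R) k1 (exprn_ge0 3 (ltW k1)).
  under eq_integral => x _ do rewrite -(mul1r `|x|).
  rewrite IH => ->; rewrite -EFinM; congr _%:E; rewrite sinDC /sinD.
  by field; rewrite pnatr_eq0 -lt0n.
have := ae_not_concurrent jk1 jk2 jk3 j12 j13 j23.
have := ae_locally_finite k0 pp; apply: filterS2 => w lf nc.
have D0 (y : R * R * R) : (0 < gap (ang k j1) (ang k j2) (ang k j3) y * 1) =
    (slope (ang k j3) (meet (ang k j1) (ang k j2) y.1) < y.2).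
  by rewrite mulr1 subr_gt0.
have mm (y : R * R * R) : slope (ang k j3) (meet (ang k j1) (ang k j2) y.1) < y.2 ->
    Num.min y.2 (y.2 - 1 * gap (ang k j1) (ang k j2) (ang k j3) y) =
      slope (ang k j3) (meet (ang k j1) (ang k j2) y.1) /\
    Num.max y.2 (y.2 - 1 * gap (ang k j1) (ang k j2) (ang k j3) y) = y.2.
  rewrite /gap => sy; rewrite mul1r opprB addrC subrK; split.
    by rewrite min_r// ltW.
  by rewrite max_l// ltW.
rewrite cH//.
  congr counting; apply/seteqP; split => y /=.
    move=> [[sy gy] yX h]; rewrite /= D0 in gy; split => // x Xx.
    by have := h x Xx; have [-> ->] := mm y gy.
  move=> [sy yX gy h]; split => //; first by split => //=; rewrite D0.
  by have [-> ->] := mm y gy.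
move=> y [[sy gy] yX h] x Xx; rewrite /= D0 in gy; have := h x Xx.
have [-> ->] := mm y gy => nb /andP[h1 h2].
(* Equality would put a line of the third direction through the crossing of the other two. *)
have h1' : slope (ang k j3) (meet (ang k j1) (ang k j2) y.1) < x.
  rewrite lt_neqAle h1 andbT eq_sym -subr_eq0.
  apply: (nc (y.1, x)) => l [[]|] -> //=; first by apply: yX; left; left.
  by apply: yX; left; right.
by apply/eqP; rewrite eq_le h2 leNgt; apply/negP => h3; apply: nb; rewrite h1'.
Qed.

End GapConsequences.

(** * Counting triangles *)

Section GoodAlmostSurely.
Context {R : realType} {d : measure_display} {Omega : measurableType d}.
Variable k : nat.
Hypothesis k0 : (0 < k)%N.
Local Notation T := (measurableTypeR R * measurableTypeR R)%type.
Variables (P : probability Omega R) (X : Omega -> set T).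
Hypothesis pp : poisson_process P (@line_measure R k) X.
Local Notation pt := (at_angle (R := R) k).

Lemma ae_good : {ae P, forall w, good_lines (angles k) (X w)}.
Proof.
have nc : {ae P, forall w, forall j1 j2 j3, (j1 < k)%N -> (j2 < k)%N -> (j3 < k)%N ->
    j1 <> j2 -> j1 <> j3 -> j2 <> j3 ->
    forall y : R * R * R, three_pts (pt j1) (pt j2) (pt j3) y `<=` X w ->
    gap (ang k j1) (ang k j2) (ang k j3) y != 0}.
  apply: ae_foralln => j1; apply: ae_foralln => j2; apply: ae_foralln => j3.
  have [jk1|?] := boolP (j1 < k)%N; last by apply: aeW.
  have [jk2|?] := boolP (j2 < k)%N; last by apply: aeW.
  have [jk3|?] := boolP (j3 < k)%N; last by apply: aeW.
  have [?|j12] := eqVneq j1 j2; first by apply: aeW.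
  have [?|j13] := eqVneq j1 j3; first by apply: aeW.
  have [?|j23] := eqVneq j2 j3; first by apply: aeW.
  have := ae_not_concurrent k0 pp jk1 jk2 jk3 (elimN eqP j12) (elimN eqP j13) (elimN eqP j23).
  by apply: filterS => w h _ _ _ _ _ _.
have angu : {ae P, forall w, (forall l, X w l -> angles k l.1) /\
    forall theta M, angles k theta -> (exists l, [/\ X w l, l.1 = theta & M < l.2]) /\
    (exists l, [/\ X w l, l.1 = theta & l.2 < M])}.
  by have := ae_angles pp; have := ae_unbounded k0 pp; apply: filterS2.
move: nc angu (ae_locally_finite k0 pp); apply: filterS3 => w nc [angs unb] lf; split => // l1 l2 l3 v L1 L2 L3 v1 v2 v3.
have [/eqP|a12] := eqVneq l1.1 l2.1; first by move=> /eqP e; constructor 1; exact: same_angle v1 v2 e.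
have [/eqP|a13] := eqVneq l1.1 l3.1; first by move=> /eqP e; constructor 2; exact: same_angle v1 v3 e.
have [/eqP|a23] := eqVneq l2.1 l3.1; first by move=> /eqP e; constructor 3; exact: same_angle v2 v3 e.
exfalso.
have [j1 jk1 e1] := angs _ L1; have [j2 jk2 e2] := angs _ L2; have [j3 jk3 e3] := angs _ L3.
have j12 : j1 <> j2 by move=> e; move: a12; rewrite -e1 -e2 e eqxx.
have j13 : j1 <> j3 by move=> e; move: a13; rewrite -e1 -e3 e eqxx.
have j23 : j2 <> j3 by move=> e; move: a23; rewrite -e2 -e3 e eqxx.
have := nc j1 j2 j3 jk1 jk2 jk3 j12 j13 j23 (l1.2, l2.2, l3.2).
rewrite /gap /= e1 e2 e3 -(@meet_uniq _ _ _ _ l1.2 l2.2 v).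
- move=> h; have := v3; rewrite /side => /eqP; rewrite subr_eq0 => /eqP e.
  move: h; rewrite e subrr eqxx => h; suff : false by []; apply: h.
  by move=> l [[]|] -> /=; rewrite /at_angle ?e1 ?e2 ?e3 -surjective_pairing.
- by rewrite -e1 -e2; apply: sin_ang_neq0 => //; exact/nesym.
- by rewrite -surjective_pairing.
- by rewrite -surjective_pairing.
Qed.

End GoodAlmostSurely.

Section MinMax.
Context {R : realType}.

(** For the coordinates of the corners of a triangle this splits its width in one direction over the
    three sides, so that the sum over directions can be taken side by side. *)
Lemma minmax_width (s a b : R) :
  Num.max s (Num.max (s + a) (s + b)) - Num.min s (Num.min (s + a) (s + b)) =
  (`|a| + `|b| + `|a - b|) / 2.
Proof.
rewrite !maxElt !minElt.
have nE (x : R) : `|x| = if x < 0 then - x else x.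
  by case: ifPn => [/ltr0_norm //|]; rewrite -leNgt => /ger0_norm.
rewrite !nE; do ! (case: ifPn; rewrite -?leNgt); lra.
Qed.

Lemma min3_lip (x x' y y' z z' e : R) : `|x - x'| <= e -> `|y - y'| <= e -> `|z - z'| <= e ->
  `|Num.min x (Num.min y z) - Num.min x' (Num.min y' z')| <= e /\
  `|Num.max x (Num.max y z) - Num.max x' (Num.max y' z')| <= e.
Proof.
by move=> hx hy hz; have [h1 h2] := min_lip hy hz; have [h3 _] := min_lip hx h1;
  have [_ h4] := min_lip hx h2.
Qed.

Lemma minmax3_eq (x a b c : R) :
  Num.min a (Num.min b c) <= x <= Num.max a (Num.max b c) ->
  ~ (Num.min a (Num.min b c) < x < Num.max a (Num.max b c)) -> [\/ x = a, x = b | x = c].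
Proof.
move=> /andP[h1 h2] /negP; rewrite negb_and -!leNgt => /orP[h|h].
- have -> : x = Num.min a (Num.min b c) by apply/eqP; rewrite eq_le h.
  have mm (u v : R) : Num.min u v = u \/ Num.min u v = v by case: leP; [left|right].
  by have [->|->] := mm b c; [have [->|->] := mm a b|have [->|->] := mm a c];
    [constructor 1|constructor 2|constructor 1|constructor 3].
- have -> : x = Num.max a (Num.max b c) by apply/eqP; rewrite eq_le h2.
  have mm (u v : R) : Num.max u v = u \/ Num.max u v = v by case: leP; [right|left].
  by have [->|->] := mm b c; [have [->|->] := mm a b|have [->|->] := mm a c];
    [constructor 1|constructor 2|constructor 1|constructor 3].
Qed.

Lemma minmax3_shift (x a b c : R) :
  (Num.min (a - x) (Num.min (b - x) (c - x)) < 0 < Num.max (a - x) (Num.max (b - x) (c - x))) =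
  (Num.min a (Num.min b c) < x < Num.max a (Num.max b c)).
Proof. by rewrite !gt_min !lt_max !subr_lt0 !subr_gt0. Qed.

End MinMax.

(** * Expected number of caps for three given directions *)

Section Caps.
Context {R : realType} {d : measure_display} {Omega : measurableType d}.
Variable k : nat.
Hypothesis k1 : (1 < k)%N.
Let k0 : (0 < k)%N. Proof. exact: ltnW. Qed.
Local Notation T := (measurableTypeR R * measurableTypeR R)%type.
Local Notation leb := (@lebesgue_measure R).
Variables (P : probability Omega R) (X : Omega -> set T).
Hypothesis pp : poisson_process P (@line_measure R k) X.
Local Notation pt := (at_angle (R := R) k).

Lemma sin_angles (a b : R) : angles k a -> angles k b -> a <> b -> sin (b - a) != 0.
Proof.
move=> [i ik <-] [j jk <-] ij; apply: sin_ang_neq0 => // e.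
by subst j.
Qed.

Lemma two_angles (a : R) : angles k a -> exists2 b, angles k b & b <> a.
Proof.
move=> [j jk <-]; exists (ang k (j == 0%N)).
  by exists (j == 0%N) => //=; case: (j == 0%N).
by move=> /(ang_inj k0); case: j jk => [|[|]].
Qed.

Variables (j1 j2 j3 : nat).
Hypotheses (jk1 : (j1 < k)%N) (jk2 : (j2 < k)%N) (jk3 : (j3 < k)%N).
Hypotheses (j12 : j1 <> j2) (j13 : j1 <> j3) (j23 : j2 <> j3).
Local Notation t1 := (ang (R := R) k j1).
Local Notation t2 := (ang (R := R) k j2).
Local Notation t3 := (ang (R := R) k j3).
Local Notation gap := (gap t1 t2 t3).
Local Notation pts := (three_pts (pt j1) (pt j2) (pt j3)).
Local Notation v := (fun y : R * R * R => meet t1 t2 y.1).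

Let u1 : R * R := dirv t1.
Let u2 : R * R := dirv t2.
Let s1 : R := slope t3 u1.
Let s2 : R := slope t3 u2.

Let K : R := \sum_(m < k) sin (ang k m).

Let K0 : 0 < K.
Proof.
rewrite lt_neqAle eq_sym; apply/andP; split.
  apply/eqP => K0'; have := @sum_sin R k k0 k1; rewrite -/K K0' mul0r => /esym/eqP.
  by rewrite oner_eq0.
by apply: sumr_ge0 => m _; rewrite sin_ang_ge0// ltnW.
Qed.

Lemma abs_slope_ang i j : `|slope (ang k j) (dirv (ang k i))| = sinD k i j :> R.
Proof. exact: norm_slope_dirv. Qed.

Lemma sinD_gt0 i j : (i < k)%N -> (j < k)%N -> i <> j -> 0 < sinD k i j :> R.
Proof. by move=> ik jk ij; rewrite normr_gt0 sin_ang_neq0. Qed.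

Let s10 : s1 != 0.
Proof. by rewrite -normr_gt0 abs_slope_ang sinD_gt0. Qed.

Let s20 : s2 != 0.
Proof. by rewrite -normr_gt0 abs_slope_ang sinD_gt0. Qed.

Let s0 : sin (t2 - t1) != 0.
Proof. by rewrite sin_ang_neq0//; exact/nesym. Qed.

(** For a third line at gap g, the other corners are v + (g / s1) u1 and v + (g / s2) u2. In passing
    to them from v, the coordinate of direction j changes by g times [al j] and [be j]. *)
Let al j : R := slope (ang k j) u1 / s1.
Let be j : R := slope (ang k j) u2 / s2.

Lemma sum_abs_al : \sum_(j < k) `|al j| = K / sinD k j1 j3.
Proof.
rewrite /K -(sum_abs_sin k0 j1) mulr_suml; apply: eq_bigr => j _.
by rewrite /al normrM normfV !abs_slope_ang.
Qed.

Lemma sum_abs_be : \sum_(j < k) `|be j| = K / sinD k j2 j3.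
Proof.
rewrite /K -(sum_abs_sin k0 j2) mulr_suml; apply: eq_bigr => j _.
by rewrite /be normrM normfV !abs_slope_ang.
Qed.

(* u1 / s1 - u2 / s2 is parallel to the third line. *)
Lemma sum_abs_al_be : \sum_(j < k) `|al j - be j| =
  K * sinD k j1 j2 / (sinD k j1 j3 * sinD k j2 j3).
Proof.
pose w : R * R := (u1.1 / s1 - u2.1 / s2, u1.2 / s1 - u2.2 / s2).
have wE j : al j - be j = slope (ang k j) w by rewrite /al /be /slope /w /=; ring.
have [c cE] : exists c, w = (c * (dirv t3).1, c * (dirv t3).2).
  by apply: slope_eq0; rewrite -wE /al /be -/s1 -/s2 !divff// subrr.
(* The length of the third side per unit of gap is found by comparing its projections in the first
   direction, where [al] vanishes. *)
have cN : `|c| = sinD k j1 j2 / (sinD k j1 j3 * sinD k j2 j3).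
  have : `|slope t1 w| = `|c| * sinD k j3 j1.
    by rewrite cE slope_scale normrM abs_slope_ang.
  rewrite -wE /al /u1 slope_dirv mul0r sub0r normrN /be normrM normfV !abs_slope_ang.
  have h13 := sinD_gt0 jk1 jk3 j13; have h23 := sinD_gt0 jk2 jk3 j23.
  rewrite (sinDC k j3 j1) (sinDC k j2 j1) => e.
  by apply: (mulIf (lt0r_neq0 h13)); rewrite -e; field; rewrite !gt_eqF.
rewrite -mulrA -cN /K -(sum_abs_sin k0 j3) mulr_suml; apply: eq_bigr => j _.
by rewrite wE cE slope_scale normrM abs_slope_ang mulrC.
Qed.

(** The coordinates strictly between [lo j] and [hi j] are those of the lines of angle [ang k j]
    that meet the interior of the triangle. *)
Let lo j (y : R * R * R) := Num.min (slope (ang k j) (v y))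
  (Num.min (slope (ang k j) (v y) + gap y * al j) (slope (ang k j) (v y) + gap y * be j)).
Let hi j (y : R * R * R) := Num.max (slope (ang k j) (v y))
  (Num.max (slope (ang k j) (v y) + gap y * al j) (slope (ang k j) (v y) + gap y * be j)).

Lemma hi_lo j y : hi j y - lo j y = `|gap y| * ((`|al j| + `|be j| + `|al j - be j|) / 2).
Proof. by rewrite /hi /lo minmax_width -mulrBr !normrM -!mulrDr mulrA. Qed.

(** The Lipschitz constant of the coordinate of the crossing, plus that of the gap times bounds for
    [al] and [be]; these use that the coordinates of a unit vector have absolute sum at most 2. *)
Let C : R := 4 / `|sin (t2 - t1)| + (1 + 4 / `|sin (t2 - t1)|) * (2 / `|s1| + 2 / `|s2|).

Let C0 : 0 <= C.
Proof. by rewrite /C !(addr_ge0, mulr_ge0, invr_ge0). Qed.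

Lemma dirv_le1 t : `|(dirv t).1| + `|(dirv t).2| <= 2 :> R.
Proof.
have [s s1' ->] := dirvE t; rewrite /= ![s * _]mulrC.
have ns : `|s| = 1 by move/eqP: s1'; rewrite sqrf_eq1 => /orP[]/eqP ->; rewrite ?normrN normr1.
have := cos_le_norm t s; have := sin_le_norm t s; rewrite ns; lra.
Qed.

Lemma lip_lohi j e y y' : close e y y' ->
  `|lo j y - lo j y'| <= C * e /\ `|hi j y - hi j y'| <= C * e.
Proof.
move=> cl; have [h1 _ _] := cl; have e0 : 0 <= e by exact: le_trans h1.
have g0 : 0 <= 1 + 4 / `|sin (t2 - t1)| by rewrite addr_ge0 ?divr_ge0.
have r1 : 0 <= 2 / `|s1| by rewrite divr_ge0.
have r2 : 0 <= 2 / `|s2| by rewrite divr_ge0.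
have hs := slope_meet_lip t1 t2 (ang k j) cl; have hg := gap_lip t1 t2 t3 cl.
have alb : `|al j| <= 2 / `|s1|.
  by rewrite /al normrM normfV ler_wpM2r ?invr_ge0// (le_trans (slope_le _ _))// dirv_le1.
have beb : `|be j| <= 2 / `|s2|.
  by rewrite /be normrM normfV ler_wpM2r ?invr_ge0// (le_trans (slope_le _ _))// dirv_le1.
have key (r : R) : `|r| <= 2 / `|s1| + 2 / `|s2| ->
    `|slope (ang k j) (v y) + gap y * r - (slope (ang k j) (v y') + gap y' * r)| <= C * e.
  move=> hr; rewrite opprD addrACA -mulrBl; apply: (le_trans (ler_normD _ _)).
  by rewrite [C * e]mulrDl; apply: lerD => //; rewrite normrM mulrAC; exact: ler_pM.
have z := key 0; rewrite !mulr0 !addr0 normr0 in z.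
by apply: min3_lip; [apply: z; rewrite addr_ge0|apply: key; rewrite (le_trans alb)// lerDl
  |apply: key; rewrite (le_trans beb)// lerDr].
Qed.

Lemma al1 : al j1 = 0. Proof. by rewrite /al slope_dirv mul0r. Qed.
Lemma be2 : be j2 = 0. Proof. by rewrite /be slope_dirv mul0r. Qed.
Lemma al3 : al j3 = 1. Proof. by rewrite /al divff. Qed.
Lemma be3 : be j3 = 1. Proof. by rewrite /be divff. Qed.

Lemma slope_crossing y : slope t1 (v y) = y.1.1 /\ slope t2 (v y) = y.1.2.
Proof. by have [/eqP + /eqP] := side_meet s0 y.1; rewrite !subr_eq0 /= => /eqP -> /eqP ->. Qed.

Lemma minmax_id (x a : R) : Num.min x (Num.min x a) <= x <= Num.max x (Num.max x a) /\
  ~ (Num.min x (Num.min x a) < x < Num.max x (Num.max x a)).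
Proof.
rewrite ge_min le_max lexx; split => //.
rewrite minA maxA minxx maxxx gt_min lt_max ltxx /= => /andP[h1 h2].
by have := lt_trans h1 h2; rewrite ltxx.
Qed.

Lemma lohi1 y : lo j1 y <= y.1.1 <= hi j1 y /\ ~ (lo j1 y < y.1.1 < hi j1 y).
Proof. by rewrite /lo /hi (slope_crossing y).1 al1 mulr0 addr0; exact: minmax_id. Qed.

Lemma lohi2 y : lo j2 y <= y.1.2 <= hi j2 y /\ ~ (lo j2 y < y.1.2 < hi j2 y).
Proof.
rewrite /lo /hi (slope_crossing y).2 be2 mulr0 addr0.
by rewrite (minC _ y.1.2) (maxC _ y.1.2); exact: minmax_id.
Qed.

Lemma lohi3 y : lo j3 y <= y.2 <= hi j3 y /\ ~ (lo j3 y < y.2 < hi j3 y).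
Proof.
rewrite /lo /hi al3 be3 mulr1 /gap addrC subrK minxx maxxx minC maxC.
by have := minmax_id y.2 (slope t3 (v y)); rewrite !minA !maxA minxx maxxx.
Qed.

Definition cap_triples (a b : R) (L : set T) : set (R * R * R) :=
  [set y | [/\ square a b (v y), pts y `<=` L & cap L (v y) u1 u2 (pt j3 y.2)]].

Lemma integral_cap_valid a b : a <= b -> 0 < s1 * s2 ->
  exists H : Omega -> \bar R, [/\ measurable_fun setT H, (forall w, 0 <= H w)%E,
    (\int[P]_w H w = (k%:R^-1 ^+ 2 * (2 / K) * tri_weight k j1 j2 j3 * (b - a) ^+ 2)%:E)%E &
    {ae P, forall w, H w = counting (cap_triples a b (X w))}].
Proof.
(* A gap with the sign of [s1] puts the foot on the first ray and, by [s12], also the foot on the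
   second. *)
move=> ab s12; pose D := [set x | 0 < x * s1]; pose A := region t1 t2 t3 D a b.
have oA : open A by apply: open_region => //; exact: open_side.
have lohi j y : lo j y <= hi j y.
  by rewrite -subr_ge0 hi_lo mulr_ge0// divr_ge0// !addr_ge0.
have [H [mH H0 IH cH]] := integral_void_triples k0 pp jk1 jk2 jk3 j12 j13 j23 C0 oA lohi lip_lohi
  (erefl : xpredT j1) (erefl : xpredT j2) (erefl : xpredT j3) (fun y => (lohi1 y).1)
  (fun y => (lohi2 y).1) (fun y => (lohi3 y).1) (fun y _ => (lohi1 y).2)
  (fun y _ => (lohi2 y).2) (fun y _ => (lohi3 y).2).
exists H; split => //.
  have p12 := sinD_gt0 jk1 jk2 j12; have p13 := sinD_gt0 jk1 jk3 j13.
  have p23 := sinD_gt0 jk2 jk3 j23.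
  have ki0 : 0 < k%:R^-1 :> R by rewrite invr_gt0 ltr0n.
  (* The perimeter of the triangle at unit gap, times K/(2k). *)
  pose r := k%:R^-1 * ((K / sinD k j1 j3 + K / sinD k j2 j3 +
    K * sinD k j1 j2 / (sinD k j1 j3 * sinD k j2 j3)) / 2).
  have r0 : 0 < r.
    have q1 : 0 < K / sinD k j1 j3 by rewrite divr_gt0.
    have q2 : 0 < K / sinD k j2 j3 by rewrite divr_gt0.
    have q3 : 0 < K * sinD k j1 j2 / (sinD k j1 j3 * sinD k j2 j3).
      by rewrite divr_gt0 ?mulr_gt0.
    by rewrite mulr_gt0//; lra.
  have widthE y : width k xpredT lo hi y = r * `|gap y|.
    rewrite /width; under eq_bigr do rewrite hi_lo.
    rewrite -mulr_sumr -mulr_sumr -mulr_suml !big_split /=.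
    by rewrite sum_abs_al sum_abs_be sum_abs_al_be /r; ring.
  rewrite IH (integral_gap s0 (phi := fun x => k%:R^-1 ^+ 3 * expR (- (r * `|x|))) ab).
  - rewrite integral_exp_side ?exprn_ge0 ?ltW// -EFinM; congr _%:E.
    rewrite -/(sinD k j2 j1) sinDC /tri_weight /r; field.
    have kn0 : 0 < k%:R :> R by rewrite ltr0n.
    have n1 := mulr_gt0 K0 p12; have n2 := mulr_gt0 K0 p13; have n3 := mulr_gt0 K0 p23.
    have g1 := addr_gt0 (addr_gt0 p12 p13) p23; have g2 := addr_gt0 (addr_gt0 n3 n2) n1.
    by rewrite !lt0r_neq0.
  - apply: open_measurable; exact: open_side.
  - apply: measurable_funM; first exact: measurable_cst.
    apply: measurableT_comp => //; apply: measurable_funN.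
    apply: measurable_funM; first exact: measurable_cst.
    exact: normr_measurable.
  - by move=> x; rewrite mulr_ge0 ?expR_ge0// exprn_ge0// ltW.
  - by move=> y _; rewrite widthE.
have := ae_good k0 pp; apply: filterS => w good; have lf := good_finite good.
have side_v (y : R * R * R) : side (pt j3 y.2) (v y) = - gap y.
  by rewrite /side /gap /= opprB.
have side_foot1 j x (y : R * R * R) : side (pt j x) (mv (v y) u1 (gap y / s1)) =
    slope (ang k j) (v y) + gap y * al j - x.
  by rewrite side_mv /side /al /=; ring.
have side_foot2 j x (y : R * R * R) : side (pt j x) (mv (v y) u2 (gap y / s2)) =
    slope (ang k j) (v y) + gap y * be j - x.
  by rewrite side_mv /side /be /=; ring.
have n12 x x' : pt j1 x <> pt j2 x' by move=> [/(ang_inj k0)].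
have n13 x x' : pt j1 x <> pt j3 x' by move=> [/(ang_inj k0)].
have n23 x x' : pt j2 x <> pt j3 x' by move=> [/(ang_inj k0)].
rewrite cH//.
  congr counting; apply/seteqP; split => y.
    move=> [[sy gy] yX h]; split => //; split.
    - by apply: yX; right.
    - by rewrite side_v mulNr oppr_lt0.
    - rewrite side_v mulNr oppr_lt0 /=; apply: same_sign gy s12.
    - rewrite side_v opprK => /= m Lm.
      have [j jk mj] := good_angle good Lm.
      have mE : m = pt j m.2 by rewrite /at_angle mj -surjective_pairing.
      rewrite mE side_foot1 side_foot2 /side /= minmax3_shift.
      by apply: h; rewrite // -mE.
  move=> [sy yX [_ h1 _ h2]]; split => //.
    by split => //; move: h1; rewrite side_v mulNr oppr_lt0.
  move=> j x jk _ Lx; have := h2 _ Lx; rewrite side_v opprK /=.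
  by rewrite side_foot1 side_foot2 /side /= minmax3_shift.
move=> y [_ yX void] j x jk _ Xx lxh.
have L1 : X w (pt j1 y.1.1) by apply: yX; left; left.
have L2 : X w (pt j2 y.1.2) by apply: yX; left; right.
have L3 : X w (pt j3 y.2) by apply: yX; right.
have [v1 v2] := side_meet s0 y.1.
have f11 : side (pt j1 y.1.1) (mv (v y) u1 (gap y / s1)) = 0.
  by rewrite side_foot1 al1 (slope_crossing y).1 mulr0 addr0 subrr.
have f22 : side (pt j2 y.1.2) (mv (v y) u2 (gap y / s2)) = 0.
  by rewrite side_foot2 be2 (slope_crossing y).2 mulr0 addr0 subrr.
have f13 : side (pt j3 y.2) (mv (v y) u1 (gap y / s1)) = 0.
  by rewrite side_foot1 al3 mulr1 /gap; ring.
have f23 : side (pt j3 y.2) (mv (v y) u2 (gap y / s2)) = 0.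
  by rewrite side_foot2 be3 mulr1 /gap; ring.
have [xE|xE|xE] := minmax3_eq lxh (void j x jk (erefl _) Xx).
- have xv : side (pt j x) (v y) = 0 by rewrite /side /= xE subrr.
  by have [->|->] := crossing_only good L1 L2 Xx (@n12 _ _) v1 v2 xv; [left; left|left; right].
- have xv : side (pt j x) (mv (v y) u1 (gap y / s1)) = 0 by rewrite side_foot1 xE subrr.
  by have [->|->] := crossing_only good L1 L3 Xx (@n13 _ _) f11 f13 xv; [left; left|right].
- have xv : side (pt j x) (mv (v y) u2 (gap y / s2)) = 0 by rewrite side_foot2 xE subrr.
  by have [->|->] := crossing_only good L2 L3 Xx (@n23 _ _) f22 f23 xv; [left; right|right].
Qed.

(** Without [valid] the two sign conditions in [cap] contradict each other, and the count is 0. *)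
Lemma integral_cap a b : a <= b ->
  exists H : Omega -> \bar R, [/\ measurable_fun setT H, (forall w, 0 <= H w)%E,
    (\int[P]_w H w = (k%:R^-1 ^+ 2 * (2 / K) * tri_weight k j1 j2 j3 * (b - a) ^+ 2 *
      (valid t1 t2 t3)%:R)%:E)%E &
    {ae P, forall w, H w = counting (cap_triples a b (X w))}].
Proof.
move=> ab; have [s12|s12] := boolP (valid t1 t2 t3); first by rewrite mulr1; exact: integral_cap_valid.
exists (cst 0%E); split => //; first by rewrite integral0 mulr0.
apply: aeW => w; rewrite [RHS](_ : _ = 0%E)//; apply/counting_eq0.
apply/seteqP; split => // y [_ _ [_ h1 h2 _]]; move: s12; rewrite /valid -/s1 -/s2 => /negP; apply.
apply: (@same_sign _ s1 (- side (pt j3 y.2) (v y))); last by rewrite mulNr oppr_gt0.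
by rewrite mulrN oppr_gt0 mulrC.
Qed.

End Caps.

(** * Cells and triples of lines *)

Section CountingLemmas.
Context {R : realType}.
Local Open Scope ereal_scope.

Lemma counting_le (T : choiceType) (A B : set T) : A `<=` B ->
  counting A <= counting B :> \bar R.
Proof.
move=> AB; rewrite !counting_esum esum_mkcond [leRHS]esum_mkcond.
by apply: le_esum => i _; case: ifPn => [/set_mem/AB/mem_set ->//|_]; case: ifP.
Qed.

Lemma counting_inj_image (T T' : choiceType) (A : set T) (f : T -> T') :
  {in A &, injective f} -> counting (f @` A) = counting A :> \bar R.
Proof.
move=> injf; rewrite !counting_esum (reindex_esum A (f @` A) f)//.
exact: inj_bij.
Qed.

Lemma counting_bigcup_ord (T : pointedType) (n : nat) (F : nat -> set T) :
  trivIset `I_n F ->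
  counting (\bigcup_(i in `I_n) F i) = \sum_(i < n) counting (F i) :> \bar R.
Proof. move=> tF; rewrite counting_fin_bigcup//; exact/esym/fsbig_ord. Qed.

Lemma esum_indic_counting (T T' : choiceType) (A : set T) (B : set T') (f : T -> T') :
  \esum_(c in A) (\1_B (f c))%:E = counting (A `&` f @^-1` B) :> \bar R.
Proof.
rewrite counting_esum esum_mkcondr; apply: eq_esum => c _; rewrite indicE.
by rewrite -[f c \in B]/(c \in f @^-1` B); case: ifP.
Qed.

End CountingLemmas.

(** * Matching cells with triples of lines *)

Section CellCounting.
Context {R : realType}.
Variable k : nat.
Hypothesis k1 : (1 < k)%N.
Let k0 : (0 < k)%N. Proof. exact: ltnW. Qed.
Variable L : set (R * R).
Hypothesis goodL : good_lines (angles k) L.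
Local Notation pt := (at_angle (R := R) k).
Local Notation ang := (ang (R := R) k).
Local Notation sin_angles := (sin_angles (R := R) (k := k)).
Local Notation two_angles := (two_angles (R := R) k1).

Lemma ang_lt i j : (ang i < ang j) = (i < j)%N.
Proof.
rewrite /ang -!mulrA ltr_pM2r ?ltr_nat// divr_gt0 ?pi_gt0 ?ltr0n//.
Qed.

Lemma lexmin_uniq (c : set (R * R)) v v' : lexmin_vertex c v -> lexmin_vertex c v' -> v = v'.
Proof.
move=> [cv hv] [cv' hv']; rewrite [v]surjective_pairing [v']surjective_pairing.
have [h|[e h]] := hv _ cv'; have [h'|[e' h']] := hv' _ cv.
- by have := lt_trans h h'; rewrite ltxx.
- by move: h; rewrite e' ltxx.
- by move: h'; rewrite e ltxx.
- by rewrite e; congr (_, _); apply/eqP; rewrite eq_le h h'.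
Qed.

Definition cells_at (V : set (R * R * R)) i j : set (set (R * R)) :=
  [set c | cells L c /\ exists2 y, V y & lexmin_vertex c (meet (ang i) (ang j) y.1)].

(** Existence and uniqueness of the cell with a given smallest vertex make y to cell a well-defined
    map. It is injective because the crossing recovers the coordinates of the first two lines, which
    by assumption determine the triple. *)
Lemma count_cells_at (V : set (R * R * R)) i j : (i < k)%N -> (j < k)%N -> i <> j ->
  (forall y, V y -> L (pt i y.1.1) /\ L (pt j y.1.2)) ->
  (forall y y', V y -> V y' -> y.1 = y'.1 -> y = y') ->
  counting (cells_at V i j) = counting V :> \bar R.
Proof.
move=> ik jk ij VL Vinj.
have s0 : sin (ang j - ang i) != 0 by apply: sin_ang_neq0 => //; exact/nesym.
have ex y : V y -> exists2 c, cells L c & lexmin_vertex c (meet (ang i) (ang j) y.1).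
  move=> Vy; have [L1 L2] := VL _ Vy; have [v1 v2] := side_meet s0 y.1.
  have n12 : (pt i y.1.1).1 <> (pt j y.1.2).1 by move=> /(ang_inj k0).
  exact: (lexmin_cell_exists sin_angles goodL L1 L2 n12 v1 v2).
pose f (y : R * R * R) := xget set0 [set c | cells L c /\ lexmin_vertex c (meet (ang i) (ang j) y.1)].
have fP y : V y -> cells L (f y) /\ lexmin_vertex (f y) (meet (ang i) (ang j) y.1).
  by move=> Vy; rewrite /f; case: xgetP => [c -> //|h]; have [c c1 c2] := ex y Vy; case: (h c).
rewrite -(counting_inj_image (A := V) (f := f)).
  congr counting; apply/seteqP; split => c.
    move=> [Lc [y Vy cy]]; exists y => //; have [fy1 fy2] := fP y Vy.
    exact: (lexmin_cell_uniq sin_angles two_angles goodL fy1 Lc fy2 cy).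
  by move=> [y Vy <-]; have [fy1 fy2] := fP y Vy; split => //; exists y.
move=> y y' /set_mem Vy /set_mem Vy' ff; apply: Vinj => //.
have [_ fy] := fP y Vy; have [_] := fP y' Vy'; rewrite -ff => /(lexmin_uniq fy) e.
have [a1 a2] := side_meet s0 y.1; have [b1 b2] := side_meet s0 y'.1.
move: a1 a2 b1 b2; rewrite e /side /= => a1 a2 b1 b2.
by rewrite [LHS]surjective_pairing [RHS]surjective_pairing; congr (_, _); lra.
Qed.

(** By simplicity a crossing lies on only two lines; ordering their indices removes the remaining
    ambiguity. *)
Lemma cells_at_angles (V V' : set (R * R * R)) i j i' j' c : (j < k)%N -> (j' < k)%N ->
  (i < j)%N -> (i' < j')%N ->
  (forall y, V y -> L (pt i y.1.1) /\ L (pt j y.1.2)) ->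
  (forall y, V' y -> L (pt i' y.1.1) /\ L (pt j' y.1.2)) ->
  cells_at V i j c -> cells_at V' i' j' c -> i = i' /\ j = j'.
Proof.
move=> jk jk' ij ij' VL VL' [_ [y Vy cy]] [_ [y' Vy' cy']].
have e := lexmin_uniq cy cy'.
have [L1 L2] := VL _ Vy; have [L1' L2'] := VL' _ Vy'.
have s0 : sin (ang j - ang i) != 0 by apply: sin_ang_neq0 => //; lia.
have s0' : sin (ang j' - ang i') != 0 by apply: sin_ang_neq0 => //; lia.
have [a1 a2] := side_meet s0 y.1; have [b1 b2] := side_meet s0' y'.1.
rewrite -e in b1 b2.
have n12 : pt i y.1.1 <> pt j y.1.2 by move=> [/(ang_inj k0)]; lia.
have c1 := crossing_only goodL L1 L2 L1' n12 a1 a2 b1.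
have c2 := crossing_only goodL L1 L2 L2' n12 a1 a2 b2.
case: c1 => -[/(ang_inj k0) e1 _]; case: c2 => -[/(ang_inj k0) e2 _]; lia.
Qed.

Lemma finite_min (T : choiceType) (A : set T) (g : T -> R) : finite_set A -> A !=set0 ->
  exists2 x, A x & forall y, A y -> g x <= g y.
Proof.
move=> /finite_seqP[s ->]; elim: s => [[x]|a s IH _]; first by rewrite /= in_nil.
have [|ne] := eqVneq s [::].
  by move=> ->; exists a; rewrite /= ?mem_head// => y; rewrite /= mem_seq1 => /eqP ->.
have [x xs xm] : exists2 x, x \in s & forall y, y \in s -> g x <= g y.
  by apply: IH; case: s ne => // b s _; exists b; rewrite /= mem_head.
have [ax|xa] := leP (g a) (g x).
  exists a; rewrite /= ?mem_head// => y /predU1P[->//|ys].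
  by rewrite (le_trans ax)// xm.
exists x; rewrite /= ?in_cons ?xs ?orbT// => y /predU1P[->|ys]; first exact: ltW.
exact: xm.
Qed.

(** Some line lies beyond [M] by unboundedness, and local finiteness leaves finitely many candidates
    up to it. *)
Lemma first_line j (M : R) : (j < k)%N -> exists x, [/\ L (pt j x), M < x &
  forall x', L (pt j x') -> ~ (M < x' < x)].
Proof.
move=> jk; have [] := good_unbounded goodL M (_ : angles k (ang j)); first by exists j.
move=> [l [Ll lj Ml]] _.
pose A := [set x | L (pt j x) /\ M < x <= l.2].
have lE : l = pt j l.2 by rewrite /at_angle -lj -surjective_pairing.
have [||x [Lx /andP[Mx xl]] xm] := @finite_min _ A id.
- have := good_finite goodL (`|M| + `|l.2|) => /(finite_image snd); apply: sub_finite_set => x.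
  move=> [Lx /andP[Mx xl]]; exists (pt j x) => //; split => //=.
  have := ler_norm (- M); have := ler_norm l.2; have := normr_ge0 M; have := normr_ge0 l.2.
  by rewrite normrN ler_norml => *; apply/andP; split; lra.
- by exists l.2; split; rewrite -?lE// Ml /=.
exists x; split => // x' Lx' /andP[Mx' xx'].
have : x <= x' by apply: xm; split => //; rewrite Mx' (ltW (lt_le_trans xx' xl)).
by rewrite leNgt xx'.
Qed.

Definition first_triples (a b : R) i j l : set (R * R * R) :=
  [set y : R * R * R |
     let v := meet (ang i) (ang j) y.1 in
     [/\ square a b v, three_pts (pt i) (pt j) (pt l) y `<=` L,
       slope (ang l) v < y.2 &
       forall x, L (pt l x) -> ~ (slope (ang l) v < x < y.2)]].

Definition cells_in (S : set (R * R)) : set (set (R * R)) :=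
  [set c | cells L c /\ exists2 v, lexmin_vertex c v & S v].

Lemma count_first_triples a b i j l : (i < k)%N -> (j < k)%N -> i <> j ->
  counting (cells_at (first_triples a b i j l) i j) = counting (first_triples a b i j l) :> \bar R.
Proof.
move=> ik jk ij; apply: count_cells_at => // [y [_ yL _ _]|y y' [_ yL yv h] [_ yL' yv' h'] e].
  by split; apply: yL; left; [left|right].
rewrite [LHS]surjective_pairing [RHS]surjective_pairing e; congr (_, _).
have L3 : L (pt l y.2) by apply: yL; right.
have L3' : L (pt l y'.2) by apply: yL'; right.
have := h _ L3'; have := h' _ L3; rewrite e in yv * => n1 n2.
by have [h3|h3|//] := ltgtP y.2 y'.2; [case: n1|case: n2]; apply/andP.
Qed.

Lemma cell_crossing c : cells L c -> forall v, lexmin_vertex c v -> exists i j,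
  [/\ (i < j)%N, (j < k)%N & exists d1 d2, [/\ L (pt i d1), L (pt j d2) &
    v = meet (ang i) (ang j) (d1, d2)]].
Proof.
rewrite cellsE => -[p offp <-] v cv.
have [l1 [l2 [L1 L2 a12 v1 v2]]] := vertex_crossing goodL offp cv.1.
have [i ik e1] := good_angle goodL L1; have [j jk e2] := good_angle goodL L2.
exists i, j; split => //; first by rewrite -ang_lt e1 e2.
exists l1.2, l2.2; rewrite /at_angle e1 e2 -!surjective_pairing; split => //.
apply: meet_uniq; rewrite -?surjective_pairing//.
apply: sin_angles; [by exists i|by exists j|].
by move=> e; rewrite e ltxx in a12.
Qed.

Variable third : nat -> nat -> nat.
Hypothesis third_lt : forall i j, (third i j < k)%N.

Lemma count_cells a b : counting (cells_in (square a b)) =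
  (\sum_(i < k) \sum_(j < k) if (i < j)%N then counting (first_triples a b i j (third i j)) else 0)%E
  :> \bar R.
Proof.
pose F i j := if (i < j)%N then cells_at (first_triples a b i j (third i j)) i j else set0.
have FL i j y : first_triples a b i j (third i j) y -> L (pt i y.1.1) /\ L (pt j y.1.2).
  by move=> [_ yL _ _]; split; apply: yL; left; [left|right].
have Funiq i j i' j' c : (j < k)%N -> (j' < k)%N -> F i j c -> F i' j' c -> i = i' /\ j = j'.
  rewrite /F; case: ifP => // ij; case: ifP => // ij' jk jk'.
  by apply: cells_at_angles => //; exact: FL.
have -> : cells_in (square a b) = \bigcup_(i in `I_k) \bigcup_(j in `I_k) F i j.
  apply/seteqP; split => c.
    move=> [Lc [v cv vS]]; have [i [j [ij jk [d1 [d2 [L1 L2 vE]]]]]] := cell_crossing Lc cv.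
    have ik : (i < k)%N by exact: ltn_trans jk.
    exists i => //; exists j => //; rewrite /F ij; split => //.
    have [x [Lx vx xm]] := first_line (slope (ang (third i j)) v) (third_lt i j).
    exists (d1, d2, x); rewrite /= -?vE//; split => //=; rewrite -?vE//.
    by move=> m [[]|] -> /=.
  move=> [i ik [j jk]]; rewrite /F; case: ifP => // ij [Lc [y [yS _ _ _] cy]]; split => //.
  by exists (meet (ang i) (ang j) y.1).
rewrite counting_bigcup_ord; last first.
  move=> i i' ik ik' [c [[j jk cj] [j' jk' cj']]].
  by have [] := Funiq i j i' j' c jk jk' cj cj'.
apply: eq_bigr => i _; rewrite counting_bigcup_ord; last first.
  by move=> j j' jk jk' [c [cj cj']]; have [] := Funiq i j i j' c jk jk' cj cj'.
apply: eq_bigr => j _; rewrite /F; case: ifP => ij; last exact: counting0.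
by apply: count_first_triples => //; lia.
Qed.

Lemma count_triangles a b : counting (cells_in (square a b) `&` [set c | triangle (centered c)]) =
  (\sum_(i < k) \sum_(j < k) \sum_(l < k) if [&& (i < j)%N, i != l & j != l] then
     counting (cap_triples k i j l a b L) else 0)%E
  :> \bar R.
Proof.
pose F i j l := if [&& (i < j)%N, i != l & j != l] then cells_at (cap_triples k i j l a b L) i j else set0.
have FL i j l y : cap_triples k i j l a b L y -> L (pt i y.1.1) /\ L (pt j y.1.2).
  by move=> [_ yL _]; split; apply: yL; left; [left|right].
have Funiq i j l i' j' l' c : (j < k)%N -> (j' < k)%N -> F i j l c -> F i' j' l' c ->
    [/\ i = i', j = j' & l = l'].
  rewrite /F; case: ifP => // /and3P[ij _ _]; case: ifP => // /and3P[ij' _ _] jk jk' ct ct'.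
  have [e1 e2] := cells_at_angles jk jk' ij ij' (FL _ _ _) (FL _ _ _) ct ct'; subst i' j'.
  split => //; move: ct ct' => [_ [y [_ yL cy] lv]] [_ [y' [_ yL' cy'] lv']].
  have e := lexmin_uniq lv lv'.
  have s0 : sin (ang j - ang i) != 0 by apply: sin_ang_neq0 => //; lia.
  have [v1 _] := side_meet s0 y.1.
  have L1 : L (pt i y.1.1) by apply: yL; left; left.
  rewrite -e in cy'.
  by have [/(ang_inj k0)] := cap_uniq goodL L1 v1 cy cy'.
have -> : cells_in (square a b) `&` [set c | triangle (centered c)] =
    \bigcup_(i in `I_k) \bigcup_(j in `I_k) \bigcup_(l in `I_k) F i j l.
  apply/seteqP; split => c.
    move=> [[Lc [v cv vS]] ct].
    have [i [j [ij jk [d1 [d2 [L1 L2 vE]]]]]] := cell_crossing Lc cv.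
    have ik : (i < k)%N by exact: ltn_trans jk.
    have s0 : sin (ang j - ang i) != 0 by apply: sin_ang_neq0 => //; lia.
    have [v1 v2] := side_meet s0 (d1, d2); rewrite -vE in v1 v2.
    have n12 : pt i d1 <> pt j d2 by move=> [/(ang_inj k0)]; lia.
    move: (Lc); rewrite cellsE => -[p offp pE]; rewrite -pE in cv ct.
    have [/(_ ct)[l3 cap3] _] := triangle_cap sin_angles two_angles goodL offp cv L1 L2 n12 v1 v2.
    have [L3 h1 h2 _] := cap3; have [l lk e3] := good_angle goodL L3.
    have l3E : l3 = pt l l3.2 by rewrite /at_angle e3 -surjective_pairing.
    exists i => //; exists j => //; exists l => //; rewrite /F ij ifT; last first.
      apply/and3P; split => //; apply/eqP => e; [move: h1|move: h2];
      by rewrite -e3 -e /= slope_dirv mulr0 ltxx.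
    split => //; exists (d1, d2, l3.2); rewrite /= -?vE -?pE//; split; rewrite /= -?vE// -?l3E//.
    by move=> m [[]|] -> //=; rewrite -l3E.
  move=> [i ik [j jk [l lk]]]; rewrite /F; case: ifP => // /and3P[ij il jl].
  move=> [Lc [y [yS yL cy] lv]]; split; first by split => //; exists (meet (ang i) (ang j) y.1).
  move: (Lc) lv; rewrite cellsE => -[p offp <-] lv /=.
  have s0 : sin (ang j - ang i) != 0 by apply: sin_ang_neq0 => //; lia.
  have [v1 v2] := side_meet s0 y.1.
  have L1 : L (pt i y.1.1) by apply: yL; left; left.
  have L2 : L (pt j y.1.2) by apply: yL; left; right.
  have n12 : pt i y.1.1 <> pt j y.1.2 by move=> [/(ang_inj k0)]; lia.
  apply/(triangle_cap sin_angles two_angles goodL offp lv L1 L2 n12 v1 v2).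
  by exists (pt l y.2).
rewrite counting_bigcup_ord; last first.
  move=> i i' ik ik' [c [[j jk [l lk cj]] [j' jk' [l' lk' cj']]]].
  by have [] := Funiq i j l i' j' l' c jk jk' cj cj'.
apply: eq_bigr => i _; rewrite counting_bigcup_ord; last first.
  move=> j j' jk jk' [c [[l lk cj] [l' lk' cj']]].
  by have [] := Funiq i j l i j' l' c jk jk' cj cj'.
apply: eq_bigr => j _; rewrite counting_bigcup_ord; last first.
  by move=> l l' lk lk' [c [cj cj']]; have [] := Funiq i j l i j l' c (ltn_ord j) (ltn_ord j) cj cj'.
apply: eq_bigr => l _; rewrite /F; case: ifP => [/and3P[ij il jl]|]; last by rewrite counting0.
apply: count_cells_at => //; first lia.
  exact: FL.
move=> y y' [_ yL cy] [_ yL' cy'] e.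
rewrite [LHS]surjective_pairing [RHS]surjective_pairing e; congr (_, _).
have s0 : sin (ang j - ang i) != 0 by apply: sin_ang_neq0 => //; lia.
have [v1 _] := side_meet s0 y.1.
have L1 : L (pt i y.1.1) by apply: yL; left; left.
rewrite -e in cy'.
by have [] := cap_uniq goodL L1 v1 cy cy'.
Qed.

End CellCounting.

(** * Expectations *)

Section TrigSums.
Context {R : realType}.
Variable k : nat.
Hypothesis k2 : (2 < k)%N.
Let k0 : (0 < k)%N. Proof. exact: ltn_trans k2. Qed.
Local Notation ang := (ang (R := R) k).
Local Notation sinD := (sinD (R := R) k).
Local Notation tw := (tri_weight (R := R) k).
Local Notation vl := (fun a b c : nat => (valid (ang a) (ang b) (ang c))%:R : R).

Lemma sum_lt_half (F : nat -> nat -> R) : (forall i j, F i j = F j i) -> (forall i, F i i = 0) ->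
  \sum_(i < k) \sum_(j < k) (if (i < j)%N then F i j else 0) = (\sum_(i < k) \sum_(j < k) F i j) / 2.
Proof.
move=> Fs F0; pose S := \sum_(i < k) \sum_(j < k) (if (i < j)%N then F i j else 0).
have e : S = \sum_(i < k) \sum_(j < k) (if (j < i)%N then F i j else 0).
  rewrite /S exchange_big; apply: eq_bigr => i _; apply: eq_bigr => j _.
  by rewrite Fs.
suff -> : \sum_(i < k) \sum_(j < k) F i j = S + S by rewrite -/S; field.
rewrite {2}e /S -big_split; apply: eq_bigr => i _; rewrite -big_split; apply: eq_bigr => j _ /=.
by case: ltngtP => [_|_|/val_inj ->]; rewrite ?addr0 ?add0r.
Qed.

Lemma sum_sinD_lt : \sum_(i < k) \sum_(j < k) (if (i < j)%N then sinD i j else 0) =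
  k%:R * (\sum_(m < k) sin (ang m)) / 2.
Proof.
rewrite sum_lt_half; [|exact: sinDC|exact: sinDaa].
congr (_ / 2); under eq_bigr do rewrite (sum_abs_sin k0).
by rewrite sumr_const card_ord mulr_natl.
Qed.

Lemma sum_rot (G : nat -> nat -> nat -> R) :
  \sum_(i < k) \sum_(j < k) \sum_(l < k) G i j l =
  \sum_(i < k) \sum_(j < k) \sum_(l < k) G j l i.
Proof. by rewrite [RHS]exchange_big; apply: eq_bigr => j _; rewrite exchange_big. Qed.

(** The weight is invariant under rotating the three indices, so [valid] may be averaged over the
    rotations, and [valid_count] makes this average 2/3. Repeated indices have weight 0. *)
Lemma sum_tri_weight_valid :
  \sum_(i < k) \sum_(j < k) \sum_(l < k) tw i j l * vl i j l =
  2 / 3 * \sum_(i < k) \sum_(j < k) \sum_(l < k) tw i j l.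
Proof.
pose S := \sum_(i < k) \sum_(j < k) \sum_(l < k) tw i j l * vl i j l.
have twr i j l : tw j l i = tw i j l by rewrite tri_weight23 tri_weight12.
have e1 : S = \sum_(i < k) \sum_(j < k) \sum_(l < k) tw i j l * vl j l i.
  rewrite /S (sum_rot (fun i j l => tw i j l * vl i j l)); do 3 (apply: eq_bigr => ? _).
  by rewrite twr.
have e2 : S = \sum_(i < k) \sum_(j < k) \sum_(l < k) tw i j l * vl l i j.
  rewrite e1 (sum_rot (fun i j l => tw i j l * vl j l i)); do 3 (apply: eq_bigr => ? _).
  by rewrite twr.
have : S + S + S = 2 * \sum_(i < k) \sum_(j < k) \sum_(l < k) tw i j l.
  rewrite {2}e1 {2}e2 /S -!big_split mulr_sumr; apply: eq_bigr => i _ /=.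
  rewrite -!big_split mulr_sumr; apply: eq_bigr => j _ /=.
  rewrite -!big_split mulr_sumr; apply: eq_bigr => l _ /=.
  rewrite -!mulrDr mulrC.
  have [e|ij] := eqVneq i j; first by subst j; rewrite tri_weightaa !mulr0.
  have [e|il] := eqVneq i l; first by subst l; rewrite tri_weight23 tri_weightaa !mulr0.
  have [e|jl] := eqVneq j l; first by subst l; rewrite tri_weight_bb !mulr0.
  rewrite -!natrD valid_count//; by rewrite -normr_gt0 abs_slope_ang sinD_gt0//; apply/eqP; rewrite // eq_sym.
by rewrite -/S; lra.
Qed.

(** The restriction i < j halves the previous sum, since weight and [valid] are symmetric in the
    first two directions. *)
Lemma sum_tri_weight_lt :
  \sum_(i < k) \sum_(j < k) \sum_(l < k)
    (if [&& (i < j)%N, i != l & j != l] then tw i j l * vl i j l else 0) =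
  (\sum_(i < k) \sum_(j < k) \sum_(l < k) tw i j l) / 3.
Proof.
transitivity (\sum_(i < k) \sum_(j < k) (if (i < j)%N then \sum_(l < k) tw i j l * vl i j l else 0)).
  apply: eq_bigr => i _; apply: eq_bigr => j _; case: ifPn => ij; last first.
    exact: big1.
  apply: eq_bigr => l _ /=.
  have [e|il] := eqVneq i l; first by subst l; rewrite tri_weight23 tri_weightaa !mul0r.
  have [e|jl] := eqVneq j l; first by subst l; rewrite tri_weight_bb !mul0r.
  by [].
rewrite (sum_lt_half (F := fun i j => \sum_(l < k) tw i j l * vl i j l)).
- by rewrite sum_tri_weight_valid; field.
- move=> i j; apply: eq_bigr => l _; rewrite tri_weight12; congr (_ * _%:R).
  by rewrite /valid mulrC.
- by move=> i; apply: big1 => l _; rewrite tri_weightaa mul0r.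
Qed.

End TrigSums.

(** * From counts in open squares to the unit square *)

Section Expectation.
Context {R : realType} {d : measure_display} {Omega : measurableType d}.
Variable P : probability Omega R.

(** A mean is attributed to [f] through an almost surely equal measurable function, because a cell
    count is controlled only on regular samples. *)
Definition has_mean (f : Omega -> \bar R) (e : R) :=
  exists H : Omega -> \bar R, [/\ measurable_fun setT H, (forall w, 0 <= H w)%E,
    (\int[P]_w H w = e%:E)%E & {ae P, forall w, H w = f w}].

Lemma has_mean0 : has_mean (cst 0%E) 0.
Proof. by exists (cst 0%E); split => //; [rewrite integral0|exact: aeW]. Qed.

Lemma has_mean_sum (I : finType) (f : I -> Omega -> \bar R) (e : I -> R) :
  (forall i, has_mean (f i) (e i)) ->
  has_mean (fun w => \sum_i f i w)%E (\sum_i e i).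
Proof.
move=> h; pose H i := projT1 (cid (h i)).
have HP i : [/\ measurable_fun setT (H i), (forall w, 0 <= H i w)%E,
    (\int[P]_w H i w = (e i)%:E)%E & {ae P, forall w, H i w = f i w}].
  by rewrite /H; case: cid.
exists (fun w => \sum_i H i w)%E; split.
- by apply: emeasurable_sum => i; have [] := HP i.
- by move=> w; apply: sume_ge0 => i _; have [] := HP i.
- rewrite ge0_integral_sum//; last 2 first.
  + by move=> i; have [] := HP i.
  + by move=> i w _; have [] := HP i.
  by rewrite -sumEFin; apply: eq_bigr => i _; have [] := HP i.
- have : {ae P, forall w, forall i, H i w = f i w}.
    by apply: filter_forall => i; have [] := HP i.
  by apply: filterS => w Hf; apply: eq_bigr.
Qed.

Variables (X : Omega -> set (R * R)).

Lemma expected_cells_mean (A : set (set (R * R))) (c : R) : 0 <= c ->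
  (forall a b, a <= b -> has_mean (fun w =>
    counting (cells_in (X w) (square a b) `&` [set q | A (centered q)])) (c * (b - a) ^+ 2)) ->
  expected_cells P X A = c%:E.
Proof.
move=> c0 mean.
pose N w : \bar R := counting (unit_cells (X w) `&` [set q | A (centered q)]).
have -> : expected_cells P X A = (\int[P]_w N w)%E.
  by apply: eq_integral => w _; exact: esum_indic_counting.
have N0 w : (0 <= N w)%E by rewrite -[0%E](@counting0 R (set (R * R))) counting_le.
have [|F [mF F0 IF aF]] := mean 0 1; first exact: ler01.
rewrite subr0 expr1n mulr1 in IF.
have bounds (e : R) : 0 < e -> (c%:E <= \int[P]_w N w)%E /\
    (\int[P]_w N w <= (c * (1 + e - - e) ^+ 2)%:E)%E.
  move=> e0; have [|G [mG G0 IG aG]] := mean (- e) (1 + e); first by lra.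
  rewrite -IF -IG; apply: integral_sandwich => //.
  apply: filterS2 aF aG => w -> ->; split; apply: counting_le => q [[Lq [v vq vS]] Aq];
    split => //; split => //; exists v => //.
    by move: vS => [/= /andP[? ?] /andP[? ?]]; split; rewrite /= in_itv /= !ltW.
  by move: vS => [/=]; rewrite !in_itv /= => /andP[? ?] /andP[? ?]; split;
    rewrite /= in_itv /=; apply/andP; split; lra.
apply/eqP; rewrite eq_le; apply/andP; split; last by have [] := bounds _ ltr01.
apply/lee_addgt0Pr => e e0.
(* For r at most 1, (1 + 2r)^2 is at most 1 + 8r; the added 1 keeps the divisor positive when c =
   0. *)
have c1 : 0 < 8 * c + 1 by lra.
pose r := Num.min 1 (e / (8 * c + 1)).
have r0 : 0 < r by rewrite lt_min ltr01 divr_gt0.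
apply: (le_trans (bounds r r0).2); rewrite -EFinD lee_fin.
have r1 : r <= 1 by rewrite ge_min lexx.
have re : r * (8 * c + 1) <= e by rewrite -ler_pdivlMr// ge_min lexx orbT.
have rr : r * r <= r by rewrite ger_pMr.
have crr : c * (r * r) <= c * r by rewrite ler_wpM2l.
rewrite (_ : c * _ = c + 4 * (c * r) + 4 * (c * (r * r))); last by ring.
by lra.
Qed.

End Expectation.

Theorem theorem2 (R : realType) (d : measure_display)
    (Omega : measurableType d) (P : probability Omega R) (k : nat)
    (X : Omega -> set (measurableTypeR R * measurableTypeR R)) :
  (3 <= k)%N ->
  poisson_line_process P 1%:pos (equiangular k) X ->
  triangle_probability P X =
    (4 / k%:R * tan (pi / (2 * k%:R)) ^+ 2 *
     \sum_(1 <= i < k.-1)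
       ((k - i)%:R *
        \sum_(1 <= j < k - i)
          (sin (i%:R * pi / k%:R) * sin (j%:R * pi / k%:R) *
             sin ((i + j)%:R * pi / k%:R) /
           (sin (i%:R * pi / k%:R) + sin (j%:R * pi / k%:R) +
              sin ((i + j)%:R * pi / k%:R)))))%:E.
Proof.
move=> k2 [_ pp0].
have k1 : (1 < k)%N by exact: ltn_trans k2.
have k0 : (0 < k)%N by exact: ltn_trans k1.
have pp : poisson_process P (@line_measure R k) X.
  move: pp0; rewrite (_ : (fun B => _) = line_measure k :> (set _ -> \bar R))//.
  by apply/funext => B; rewrite mul1e.
set W := \sum_(1 <= i < k.-1) _.
pose K : R := \sum_(m < k) sin (ang k m).
have Kt : K * tan (pi / (2 * k%:R)) = 1 by exact: sum_sin.
have K0 : 0 < K.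
  rewrite lt_neqAle eq_sym; apply/andP; split.
    by apply/eqP => e; move: Kt; rewrite e mul0r => /esym/eqP; rewrite oner_eq0.
  by apply: sumr_ge0 => m _; rewrite sin_ang_ge0// ltnW.
have kn0 : 0 < k%:R :> R by rewrite ltr0n.
have W0 : 3 * W = \sum_(a < k) \sum_(b < k) \sum_(c < k) tri_weight k a b c by rewrite sum_tri_weight.
have Wge0 : 0 <= W.
  suff : 0 <= 3 * W by lra.
  rewrite W0; do 3 (apply: sumr_ge0 => ? _).
  by rewrite /tri_weight /sinD divr_ge0// ?mulr_ge0// !addr_ge0.
(* The least of 0, 1, 2 different from both i and j; it is a direction because k is at least 3. *)
pose third (i j : nat) : nat := if (0 < i)%N && (0 < j)%N then 0%N
  else if (i != 1)%N && (j != 1)%N then 1%N else 2%N.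
have thirdP i j : [/\ (third i j < k)%N, i <> third i j & j <> third i j].
  by rewrite /third; case: i j => [|[|i]] [|[|j]].
have Eall : expected_cells P X setT = (k%:R^-1 ^+ 2 * (k%:R * K / 2))%:E.
  apply: expected_cells_mean; first by rewrite mulr_ge0 ?exprn_ge0 ?invr_ge0 ?ltW// divr_gt0 ?mulr_gt0.
  move=> a b ab.
  have mean : has_mean P (fun w => \sum_(i < k) \sum_(j < k)
      if (i < j)%N then counting (first_triples k (X w) a b i j (third i j)) else 0)%E
      (\sum_(i < k) \sum_(j < k) if (i < j)%N then k%:R^-1 ^+ 2 * sinD k i j * (b - a) ^+ 2 else 0).
    apply: has_mean_sum => i; apply: has_mean_sum => j.
    case: ifPn => ij; last exact: has_mean0.
    have [t1 t2 t3] := thirdP i j.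
    by apply: integral_first_line => //; lia.
  move: mean => [H [mH H0 IH aH]]; exists H; split => //.
    rewrite IH; congr _%:E; rewrite -sum_sinD_lt// mulrAC.
    rewrite mulr_sumr; apply: eq_bigr => i _; rewrite mulr_sumr; apply: eq_bigr => j _.
    by case: ifP => _; rewrite ?mulr0//; ring.
  apply: filterS2 aH (ae_good k0 pp) => w -> good; rewrite setIT.
  by rewrite (count_cells k1 good (third := third))// => i j; have [] := thirdP i j.
have Etri : expected_cells P X [set c | triangle c] = (k%:R^-1 ^+ 2 * (2 / K * W))%:E.
  apply: expected_cells_mean.
    have h : 0 <= 2 / K by rewrite divr_ge0// ltW.
    by rewrite mulr_ge0 ?exprn_ge0 ?invr_ge0//; exact: mulr_ge0.
  move=> a b ab.
  have mean : has_mean P (fun w => \sum_(i < k) \sum_(j < k) \sum_(l < k)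
      if [&& (i < j)%N, i != l & j != l] then counting (cap_triples k i j l a b (X w)) else 0)%E
      (\sum_(i < k) \sum_(j < k) \sum_(l < k) if [&& (i < j)%N, i != l & j != l] then
        k%:R^-1 ^+ 2 * (2 / K) * tri_weight k i j l * (b - a) ^+ 2 *
        (valid (ang k i : R) (ang k j) (ang k l))%:R else 0).
    apply: has_mean_sum => i; apply: has_mean_sum => j; apply: has_mean_sum => l.
    case: ifPn => [/and3P[ij /eqP il /eqP jl]|_]; last exact: has_mean0.
    by apply: integral_cap => // e; [lia|apply: il; apply: val_inj|apply: jl; apply: val_inj].
  move: mean => [H [mH H0 IH aH]]; exists H; split => //.
    rewrite IH; congr _%:E.
    (* The factor 3 of [sum_tri_weight] cancels the third left by [sum_tri_weight_lt]. *)
    have -> : W = (\sum_(i < k) \sum_(j < k) \sum_(l < k) tri_weight k i j l) / 3 by rewrite -W0; field.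
    rewrite -sum_tri_weight_lt//.
    rewrite !mulr_sumr mulr_suml; apply: eq_bigr => i _; rewrite !mulr_sumr mulr_suml; apply: eq_bigr => j _.
    rewrite !mulr_sumr mulr_suml; apply: eq_bigr => l _.
    by case: ifP => _; rewrite ?mulr0 ?mul0r//; ring.
  apply: filterS2 aH (ae_good k0 pp) => w -> good.
  by rewrite (count_triangles k1 good).
rewrite /triangle_probability /typical_cell_law Eall Etri.
(* The extended inverse has a separate branch at 0, excluded since the mean number of cells K/(2k)
   is positive. *)
rewrite inver ifF; last by rewrite gt_eqF// mulr_gt0 ?exprn_gt0 ?invr_gt0// divr_gt0 ?mulr_gt0.
rewrite -EFinM; congr _%:E.
(* The quotient of the two means is 4W/(k K^2), which becomes the tangent form by K^-1 =
   tan(pi/(2k)). *)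
have -> : tan (pi / (2 * k%:R)) = K^-1 :> R by apply: (mulfI (lt0r_neq0 K0)); rewrite Kt divff// lt0r_neq0.
by field; rewrite !lt0r_neq0.
Qed.
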